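(* Let $\Gamma$ be an analytic Jordan curve (without cusps) bounding the simply connected domain $\Omega$, and let $\Pi=H+CHC$ acting on $\Lambda_\sigma(\Gamma)$. Then $\Pi$ admits a fixed point $F\in\Lambda_\sigma(\Gamma)$ that is not identically zero if and only if there exist non-constant $f\in A(\Gamma)$ and $g\in A'(\Gamma)$ with $f=\bar g$ on $\Gamma$. Moreover, if such $f$ and $g$ exist, then $\Pi f=f$ and $\Pi g=g$.
   Context: Fix $0<\sigma<1$. $\Omega$ is the interior domain of $\Gamma$ and $\Omega':=\widehat{\mathbb C}\setminus\overline\Omega$ the exterior domain (containing $\infty$). $\Lambda_\sigma(\Gamma)$ is the space of complex-valued Hölder continuous functions of order $\sigma$ on $\Gamma$. $A(\Gamma)$ is the set of restrictions to $\Gamma$ of functions that are $\sigma$-Hölder continuous on $\overline\Omega$ and holomorphic in $\Omega$; $A'(\Gamma)$ is the set of restrictions to $\Gamma$ of functions that are $\sigma$-Hölder continuous on $\overline{\Omega'}$, holomorphic in $\Omega'$, and vanish at $\infty$. The Hilbert operator $H:\Lambda_\sigma(\Gamma)\to\Lambda_\sigma(\Gamma)$ sends $F$ to the boundary values on $\Gamma$, taken from inside $\Omega$, of the Cauchy integral $f_i(z)=\frac{1}{2\pi i}\int_\Gamma \frac{F(\zeta)}{\zeta-z}\,d\zeta$, $z\in\Omega$; $H$ is a continuous idempotent with range $A(\Gamma)$ and kernel $A'(\Gamma)$. $C$ denotes complex conjugation, $CF=\overline F$. ($\Pi F$ equals the boundary values from $\Omega$ of the double layer potential $\frac1\pi\int_\Gamma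 F(\zeta)\,\partial_{N_\zeta}\log|z-\zeta|\,ds_\zeta$.) *)

(* Defs.v *)
From Stdlib Require Import Reals ClassicalEpsilon.
From Coquelicot Require Import Coquelicot.
Open Scope R_scope.
Open Scope C_scope.

(** The closed curve Gamma is given by a parametrization gam : R -> C of period 1. *)

Definition real_analytic (gam : R -> C) : Prop :=
  forall t0 : R, exists (a : nat -> C) (r : R), 0 < r /\
    forall t : R, (Rabs (t - t0) < r)%R ->
      @is_pseries R_AbsRing C_R_NormedModule a (t - t0)%R (gam t).

Definition analytic_jordan (gam : R -> C) : Prop :=
  (forall t, gam (t + 1)%R = gam t) /\
  (forall s t, (0 <= s < 1)%R -> (0 <= t < 1)%R -> gam s = gam t -> s = t) /\
  real_analytic gam /\
  (forall t, exists l : C, @is_derive R_AbsRing C_R_NormedModule gam t l /\ l <> 0).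

Definition onG (gam : R -> C) (z : C) : Prop := exists t : R, gam t = z.

(** the derivative gam'(t) (chosen; unique when it exists) *)
Definition dgam (gam : R -> C) (t : R) : C :=
  epsilon (inhabits (RtoC 0))
    (fun l => @is_derive R_AbsRing C_R_NormedModule gam t l).

Definition cint (gam : R -> C) (h : C -> C) : C :=
  @RInt C_R_CompleteNormedModule (fun t => h (gam t) * dgam gam t) 0%R 1%R.

Definition wind (gam : R -> C) (z : C) : C :=
  / (2 * RtoC PI * Ci) * cint gam (fun zeta => / (zeta - z)).

(** exterior domain Omega' (finite part): the unbounded component of C \ Gamma,
    i.e. points that can be joined, avoiding Gamma, to points of arbitrarily
    large modulus by a continuous path. *)
Definition extD (gam : R -> C) (z : C) : Prop :=
  ~ onG gam z /\
  forall M : R, exists p : R -> C,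
    (forall s, 0 <= s <= 1 -> @continuous R_UniformSpace C_UniformSpace p s) /\
    p 0 = z /\ M < Cmod (p 1) /\
    (forall s, 0 <= s <= 1 -> ~ onG gam (p s)).

Definition intD (gam : R -> C) (z : C) : Prop := ~ onG gam z /\ ~ extD gam z.

Definition pos_oriented (gam : R -> C) : Prop :=
  forall z, intD gam z -> wind gam z = 1.

Definition clos (S : C -> Prop) (z : C) : Prop :=
  forall eps : R, 0 < eps -> exists w, S w /\ Cmod (w - z) < eps.

Definition holder (sigma : R) (S : C -> Prop) (f : C -> C) : Prop :=
  exists K : R, forall z w, S z -> S w -> z <> w ->
    Cmod (f z - f w) <= K * Rpower (Cmod (z - w)) sigma.

Definition holo (U : C -> Prop) (f : C -> C) : Prop :=
  forall z, U z -> @ex_derive C_AbsRing C_NormedModule f z.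

(** Functions on Gamma are represented by functions C -> C, only their
    values on Gamma matter. *)
Definition Lambda (sigma : R) (gam : R -> C) (F : C -> C) : Prop :=
  holder sigma (onG gam) F.

Definition inA (sigma : R) (gam : R -> C) (F : C -> C) : Prop :=
  exists f : C -> C,
    holder sigma (clos (intD gam)) f /\ holo (intD gam) f /\
    forall z, onG gam z -> f z = F z.

Definition inA' (sigma : R) (gam : R -> C) (G : C -> C) : Prop :=
  exists g : C -> C,
    holder sigma (clos (extD gam)) g /\ holo (extD gam) g /\
    (forall eps : R, 0 < eps -> exists M : R, forall z,
        extD gam z -> M < Cmod z -> Cmod (g z) < eps) /\
    forall z, onG gam z -> g z = G z.

Definition cauchy (gam : R -> C) (F : C -> C) (z : C) : C :=
  / (2 * RtoC PI * Ci) * cint gam (fun zeta => F zeta / (zeta - z)).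

Definition Hop (gam : R -> C) (F : C -> C) (zeta : C) : C :=
  epsilon (inhabits (RtoC 0))
    (fun l => filterlim (cauchy gam F) (within (intD gam) (locally zeta)) (locally l)).

Definition Cop (F : C -> C) : C -> C := fun z => Cconj (F z).

Definition Piop (gam : R -> C) (F : C -> C) : C -> C :=
  fun z => Hop gam F z + Cop (Hop gam (Cop F)) z.

Definition nonconst (gam : R -> C) (F : C -> C) : Prop :=
  exists z w, onG gam z /\ onG gam w /\ F z <> F w.

(* Main.v *)
(** Write E F for the Cauchy integral of F, and z = gam t + i tau gam' t for points near the
    loop. The winding number is constant along paths avoiding the loop, hence 0 outside and, by
    orientation, 1 inside; since it jumps by one across the loop, small tau > 0 lies inside and
    small tau < 0 outside. For z, w off the loop and any constant A,

      E F z - E F w - A (wind z - wind w)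
        = 1/(2 pi i) int (F - A) (z - w) / ((zeta - z) (zeta - w)) dzeta.

    Taking for A the value of F at the foot of the normal through z, this gives both the Hölder
    continuity of E F on either side (push two points at distance delta off the loop by delta)
    and the jump relation: E F from inside minus E F from outside is F. Consequently
    H F belongs to A and F - H F to A'.

    That H f = f on A and H g = 0 on A' then follows from Liouville's theorem: E f - f inside and
    E f outside (respectively E g inside and E g + g outside) agree on the loop, so they form a
    continuous function on the plane, holomorphic off the loop and vanishing at infinity. Such a
    function is zero, because the loop is covered by O(n) cells of an n by n grid.

    If Pi F = F, then f = H (conj F) and g = F - H F satisfy f = conj g. If f is constant, then
    so is g, and g = 0 because the only constant in A' is 0; hence F is in A, conj F in A', and
    the pair F, conj F works. *)

Require Import Defs.
From Stdlib Require Import Reals Lra Lia ZArith Classical ClassicalEpsilon FunctionalExtensionality.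
From Coquelicot Require Import Coquelicot.
Open Scope R_scope.
Open Scope C_scope.

(* [cauchy] alone now refers to Coquelicot's Cauchy filters. *)
Notation cauchy_int := Defs.cauchy.

(** The interior is defined as whatever is neither on the loop nor joined to infinity, so nothing
    topological about it is known at the start. That both sides are open, that the interior is
    bounded and that every point of the loop is approached from both sides is read off the winding
    number. All local estimates rest on one inequality, [normal_pt_lower_bound]: [gam (t + s)] stays
    at distance at least c (|s| + |tau|) from the normal point of height tau over t, uniformly in t.
    It dominates the kernel (z - w) / ((zeta - z) (zeta - w)), and subtracting the value of F at the
    foot lowers the order of the singularity by sigma, which makes the majorant integrable. For z, w
    on one side the winding term cancels whatever A is; for z, w facing each other across the loop
    it equals A. Hence one estimate serves both purposes. In the Liouville step the glued function
    is not known to be differentiable on the loop. Instead of regaining regularity there, its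
    difference quotient at a point z0 is integrated over the boundary of a large square and compared
    with 1 / (w - z0). *)

Lemma Cmod_sub_sym (x y : C) : Cmod (x - y) = Cmod (y - x).
Proof. rewrite <- Cmod_opp. f_equal. ring. Qed.

Lemma Cmod_tri (x y z : C) : Cmod (x - z) <= Cmod (x - y) + Cmod (y - z).
Proof. replace (x - z) with ((x - y) + (y - z)) by ring. apply Cmod_triangle. Qed.

Lemma Cmod_sub_le (x y : C) : Cmod (x - y) <= Cmod x + Cmod y.
Proof. unfold Cminus. rewrite <- (Cmod_opp y). apply Cmod_triangle. Qed.

Lemma Cmod_le_sub (x y : C) : Cmod x <= Cmod y + Cmod (x - y).
Proof. replace x with (y + (x - y)) at 1 by ring. apply Cmod_triangle. Qed.

Lemma Cmod_sub_gt_0 (x y : C) : x <> y -> 0 < Cmod (x - y).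
Proof.
  intros H. apply Cmod_gt_0. intros E. apply H.
  replace x with (x - y + y) by ring. rewrite E. ring.
Qed.

Lemma Csub_neq_0 (x y : C) : x <> y -> x - y <> 0.
Proof. intros H. apply Cmod_gt_0, Cmod_sub_gt_0, H. Qed.

Lemma Re_le_Cmod (z : C) : Rabs (fst z) <= Cmod z.
Proof. apply Rle_trans with (2 := Rmax_Cmod z), Rmax_l. Qed.

Lemma Im_le_Cmod (z : C) : Rabs (snd z) <= Cmod z.
Proof. apply Rle_trans with (2 := Rmax_Cmod z), Rmax_r. Qed.

Lemma Cmod_le_Re_Im (z : C) : Cmod z <= Rabs (fst z) + Rabs (snd z).
Proof.
  replace z with (RtoC (fst z) + Ci * RtoC (snd z)).
  2:{ destruct z; unfold RtoC, Ci, Cplus, Cmult; simpl; f_equal; ring. }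
  eapply Rle_trans; [apply Cmod_triangle|].
  rewrite Cmod_mult, Cmod_Ci, !Cmod_R. destruct z; simpl.
  unfold RtoC, Cplus, Cmult, Ci; simpl.
  rewrite !Rmult_0_r, !Rmult_0_l, !Rmult_1_l, Rminus_0_r, !Rplus_0_r, !Rplus_0_l. lra.
Qed.

Lemma eq_of_Cmod_le_all (x y : C) :
  (forall eps : R, 0 < eps -> Cmod (x - y) <= eps) -> x = y.
Proof.
  intros H. apply NNPP; intros N. pose proof (Cmod_sub_gt_0 _ _ N).
  specialize (H (Cmod (x - y) / 2)%R). lra.
Qed.

(** * Continuity and integration of complex valued functions *)

(** Balls of [C_UniformSpace] are squares, being those of a product; halving the radius fits a
    square into a disk. *)
Lemma locally_Cmod (z : C) (P : C -> Prop) :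
  @locally C_UniformSpace z P <->
  exists d : R, 0 < d /\ forall w, Cmod (w - z) < d -> P w.
Proof.
  split.
  - intros [d H]. exists d. split; [apply cond_pos|]. intros w Hw. apply H.
    split; simpl.
    + eapply Rle_lt_trans; [|exact Hw]. apply (Re_le_Cmod (w - z)).
    + eapply Rle_lt_trans; [|exact Hw]. apply (Im_le_Cmod (w - z)).
  - intros [d [Hd H]].
    assert (H2 : 0 < d / 2) by lra.
    exists (mkposreal _ H2). intros w [H3 H4]. apply H.
    eapply Rle_lt_trans; [apply Cmod_le_Re_Im|].
    change (Rabs (fst w - fst z) < d/2) in H3. change (Rabs (snd w - snd z) < d/2) in H4.
    change (Rabs (fst w - fst z) + Rabs (snd w - snd z) < d). lra.
Qed.

Lemma ball_C_Cmod (z w : C) (e : posreal) :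
  Cmod (w - z) < e -> @ball C_UniformSpace z e w.
Proof.
  intros Hw. split; simpl.
  - eapply Rle_lt_trans; [|exact Hw]. apply (Re_le_Cmod (w - z)).
  - eapply Rle_lt_trans; [|exact Hw]. apply (Im_le_Cmod (w - z)).
Qed.

Lemma filterlim_Cmod {T : Type} (F : (T -> Prop) -> Prop) {FF : Filter F} (f : T -> C) (l : C) :
  filterlim f F (@locally C_UniformSpace l) <->
  forall eps : R, 0 < eps -> F (fun x => Cmod (f x - l) < eps).
Proof.
  split.
  - intros H eps He. apply (H (fun w => Cmod (w - l) < eps)).
    apply locally_Cmod. exists eps; auto.
  - intros H P HP. apply locally_Cmod in HP. destruct HP as [d [Hd HP]].
    unfold filtermap. apply (filter_imp (fun x => Cmod (f x - l) < d)); auto.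
Qed.

Notation cpt f t := (@continuous R_UniformSpace C_UniformSpace f t).
Definition cts (f : R -> C) : Prop := forall t, cpt f t.

Lemma cpt_iff (f : R -> C) (t : R) :
  cpt f t <-> forall eps : R, 0 < eps -> exists d : R, 0 < d /\
    forall s, (Rabs (s - t) < d)%R -> Cmod (f s - f t) < eps.
Proof.
  unfold continuous. rewrite (filterlim_Cmod (locally t)). split; intros H eps He.
  - destruct (H eps He) as [d Hd]. exists d. split; [apply cond_pos|]. intros s Hs. now apply Hd.
  - destruct (H eps He) as [d [Hd Hs]]. exists (mkposreal d Hd). intros s Hb. now apply Hs.
Qed.

Lemma cpt_components (f : R -> C) (t : R) :
  continuous (fun t => fst (f t)) t -> continuous (fun t => snd (f t)) t -> cpt f t.
Proof.
  intros H1 H2. apply cpt_iff. intros eps He.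
  assert (He2 : 0 < eps / 2) by lra.
  destruct (proj1 (filterlim_locally _ _) H1 (mkposreal _ He2)) as [d1 D1].
  destruct (proj1 (filterlim_locally _ _) H2 (mkposreal _ He2)) as [d2 D2].
  exists (Rmin d1 d2). split; [apply Rmin_pos; apply cond_pos|].
  intros s Hs. eapply Rle_lt_trans; [apply Cmod_le_Re_Im|].
  assert (A1 : Rabs (s - t) < d1) by (eapply Rlt_le_trans; [exact Hs|apply Rmin_l]).
  assert (A2 : Rabs (s - t) < d2) by (eapply Rlt_le_trans; [exact Hs|apply Rmin_r]).
  specialize (D1 s A1). specialize (D2 s A2).
  change (Rabs (fst (f s) - fst (f t)) < eps / 2) in D1.
  change (Rabs (snd (f s) - snd (f t)) < eps / 2) in D2.
  change (Rabs (fst (f s) - fst (f t)) + Rabs (snd (f s) - snd (f t)) < eps). lra.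
Qed.

Lemma cpt_fst (f : R -> C) (t : R) : cpt f t -> continuous (fun t => fst (f t)) t.
Proof.
  intros H. apply (continuous_comp f fst); [exact H|].
  destruct (f t). apply continuous_fst.
Qed.

Lemma cpt_snd (f : R -> C) (t : R) : cpt f t -> continuous (fun t => snd (f t)) t.
Proof.
  intros H. apply (continuous_comp f snd); [exact H|].
  destruct (f t). apply continuous_snd.
Qed.

Lemma cts_const (c : C) : cts (fun _ => c).
Proof. intros t. apply continuous_const. Qed.

Lemma cts_plus (f g : R -> C) : cts f -> cts g -> cts (fun t => f t + g t).
Proof.
  intros Hf Hg t. apply cpt_components; simpl.
  - apply (continuous_plus (V := R_NormedModule)); apply cpt_fst; auto.
  - apply (continuous_plus (V := R_NormedModule)); apply cpt_snd; auto.
Qed.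

Lemma cts_opp (f : R -> C) : cts f -> cts (fun t => - f t).
Proof.
  intros Hf t. apply cpt_components; simpl.
  - apply (continuous_opp (V := R_NormedModule)); apply cpt_fst; auto.
  - apply (continuous_opp (V := R_NormedModule)); apply cpt_snd; auto.
Qed.

Lemma cts_minus (f g : R -> C) : cts f -> cts g -> cts (fun t => f t - g t).
Proof. intros Hf Hg. apply cts_plus; [|apply cts_opp]; auto. Qed.

Lemma cts_mult (f g : R -> C) : cts f -> cts g -> cts (fun t => f t * g t).
Proof.
  intros Hf Hg t. apply cpt_components; simpl.
  - apply (continuous_minus (V := R_NormedModule));
    apply (continuous_mult (K := R_AbsRing)); (apply cpt_fst || apply cpt_snd); auto.
  - apply (continuous_plus (V := R_NormedModule));
    apply (continuous_mult (K := R_AbsRing)); (apply cpt_fst || apply cpt_snd); auto.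
Qed.

Lemma cts_inv (f : R -> C) : cts f -> (forall t, f t <> 0) -> cts (fun t => / f t).
Proof.
  intros Hf H0 t.
  assert (D : forall t, (fst (f t) ^ 2 + snd (f t) ^ 2 <> 0)%R).
  { intros s E. apply (H0 s). assert (fst (f s) = 0%R /\ snd (f s) = 0%R) as [E1 E2] by nra.
    destruct (f s); simpl in *. now subst. }
  assert (C2 : continuous (fun t => (fst (f t) ^ 2 + snd (f t) ^ 2))%R t).
  { apply (continuous_ext (fun t => fst (f t) * fst (f t) + snd (f t) * snd (f t))%R).
    { intros s; simpl; ring. }
    apply (continuous_plus (V := R_NormedModule));
    apply (continuous_mult (K := R_AbsRing)); (apply cpt_fst || apply cpt_snd); auto. }
  assert (CI : continuous (fun t => / (fst (f t) ^ 2 + snd (f t) ^ 2))%R t).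
  { apply (continuous_comp (fun t => (fst (f t) ^ 2 + snd (f t) ^ 2))%R Rinv); [exact C2|].
    apply continuous_Rinv. apply D. }
  apply cpt_components; simpl; apply (continuous_mult (K := R_AbsRing)).
  - apply cpt_fst; auto.
  - exact CI.
  - apply (continuous_opp (V := R_NormedModule)); apply cpt_snd; auto.
  - exact CI.
Qed.

Lemma cts_RtoC (f : R -> R) : (forall t, continuous f t) -> cts (fun t => RtoC (f t)).
Proof.
  intros H t. apply cpt_components; simpl; [apply H|apply continuous_const].
Qed.

Lemma cts_comp (f : R -> C) (g : R -> R) :
  cts f -> (forall t, continuous g t) -> cts (fun t => f (g t)).
Proof. intros Hf Hg t. apply (continuous_comp g f); [apply Hg|apply Hf]. Qed.

Definition CInt (f : R -> C) (a b : R) : C := @RInt C_R_CompleteNormedModule f a b.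

Lemma cts_ex_RInt (f : R -> C) (a b : R) : cts f -> @ex_RInt C_R_NormedModule f a b.
Proof. intros H. apply (ex_RInt_continuous (V := C_R_CompleteNormedModule)). intros; apply H. Qed.

Lemma CInt_correct (f : R -> C) (a b : R) :
  cts f -> @is_RInt C_R_NormedModule f a b (CInt f a b).
Proof. intros H. apply (RInt_correct (V := C_R_CompleteNormedModule)). now apply cts_ex_RInt. Qed.

Lemma CInt_unique (f : R -> C) (a b : R) (l : C) :
  @is_RInt C_R_NormedModule f a b l -> CInt f a b = l.
Proof. apply (is_RInt_unique (V := C_R_CompleteNormedModule)). Qed.

Lemma CInt_ext (f g : R -> C) (a b : R) : (forall t, f t = g t) -> CInt f a b = CInt g a b.
Proof. intros H. unfold CInt. f_equal. extensionality t. apply H. Qed.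

Lemma CInt_plus (f g : R -> C) (a b : R) :
  cts f -> cts g -> CInt (fun t => f t + g t) a b = CInt f a b + CInt g a b.
Proof.
  intros Hf Hg. apply CInt_unique.
  apply (is_RInt_plus (V := C_R_NormedModule)); now apply CInt_correct.
Qed.

Lemma CInt_fst (f : R -> C) (a b : R) : cts f ->
  is_RInt (fun t => fst (f t)) a b (fst (CInt f a b)).
Proof. intros H. apply (is_RInt_fct_extend_fst (U := R_NormedModule) (V := R_NormedModule)). now apply CInt_correct. Qed.

Lemma CInt_snd (f : R -> C) (a b : R) : cts f ->
  is_RInt (fun t => snd (f t)) a b (snd (CInt f a b)).
Proof. intros H. apply (is_RInt_fct_extend_snd (U := R_NormedModule) (V := R_NormedModule)). now apply CInt_correct. Qed.

(** The integral is taken in a real normed module, so linearity in a complex factor has to go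
    through the real and imaginary parts. *)
Lemma CInt_mult (c : C) (f : R -> C) (a b : R) :
  cts f -> CInt (fun t => c * f t) a b = c * CInt f a b.
Proof.
  intros Hf. apply CInt_unique.
  pose proof (CInt_fst f a b Hf) as H1. pose proof (CInt_snd f a b Hf) as H2.
  set (I := CInt f a b) in *. clearbody I.
  apply (is_RInt_fct_extend_pair (U := R_NormedModule) (V := R_NormedModule)).
  - pose proof (is_RInt_minus (V := R_NormedModule) _ _ _ _ _ _
      (is_RInt_scal (V := R_NormedModule) _ _ _ (fst c) _ H1)
      (is_RInt_scal (V := R_NormedModule) _ _ _ (snd c) _ H2)) as H. exact H.
  - pose proof (is_RInt_plus (V := R_NormedModule) _ _ _ _ _ _
      (is_RInt_scal (V := R_NormedModule) _ _ _ (fst c) _ H2)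
      (is_RInt_scal (V := R_NormedModule) _ _ _ (snd c) _ H1)) as H. exact H.
Qed.

Lemma CInt_minus (f g : R -> C) (a b : R) :
  cts f -> cts g -> CInt (fun t => f t - g t) a b = CInt f a b - CInt g a b.
Proof.
  intros Hf Hg. apply CInt_unique.
  apply (is_RInt_minus (V := C_R_NormedModule)); now apply CInt_correct.
Qed.

Lemma CInt_Chasles (f : R -> C) (a b c : R) :
  cts f -> CInt f a b + CInt f b c = CInt f a c.
Proof. intros Hf. apply (RInt_Chasles (V := C_R_CompleteNormedModule)); now apply cts_ex_RInt. Qed.

Lemma CInt_point (f : R -> C) (a : R) : CInt f a a = 0.
Proof. apply (RInt_point (V := C_R_CompleteNormedModule)). Qed.

Lemma CInt_shift (f : R -> C) (v a b : R) :
  cts f -> CInt (fun t => f (t + v)%R) a b = CInt f (a + v) (b + v).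
Proof.
  intros Hf.
  pose proof (RInt_comp_lin (V := C_R_CompleteNormedModule) f 1 v a b) as H.
  rewrite !Rmult_1_l in H. unfold CInt. rewrite <- H by now apply cts_ex_RInt.
  f_equal. extensionality t. rewrite Rmult_1_l.
  symmetry. apply (scal_one (V := C_R_ModuleSpace)).
Qed.

Lemma CInt_reflect (f : R -> C) (v a b : R) :
  cts f -> CInt (fun t => f (v - t)%R) a b = CInt f (v - b) (v - a).
Proof.
  intros Hf.
  assert (Hg : cts (fun t => f (v - t)%R)).
  { apply cts_comp; auto. intros t. apply (continuous_minus (V := R_NormedModule)).
    apply continuous_const. apply continuous_id. }
  pose proof (RInt_comp_lin (V := C_R_CompleteNormedModule) f (-1) v a b) as H.
  replace (-1 * a + v)%R with (v - a)%R in H by ring.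
  replace (-1 * b + v)%R with (v - b)%R in H by ring.
  assert (E : CInt f (v - a) (v - b) = (-(1)) * CInt (fun t => f (v - t)%R) a b).
  { rewrite <- CInt_mult by auto. unfold CInt. rewrite <- H by now apply cts_ex_RInt.
    f_equal. extensionality t. replace (-1 * t + v)%R with (v - t)%R by ring.
    rewrite scal_R_Cmult. f_equal. unfold RtoC, Copp; simpl. f_equal; ring. }
  assert (E2 : CInt f (v - a) (v - b) + CInt f (v - b) (v - a) = 0).
  { rewrite CInt_Chasles by auto. apply CInt_point. }
  rewrite E in E2.
  replace (CInt f (v - b) (v - a)) with ((- (1) * CInt (fun t : R => f (v - t)%R) a b +
      CInt f (v - b) (v - a)) + CInt (fun t : R => f (v - t)%R) a b) by ring.
  rewrite E2. ring.
Qed.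

Lemma Cmod_CInt_le (f : R -> C) (g : R -> R) (a b l : R) :
  a <= b -> cts f -> (forall t, a <= t <= b -> Cmod (f t) <= g t) ->
  is_RInt g a b l -> Cmod (CInt f a b) <= l.
Proof.
  intros Hab Hf Hg HI. rewrite Cmod_norm.
  apply (norm_RInt_le (V := C_R_NormedModule) f g a b); auto.
  - intros x Hx. rewrite <- Cmod_norm. now apply Hg.
  - now apply CInt_correct.
Qed.

Lemma Cmod_CInt_le_const (f : R -> C) (M a b : R) :
  a <= b -> cts f -> (forall t, a <= t <= b -> Cmod (f t) <= M) ->
  Cmod (CInt f a b) <= (b - a) * M.
Proof.
  intros Hab Hf Hg. apply (Cmod_CInt_le f (fun _ => M) a b); auto.
  apply (is_RInt_const (V := R_NormedModule)).
Qed.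

Lemma CInt_FTC (G g : R -> C) (a b : R) :
  (forall t, @is_derive R_AbsRing C_R_NormedModule G t (g t)) -> cts g ->
  CInt g a b = G b - G a.
Proof.
  intros HG Hg. apply CInt_unique.
  apply (is_RInt_derive (V := C_R_CompleteNormedModule) G g); intros; auto.
Qed.

Lemma Cmod_CInt_le_derive (f : R -> C) (B b : R -> R) (x y : R) :
  x <= y -> cts f ->
  (forall t, x <= t <= y -> Cmod (f t) <= b t) ->
  (forall t, x <= t <= y -> is_derive B t (b t)) ->
  (forall t, x <= t <= y -> continuous b t) ->
  Cmod (CInt f x y) <= B y - B x.
Proof.
  intros Hxy Hf Hb HB Hc. apply (Cmod_CInt_le f b x y); auto.
  apply (is_RInt_derive (V := R_CompleteNormedModule) B b);
  rewrite Rmin_left, Rmax_right by auto; auto.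
Qed.

Lemma CInt_period (f : R -> C) (t0 : R) :
  cts f -> (forall t, f (t + 1)%R = f t) -> CInt f t0 (t0 + 1) = CInt f 0 1.
Proof.
  intros Hf Hp.
  assert (E : CInt f 1 (t0 + 1) = CInt f 0 t0).
  { rewrite <- (Rplus_0_l 1) at 1. rewrite <- CInt_shift by auto. now apply CInt_ext. }
  assert (E0 : CInt f t0 0 + CInt f 0 t0 = 0).
  { rewrite CInt_Chasles by auto. apply CInt_point. }
  rewrite <- (CInt_Chasles f t0 0), <- (CInt_Chasles f 0 1 (t0 + 1)), E by auto.
  replace (CInt f t0 0 + (CInt f 0 1 + CInt f 0 t0)) with
    ((CInt f t0 0 + CInt f 0 t0) + CInt f 0 1) by ring.
  rewrite E0. ring.
Qed.

(** Folds a full period about [t0]. The distance estimates hold for parameters within 1/2 of the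
    foot and depend on |s| only, so both halves obey the same bound in u. *)
Lemma CInt_period_sym (f : R -> C) (t0 : R) :
  cts f -> (forall t, f (t + 1)%R = f t) ->
  CInt f 0 1 = CInt (fun u => f (u + t0)%R + f (t0 - u)%R) 0 (1 / 2).
Proof.
  intros Hf Hp.
  assert (H1 : cts (fun u => f (u + t0)%R)).
  { apply cts_comp; auto. intros t. apply (continuous_plus (V := R_NormedModule));
    [apply continuous_id|apply continuous_const]. }
  assert (H2 : cts (fun u => f (t0 - u)%R)).
  { apply cts_comp; auto. intros t. apply (continuous_minus (V := R_NormedModule));
    [apply continuous_const|apply continuous_id]. }
  rewrite CInt_plus, CInt_shift, CInt_reflect by auto.
  rewrite <- (CInt_period f (t0 - 1 / 2)) by auto.
  rewrite <- (CInt_Chasles f (t0 - 1/2) t0) by auto.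
  replace (t0 - 0)%R with t0 by ring. replace (0 + t0)%R with t0 by ring.
  replace (t0 - 1 / 2 + 1)%R with (1 / 2 + t0)%R by field. ring.
Qed.

(** * Derivatives *)

Notation is_derive_RC := (@is_derive R_AbsRing C_R_NormedModule).

Lemma is_derive_RC_iff (f : R -> C) (t : R) (l : C) :
  is_derive_RC f t l <->
  forall eps : R, 0 < eps -> exists d : R, 0 < d /\ forall s, Rabs (s - t) < d ->
    Cmod (f s - f t - RtoC (s - t) * l) <= eps * Rabs (s - t).
Proof.
  split.
  - intros [_ H] eps He.
    destruct (H t (fun P HP => HP) (mkposreal eps He)) as [d Hd].
    exists d. split; [apply cond_pos|]. intros s Hs. specialize (Hd s Hs).
    rewrite <- Cmod_norm in Hd. rewrite scal_R_Cmult in Hd. exact Hd.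
  - intros H. split; [apply is_linear_scal_l|].
    intros x Hx.
    apply (is_filter_lim_locally_unique (K := R_AbsRing) (V := R_NormedModule)) in Hx. subst x.
    intros eps. destruct (H eps (cond_pos eps)) as [d [Hd H']].
    exists (mkposreal d Hd). intros s Hs.
    rewrite <- Cmod_norm, scal_R_Cmult. now apply H'.
Qed.

Notation is_derive_CC := (@is_derive C_AbsRing C_NormedModule).

Lemma is_derive_CC_iff (f : C -> C) (z l : C) :
  is_derive_CC f z l <->
  forall eps : R, 0 < eps -> exists d : R, 0 < d /\ forall w, Cmod (w - z) < d ->
    Cmod (f w - f z - (w - z) * l) <= eps * Cmod (w - z).
Proof.
  split.
  - intros [_ H] eps He.
    destruct (H z (fun P HP => HP) (mkposreal eps He)) as [d Hd].
    exists d. split; [apply cond_pos|]. intros s Hs. exact (Hd s Hs).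
  - intros H. split; [apply is_linear_scal_l|].
    intros x Hx.
    apply (is_filter_lim_locally_unique (K := C_AbsRing) (V := AbsRing_NormedModule C_AbsRing)) in Hx. subst x.
    intros eps. destruct (H eps (cond_pos eps)) as [d [Hd H']].
    exists (mkposreal d Hd). intros s Hs. now apply H'.
Qed.

Lemma is_derive_RC_fst (f : R -> C) (t : R) (l : C) :
  is_derive_RC f t l -> is_derive (fun t => fst (f t)) t (fst l).
Proof.
  intros H. apply (filterdiff_comp' f (fun z : C_R_NormedModule => fst z)) with (2 := filterdiff_linear _ is_linear_fst) in H.
  exact H.
Qed.

Lemma is_derive_RC_snd (f : R -> C) (t : R) (l : C) :
  is_derive_RC f t l -> is_derive (fun t => snd (f t)) t (snd l).
Proof.
  intros H. apply (filterdiff_comp' f (fun z : C_R_NormedModule => snd z)) with (2 := filterdiff_linear _ is_linear_snd) in H.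
  exact H.
Qed.

Lemma is_derive_RC_unique (f : R -> C) (t : R) (l1 l2 : C) :
  is_derive_RC f t l1 -> is_derive_RC f t l2 -> l1 = l2.
Proof.
  intros H1 H2.
  pose proof (is_derive_unique _ _ _ (is_derive_RC_fst _ _ _ H1)) as A1.
  pose proof (is_derive_unique _ _ _ (is_derive_RC_fst _ _ _ H2)) as A2.
  pose proof (is_derive_unique _ _ _ (is_derive_RC_snd _ _ _ H1)) as A3.
  pose proof (is_derive_unique _ _ _ (is_derive_RC_snd _ _ _ H2)) as A4.
  destruct l1, l2; simpl in *. congruence.
Qed.

Lemma is_derive_RC_continuous (f : R -> C) (t : R) (l : C) :
  is_derive_RC f t l -> cpt f t.
Proof.
  intros H. apply (ex_derive_continuous (V := C_R_NormedModule)). now exists l.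
Qed.

(** * Regularity of the curve *)

Definition regular_loop (gam : R -> C) : Prop :=
  (forall t, gam (t + 1)%R = gam t) /\
  (forall s t, (0 <= s < 1)%R -> (0 <= t < 1)%R -> gam s = gam t -> s = t) /\
  (forall t, is_derive_RC gam t (dgam gam t)) /\
  cts (dgam gam) /\
  (forall t, dgam gam t <> 0).

Lemma is_pseries_components (a : nat -> C) (x : R) (l : C) :
  @is_pseries R_AbsRing C_R_NormedModule a x l ->
  is_pseries (fun n => fst (a n)) x (fst l) /\ is_pseries (fun n => snd (a n)) x (snd l).
Proof.
  intros H.
  assert (E : forall n, sum_n (fun k => @scal R_AbsRing C_R_NormedModule (pow_n x k) (a k)) n =
    (sum_n (fun k => @scal R_AbsRing R_NormedModule (pow_n x k) (fst (a k))) n,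
     sum_n (fun k => @scal R_AbsRing R_NormedModule (pow_n x k) (snd (a k))) n)).
  { induction n as [|n IH].
    - rewrite !sum_O. reflexivity.
    - rewrite !sum_Sn, IH. reflexivity. }
  unfold is_pseries, is_series in *. split.
  - apply (filterlim_comp _ _ _ _ fst _ _ (locally (fst l))) in H.
    + eapply filterlim_ext; [|exact H]. intros n; cbv beta. now rewrite E.
    + destruct l; apply continuous_fst.
  - apply (filterlim_comp _ _ _ _ snd _ _ (locally (snd l))) in H.
    + eapply filterlim_ext; [|exact H]. intros n; cbv beta. now rewrite E.
    + destruct l; apply continuous_snd.
Qed.

(** A point strictly between the radius of convergence and [r] would have a convergent series, hence
    terms tending to zero, which is impossible outside the disk of convergence. *)
Lemma CV_radius_ge (a : nat -> R) (r : R) :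
  (forall x, Rabs x < r -> ex_pseries a x) -> Rbar_le r (CV_radius a).
Proof.
  intros H. apply Rbar_not_lt_le. intros L.
  assert (exists x, Rabs x < r /\ Rbar_lt (CV_radius a) (Rabs x)) as [x [X1 X2]].
  { pose proof (CV_radius_ge_0 a) as G. destruct (CV_radius a) as [c| |]; simpl in *; try tauto.
    exists ((c + r) / 2)%R. rewrite Rabs_pos_eq; lra. }
  apply (CV_disk_outside _ _ X2). destruct (H x X1) as [l Hl].
  apply (is_lim_seq_ext (fun k => @scal R_AbsRing R_NormedModule (pow_n x k) (a k))).
  - intros n. rewrite pow_n_pow. unfold scal; simpl. unfold mult; simpl. ring.
  - apply ex_series_lim_0. now exists l.
Qed.

(** Near [t0] the derivative is the sum of the series differentiated term by term, which has the
    same radius of convergence. *)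
Lemma derive_pseries_continuous (a : nat -> R) (f g : R -> R) (t0 r : R) :
  0 < r -> (forall t, Rabs (t - t0) < r -> is_pseries a (t - t0)%R (f t)) ->
  (forall t, is_derive f t (g t)) -> continuous g t0.
Proof.
  intros Hr Ha Hg.
  assert (CV : Rbar_le r (CV_radius a)).
  { apply CV_radius_ge. intros x Hx. exists (f (t0 + x)%R).
    specialize (Ha (t0 + x)%R). replace (t0 + x - t0)%R with x in Ha by ring. exact (Ha Hx). }
  assert (CV' : forall x, Rabs x < r -> Rbar_lt (Rabs x) (CV_radius a)).
  { intros x Hx. eapply Rbar_lt_le_trans; [|exact CV]. exact Hx. }
  assert (L : locally t0 (fun t => PSeries (PS_derive a) (t - t0)%R = g t)).
  { exists (mkposreal r Hr). intros t Ht. change (Rabs (t - t0) < r) in Ht.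
    rewrite <- (is_derive_unique _ _ _ (Hg t)).
    symmetry. apply is_derive_unique.
    apply (is_derive_ext_loc (fun t => PSeries a (t - t0)%R)).
    - assert (Hp : 0 < r - Rabs (t - t0)) by lra.
      exists (mkposreal _ Hp). intros s Hs. change (Rabs (s - t) < r - Rabs (t - t0)) in Hs.
      apply is_pseries_unique. apply Ha.
      replace (s - t0)%R with ((s - t) + (t - t0))%R by ring.
      eapply Rle_lt_trans; [apply Rabs_triang|]. lra.
    - pose proof (is_derive_PSeries a (t - t0) (CV' _ Ht)) as D.
      replace (PSeries (PS_derive a) (t - t0)) with
        (@scal R_AbsRing R_NormedModule 1%R (PSeries (PS_derive a) (t - t0))) by apply Rmult_1_l.
      apply (is_derive_comp (K := R_AbsRing) (PSeries a) (fun t => t - t0)%R); [exact D|].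
      auto_derive; auto; ring. }
  apply (continuous_ext_loc _ (fun t => PSeries (PS_derive a) (t - t0)%R)); [exact L|].
  apply (continuous_comp (fun t => t - t0)%R (PSeries (PS_derive a))).
  - apply (continuous_minus (V := R_NormedModule)); [apply continuous_id|apply continuous_const].
  - apply continuity_pt_filterlim. apply PSeries_continuity.
    rewrite CV_radius_derive. apply CV'. replace (t0 - t0)%R with 0%R by ring. now rewrite Rabs_R0.
Qed.

Lemma analytic_jordan_regular (gam : R -> C) : analytic_jordan gam -> regular_loop gam.
Proof.
  intros (Hp & Hi & Ha & Hd).
  assert (HD : forall t, is_derive_RC gam t (dgam gam t)).
  { intros t. unfold dgam. apply epsilon_spec. destruct (Hd t) as [l [Hl _]]. now exists l. }
  split; [exact Hp|split; [exact Hi|split; [exact HD|split]]].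
  - intros t. destruct (Ha t) as (a & r & Hr & H).
    apply cpt_components.
    + apply (derive_pseries_continuous (fun n => fst (a n)) (fun t => fst (gam t)) _ t r Hr).
      * intros s Hs. now apply is_pseries_components, H.
      * intros s. now apply is_derive_RC_fst.
    + apply (derive_pseries_continuous (fun n => snd (a n)) (fun t => snd (gam t)) _ t r Hr).
      * intros s Hs. now apply is_pseries_components, H.
      * intros s. now apply is_derive_RC_snd.
  - intros t. destruct (Hd t) as [l [Hl Hl0]].
    now rewrite (is_derive_RC_unique _ _ _ _ (HD t) Hl).
Qed.

(** * Periodic functions: bounds and uniform continuity *)

Definition periodic (f : R -> C) : Prop := forall t, f (t + 1)%R = f t.

Lemma periodic_IZR (f : R -> C) (n : Z) (t : R) : periodic f -> f (t + IZR n)%R = f t.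
Proof.
  intros Hp.
  assert (P : forall (k : nat) t, f (t + INR k)%R = f t).
  { induction k as [|k IH]; intros u.
    - simpl. f_equal; ring.
    - rewrite S_INR. replace (u + (INR k + 1))%R with ((u + INR k) + 1)%R by ring.
      now rewrite Hp. }
  destruct (Z_le_gt_dec 0 n) as [H|H].
  - rewrite <- (Z2Nat.id n) by auto. rewrite <- INR_IZR_INZ. apply P.
  - rewrite <- (P (Z.to_nat (- n)) (t + IZR n)%R).
    rewrite INR_IZR_INZ, Z2Nat.id, opp_IZR by lia. f_equal. ring.
Qed.

Lemma reduce_mod_1 (t : R) : exists n : Z, 0 <= t + IZR n < 1.
Proof.
  exists (- Int_part t)%Z. rewrite opp_IZR.
  destruct (base_Int_part t). lra.
Qed.

Lemma Cmod_continuity_pt (f : R -> C) (t : R) : cpt f t -> continuity_pt (fun t => Cmod (f t)) t.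
Proof.
  intros H. apply continuity_pt_filterlim, (filterlim_locally (F := locally t)).
  intros eps. destruct (proj1 (cpt_iff f t) H eps (cond_pos eps)) as [d [Hd K]].
  exists (mkposreal d Hd). intros s Hs. specialize (K s Hs).
  change (Rabs (Cmod (f s) - Cmod (f t)) < eps).
  apply Rabs_def1.
  - pose proof (Cmod_le_sub (f s) (f t)). lra.
  - pose proof (Cmod_le_sub (f t) (f s)). rewrite Cmod_sub_sym in H0. lra.
Qed.

Lemma periodic_bounded (f : R -> C) : cts f -> periodic f ->
  exists M, 0 < M /\ forall t, Cmod (f t) <= M.
Proof.
  intros Hf Hp.
  destruct (continuity_ab_maj (fun t => Cmod (f t)) 0 1) as [u [Hu _]]; [lra| |].
  { intros c _. now apply Cmod_continuity_pt. }
  exists (Cmod (f u) + 1)%R. split; [pose proof (Cmod_ge_0 (f u)); lra|].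
  intros t. destruct (reduce_mod_1 t) as [n Hn].
  rewrite <- (periodic_IZR f n t Hp). specialize (Hu (t + IZR n)%R). lra.
Qed.

Lemma periodic_bounded_below (f : R -> C) : cts f -> periodic f -> (forall t, f t <> 0) ->
  exists m, 0 < m /\ forall t, m <= Cmod (f t).
Proof.
  intros Hf Hp H0.
  destruct (continuity_ab_min (fun t => Cmod (f t)) 0 1) as [u [Hu _]]; [lra| |].
  { intros c _. now apply Cmod_continuity_pt. }
  exists (Cmod (f u)). split; [apply Cmod_gt_0, H0|].
  intros t. destruct (reduce_mod_1 t) as [n Hn].
  rewrite <- (periodic_IZR f n t Hp). apply Hu. lra.
Qed.

Lemma periodic_unifcont (f : R -> C) (eps : R) : cts f -> periodic f -> 0 < eps ->
  exists d, 0 < d /\ forall s t, Rabs (s - t) <= d -> Cmod (f s - f t) <= eps.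
Proof.
  intros Hf Hp He.
  assert (He2 : 0 < eps / 2) by lra.
  (* Once [t] is shifted into [0, 1), a point [s] within 1 of it lies in [-1, 2]. *)
  destruct (unifcont_1d (V := C_UniformSpace) f (-1) 2 (fun x _ => Hf x) (mkposreal _ He2)) as [d Hd].
  exists (Rmin (d / 2) 1). split.
  { apply Rmin_pos; [pose proof (cond_pos d); lra|lra]. }
  intros s t Hst.
  assert (A1 : Rabs (s - t) <= d / 2) by (eapply Rle_trans; [exact Hst|apply Rmin_l]).
  assert (A2 : Rabs (s - t) <= 1) by (eapply Rle_trans; [exact Hst|apply Rmin_r]).
  destruct (reduce_mod_1 t) as [n Hn].
  rewrite <- (periodic_IZR f n t Hp), <- (periodic_IZR f n s Hp).
  assert (A3 : (s + IZR n - (t + IZR n) = s - t)%R) by ring.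
  assert (A4 : -1 <= s + IZR n <= 2) by (apply Rabs_le_between in A2; lra).
  pose proof (cond_pos d).
  assert (B : ball (t + IZR n)%R d (s + IZR n)%R).
  { change (Rabs (s + IZR n - (t + IZR n)) < d). rewrite A3. lra. }
  specialize (Hd (t + IZR n)%R (s + IZR n)%R ltac:(lra) A4 B).
  apply NNPP in Hd. destruct Hd as [H1 H2].
  eapply Rle_trans; [apply Cmod_le_Re_Im|].
  set (p := f (s + IZR n)%R) in *. set (q := f (t + IZR n)%R) in *.
  change (Rabs (fst p - fst q) < eps / 2) in H1. change (Rabs (snd p - snd q) < eps / 2) in H2.
  change (Rabs (fst p - fst q) + Rabs (snd p - snd q) <= eps). lra.
Qed.

(** A complex-valued function has no mean value point; the bound comes from integrating g - c. *)
Lemma Cmod_mean_value (G g : R -> C) (c : C) (a b eta : R) :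
  (forall t, is_derive_RC G t (g t)) -> cts g -> a <= b ->
  (forall t, a <= t <= b -> Cmod (g t - c) <= eta) ->
  Cmod (G b - G a - RtoC (b - a) * c) <= (b - a) * eta.
Proof.
  intros HG Hg Hab Hc.
  replace (G b - G a - RtoC (b - a) * c) with (CInt (fun t => g t - c) a b).
  - apply Cmod_CInt_le_const; auto. apply cts_minus; auto. apply cts_const.
  - rewrite CInt_minus by (auto; apply cts_const). rewrite (CInt_FTC G g) by auto.
    f_equal. f_equal. apply CInt_unique. rewrite <- scal_R_Cmult.
    apply (is_RInt_const (V := C_R_NormedModule)).
Qed.

(** * Geometry of the loop: chords, normals, nearest points *)

Section Loop.
Context (gam : R -> C) (Hreg : regular_loop gam).
Notation dg := (dgam gam).

Let gam_periodic : periodic gam := proj1 Hreg.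
Let gam_inj := proj1 (proj2 Hreg).
Let gam_derive : forall t, is_derive_RC gam t (dg t) := proj1 (proj2 (proj2 Hreg)).
Let dg_cts : cts dg := proj1 (proj2 (proj2 (proj2 Hreg))).
Let dg_neq_0 : forall t, dg t <> 0 := proj2 (proj2 (proj2 (proj2 Hreg))).

Lemma loop_cts : cts gam.
Proof. intros t. apply (is_derive_RC_continuous _ _ _ (gam_derive t)). Qed.

Lemma dgam_periodic : periodic dg.
Proof.
  intros t. apply (is_derive_RC_unique gam t); auto.
  apply is_derive_RC_iff. intros eps He.
  destruct (proj1 (is_derive_RC_iff _ _ _) (gam_derive (t + 1)%R) eps He) as [d [Hd H]].
  exists d. split; auto. intros s Hs. specialize (H (s + 1)%R).
  rewrite !gam_periodic in H. replace (s + 1 - (t + 1))%R with (s - t)%R in H by ring. auto.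
Qed.

Lemma dgam_bounds : exists m L, 0 < m /\ 0 < L /\ forall t, m <= Cmod (dg t) <= L.
Proof.
  destruct (periodic_bounded dg dg_cts dgam_periodic) as [L [HL1 HL2]].
  destruct (periodic_bounded_below dg dg_cts dgam_periodic dg_neq_0) as [m [Hm1 Hm2]].
  exists m, L. repeat split; auto.
Qed.

Lemma loop_uniform_derive (eta : R) : 0 < eta ->
  exists s0, 0 < s0 <= 1 / 2 /\ forall t s, Rabs s <= s0 ->
    Cmod (dg (t + s) - dg t) <= eta /\
    Cmod (gam (t + s) - gam t - RtoC s * dg t) <= eta * Rabs s.
Proof.
  intros He. destruct (periodic_unifcont dg eta dg_cts dgam_periodic He) as [d [Hd K]].
  exists (Rmin d (1 / 2)). split.
  { split; [apply Rmin_pos; lra|apply Rmin_r]. }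
  intros t s Hs. assert (Hs' : Rabs s <= d) by (eapply Rle_trans; [exact Hs|apply Rmin_l]).
  split.
  - apply K. now replace (t + s - t)%R with s by ring.
  - destruct (Rle_dec 0 s) as [P|P].
    + rewrite Rabs_pos_eq in * by lra.
      pose proof (Cmod_mean_value gam dg (dg t) t (t + s) eta gam_derive dg_cts) as M.
      replace (t + s - t)%R with s in M by ring. rewrite (Rmult_comm eta). apply M; [lra|].
      intros u Hu. apply K. apply Rabs_le. lra.
    + rewrite Rabs_left in * by lra.
      pose proof (Cmod_mean_value gam dg (dg t) (t + s) t eta gam_derive dg_cts) as M.
      replace (t - (t + s))%R with (- s)%R in M by ring. rewrite (Rmult_comm eta).
      rewrite <- Cmod_opp.
      replace (- (gam (t + s) - gam t - s * dg t)) with (gam t - gam (t + s) - RtoC (- s) * dg t).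
      2:{ rewrite RtoC_opp. ring. }
      apply M; [lra|]. intros u Hu. apply K. apply Rabs_le. lra.
Qed.

Lemma loop_lipschitz (L : R) : (forall t, Cmod (dg t) <= L) ->
  forall s t, Cmod (gam s - gam t) <= L * Rabs (s - t).
Proof.
  intros HL.
  assert (W : forall s t, s <= t -> Cmod (gam t - gam s) <= L * (t - s)).
  { intros s t Hst. pose proof (Cmod_mean_value gam dg 0 s t L gam_derive dg_cts Hst) as M.
    replace (gam t - gam s - RtoC (t - s) * 0) with (gam t - gam s) in M by ring.
    rewrite Rmult_comm. apply M. intros u _. replace (dg u - 0) with (dg u) by ring. apply HL. }
  intros s t. destruct (Rle_dec s t).
  - rewrite Cmod_sub_sym, Rabs_minus_sym, Rabs_pos_eq by lra. now apply W.
  - rewrite Rabs_pos_eq by lra. apply W. lra.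
Qed.

Lemma loop_inj_period (t s : R) : gam (t + s)%R = gam t -> exists n : Z, s = IZR n.
Proof.
  intros E. destruct (reduce_mod_1 t) as [n Hn]. destruct (reduce_mod_1 (t + s)) as [k Hk].
  exists (n - k)%Z. rewrite minus_IZR.
  assert (t + s + IZR k = t + IZR n)%R; [|lra].
  apply gam_inj; auto. now rewrite !periodic_IZR.
Qed.

(** Injectivity made quantitative by compactness. The range s0 <= |s| <= 1/2 contains no integer, so
    no chord in it degenerates. *)
Lemma loop_separation (s0 : R) : 0 < s0 ->
  exists c, 0 < c /\ forall t s, s0 <= Rabs s <= 1 / 2 -> c <= Cmod (gam (t + s) - gam t).
Proof.
  intros Hs0.
  destruct dgam_bounds as (m & L & Hm & HL & HmL).
  assert (Lip := loop_lipschitz L (fun t => proj2 (HmL t))).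
  set (D := fun t s => Cmod (gam (t + s) - gam t)).
  assert (Dlip : forall t s t' s', D t s <= D t' s' + L * (2 * Rabs (t' - t) + Rabs (s' - s))).
  { intros t s t' s'. unfold D.
    pose proof (Cmod_tri (gam (t + s)) (gam (t' + s')) (gam t)).
    pose proof (Cmod_tri (gam (t' + s')) (gam t') (gam t)).
    pose proof (Lip (t + s) (t' + s'))%R. pose proof (Lip t' t).
    assert (Rabs (t + s - (t' + s')) <= Rabs (t' - t) + Rabs (s' - s)).
    { replace (t + s - (t' + s'))%R with (- ((t' - t) + (s' - s)))%R by ring.
      rewrite Rabs_Ropp. apply Rabs_triang. }
    assert (L * Rabs (t + s - (t' + s')) <= L * (Rabs (t' - t) + Rabs (s' - s))).
    { apply Rmult_le_compat_l; lra. }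
    lra. }
  (* The gauge at (t, s) is proportional to D t s, so its uniform lower bound
     on the compact parameter rectangle bounds D from below. *)
  assert (Q : forall a b, (forall s, a <= s <= b -> s0 <= Rabs s <= 1 / 2) ->
    exists c, 0 < c /\ forall t s, 0 <= t <= 1 -> a <= s <= b -> c <= D t s).
  { intros a b Hab.
    (* Within the gauge, D varies by at most L (2 |dt| + |ds|) <= 3 L (D / (6 L)) = D / 2. The value
       1 is a filler for D = 0, a case excluded below by injectivity. *)
    assert (G : forall t s, 0 < if Rlt_dec 0 (D t s) then D t s / (6 * L) else 1).
    { intros t s. destruct (Rlt_dec 0 (D t s)); [apply Rdiv_lt_0_compat|]; lra. }
    destruct (compactness_value_2d 0 1 a b (fun t s => mkposreal _ (G t s))) as [d Hd].
    exists (3 * L * d)%R. split.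
    { pose proof (cond_pos d). nra. }
    intros t s Ht Hs. specialize (Hd t s Ht Hs). apply NNPP in Hd.
    destruct Hd as (u & v & Hu & Hv & H1 & H2 & H3). simpl in *.
    destruct (Rlt_dec 0 (D u v)) as [P|P].
    - pose proof (Dlip u v t s) as E. 
      assert (E2 : (6 * L * (D u v / (6 * L)) = D u v)%R) by (field; lra).
      set (q := (D u v / (6 * L))%R) in *.
      assert (L * (2 * Rabs (t - u) + Rabs (s - v)) <= L * (3 * q)) by (apply Rmult_le_compat_l; lra).
      assert (L * d <= L * q) by (apply Rmult_le_compat_l; lra). lra.
    - exfalso. apply P. unfold D. apply Cmod_sub_gt_0. intros E.
      destruct (loop_inj_period _ _ E) as [n Hn]. specialize (Hab v Hv). subst v.
      rewrite <- abs_IZR in Hab.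
      assert (0 < Z.abs n)%Z by (apply lt_IZR; lra).
      assert (Z.abs n < 1)%Z by (apply lt_IZR; lra). lia. }
  destruct (Q s0 (1 / 2)%R) as [c1 [C1 K1]].
  { intros s Hs. rewrite Rabs_pos_eq; lra. }
  destruct (Q (- (1 / 2))%R (- s0)%R) as [c2 [C2 K2]].
  { intros s Hs. rewrite Rabs_left1; lra. }
  exists (Rmin c1 c2). split; [now apply Rmin_pos|].
  intros t s Hs. destruct (reduce_mod_1 t) as [n Hn].
  replace (Cmod (gam (t + s) - gam t)) with (D (t + IZR n) s)%R.
  2:{ unfold D. replace (t + IZR n + s)%R with (t + s + IZR n)%R by ring.
      now rewrite !periodic_IZR. }
  destruct (Rle_dec 0 s) as [P|P].
  - rewrite Rabs_pos_eq in Hs by lra. eapply Rle_trans; [apply Rmin_l|]. apply K1; lra.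
  - rewrite Rabs_left in Hs by lra. eapply Rle_trans; [apply Rmin_r|]. apply K2; lra.
Qed.

(** The tangent line at t evaluated at the complex parameter t + i tau. The normal i gam' is not
    normalised, so that [gam (t + s)] minus this point is (s - i tau) gam' t to first order. *)
Definition normal_pt (t tau : R) : C := gam t + Ci * RtoC tau * dg t.

Lemma Cmod_add_Ci (s tau : R) : Rabs s + Rabs tau <= 2 * Cmod (RtoC s - Ci * RtoC tau).
Proof.
  pose proof (Re_le_Cmod (RtoC s - Ci * RtoC tau)) as H1.
  pose proof (Im_le_Cmod (RtoC s - Ci * RtoC tau)) as H2.
  assert (E : RtoC s - Ci * RtoC tau = (s, (- tau)%R)).
  { unfold Cminus, Cplus, Copp, Cmult, Ci, RtoC; simpl. f_equal; ring. }
  rewrite E in *. simpl in *. rewrite Rabs_Ropp in H2. lra.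
Qed.

(** For small s the main term (s - i tau) gam' t has modulus at least m (|s| + |tau|) / 2, and the
    error m |s| / 4 leaves the constant m / 4. For the other s the chord is bounded below and tau is
    too small to matter. *)
Lemma normal_pt_lower_bound : exists c tau1, 0 < c /\ 0 < tau1 /\
  forall t s tau, Rabs s <= 1 / 2 -> Rabs tau <= tau1 ->
    c * (Rabs s + Rabs tau) <= Cmod (gam (t + s) - normal_pt t tau).
Proof.
  destruct dgam_bounds as (m & L & Hm & HL & HmL).
  destruct (loop_uniform_derive (m / 4)%R) as (s0 & Hs0 & U); [lra|].
  destruct (loop_separation s0) as (c0 & Hc0 & Sep); [lra|].
  (* The normal displacement, at most L tau, then uses up no more than half of the chord bound
     c0. *)
  set (tau1 := Rmin (1 / 2) (c0 / (2 * L))).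
  assert (T1 : tau1 <= 1 / 2) by apply Rmin_l.
  assert (T2 : L * tau1 <= c0 / 2).
  { replace (c0 / 2)%R with (L * (c0 / (2 * L)))%R by (field; lra).
    apply Rmult_le_compat_l; [lra|apply Rmin_r]. }
  assert (T0 : 0 < tau1).
  { apply Rmin_pos; [lra|]. apply Rdiv_lt_0_compat; lra. }
  set (c := Rmin (m / 4) (c0 / 2)).
  assert (Cp : 0 < c) by (apply Rmin_pos; lra).
  assert (Cl : c <= m / 4) by apply Rmin_l.
  assert (Cr : c <= c0 / 2) by apply Rmin_r.
  exists c, tau1. split; [auto|split; [auto|]].
  intros t s tau Hs Htau.
  pose proof (Rabs_pos s). pose proof (Rabs_pos tau).
  destruct (Rle_dec (Rabs s) s0) as [P|P].
  - destruct (U t s P) as [_ V]. unfold normal_pt.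
    set (r := gam (t + s) - gam t - RtoC s * dg t) in *.
    assert (E : (RtoC s - Ci * RtoC tau) * dg t = (gam (t + s) - (gam t + Ci * RtoC tau * dg t)) - r)
      by (unfold r; ring).
    pose proof (Cmod_add_Ci s tau) as A.
    assert (B : Cmod (RtoC s - Ci * RtoC tau) * m <=
      Cmod (gam (t + s) - (gam t + Ci * RtoC tau * dg t)) + m / 4 * Rabs s).
    { apply Rle_trans with (Cmod ((RtoC s - Ci * RtoC tau) * dg t)).
      - rewrite Cmod_mult. apply Rmult_le_compat_l; [apply Cmod_ge_0|apply HmL].
      - rewrite E. eapply Rle_trans; [apply Cmod_sub_le|]. lra. }
    assert (c * (Rabs s + Rabs tau) <= m / 4 * (Rabs s + Rabs tau)) by (apply Rmult_le_compat_r; lra).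
    nra.
  - pose proof (Sep t s ltac:(lra)) as S1. unfold normal_pt.
    assert (E : gam (t + s) - gam t = (gam (t + s) - (gam t + Ci * RtoC tau * dg t)) + Ci * RtoC tau * dg t) by ring.
    rewrite E in S1.
    assert (B : Cmod (Ci * RtoC tau * dg t) <= L * tau1).
    { rewrite !Cmod_mult, Cmod_Ci, Cmod_R, Rmult_1_l, Rmult_comm.
      apply Rmult_le_compat; auto; try apply Cmod_ge_0; apply HmL. }
    pose proof (Cmod_triangle (gam (t + s) - (gam t + Ci * RtoC tau * dg t)) (Ci * RtoC tau * dg t)).
    assert (c * (Rabs s + Rabs tau) <= c0 / 2 * 1) by (apply Rmult_le_compat; lra). lra.
Qed.

(** At a minimum of the distance, z - gam t is orthogonal to gam' t, so their quotient is purely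
    imaginary and z lies on the normal at t. *)
Lemma nearest_point (z : C) : exists t, 
  (forall u, Cmod (gam t - z) <= Cmod (gam u - z)) /\
  exists tau, z = normal_pt t tau.
Proof.
  assert (Cz : cts (fun t => gam t - z)) by (apply cts_minus; [apply loop_cts|apply cts_const]).
  destruct (continuity_ab_min (fun t => Cmod (gam t - z)) 0 1) as [t [Ht _]]; [lra| |].
  { intros c _. apply (Cmod_continuity_pt (fun t => gam t - z)), Cz. }
  assert (Min : forall u, Cmod (gam t - z) <= Cmod (gam u - z)).
  { intros u. destruct (reduce_mod_1 u) as [n Hn].
    rewrite <- (periodic_IZR gam n u) by auto. apply Ht; lra. }
  exists t. split; [exact Min|].
  set (f := fun u => ((fst (gam u) - fst z) ^ 2 + (snd (gam u) - snd z) ^ 2)%R).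
  assert (Fd : is_derive f t (2 * ((fst (gam t) - fst z) * fst (dg t) + (snd (gam t) - snd z) * snd (dg t)))%R).
  { pose proof (is_derive_RC_fst _ _ _ (gam_derive t)) as D1.
    pose proof (is_derive_RC_snd _ _ _ (gam_derive t)) as D2.
    unfold f. evar_last.
    - apply (is_derive_plus (V := R_NormedModule));
      apply (is_derive_pow _ 2); apply (is_derive_minus (V := R_NormedModule));
      [exact D1|apply is_derive_const|exact D2|apply is_derive_const].
    - unfold plus, minus, opp, zero; simpl. unfold plus, opp; simpl. ring. }
  assert (F0 : (2 * ((fst (gam t) - fst z) * fst (dg t) + (snd (gam t) - snd z) * snd (dg t)) = 0)%R).
  { apply is_derive_Reals in Fd.
    rewrite <- (derive_pt_eq_0 f t _ (exist _ _ Fd) Fd).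
    apply (deriv_minimum f (t - 1) (t + 1)); [lra|lra|].
    intros u _ _. specialize (Min u). unfold f.
    assert (E : forall v, ((fst (gam v) - fst z) ^ 2 + (snd (gam v) - snd z) ^ 2 = Cmod (gam v - z) ^ 2)%R).
    { intros v. rewrite Cmod2_alt. reflexivity. }
    rewrite !E. apply pow_incr. split; auto. apply Cmod_ge_0. }
  set (q := (z - gam t) / dg t).
  assert (Eq : z - gam t = q * dg t) by (unfold q; field; auto).
  clearbody q.
  assert (Q0 : fst q = 0%R).
  { assert (N : (fst (dg t) ^ 2 + snd (dg t) ^ 2 <> 0)%R).
    { intros E. apply (dg_neq_0 t). assert (fst (dg t) = 0%R /\ snd (dg t) = 0%R) as [E1 E2] by nra.
      destruct (dg t); simpl in *; now subst. }
    pose proof (f_equal fst Eq) as E1. pose proof (f_equal snd Eq) as E2. simpl in E1, E2.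
    assert ((fst q * (fst (dg t) ^ 2 + snd (dg t) ^ 2) = 0)%R) as P.
    { replace (fst q * (fst (dg t) ^ 2 + snd (dg t) ^ 2))%R with
       ((fst q * fst (dg t) - snd q * snd (dg t)) * fst (dg t) +
        (fst q * snd (dg t) + snd q * fst (dg t)) * snd (dg t))%R by ring.
      rewrite <- E1, <- E2. lra. }
    apply Rmult_integral in P. tauto. }
  exists (snd q). unfold normal_pt.
  replace (Ci * RtoC (snd q)) with q.
  - rewrite <- Eq. ring.
  - destruct q as [a b]; simpl in *. subst a. unfold Ci, RtoC, Cmult; simpl. f_equal; ring.
Qed.

End Loop.

Lemma Cmod_div_le (x y : C) (M d : R) :
  0 < d -> d <= Cmod y -> Cmod x <= M -> Cmod (x / y) <= M / d.
Proof.
  intros Hd Hy Hx. assert (y <> 0) by (apply Cmod_gt_0; lra).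
  rewrite Cmod_div by auto. unfold Rdiv.
  apply Rmult_le_compat; auto; try apply Cmod_ge_0.
  - left. apply Rinv_0_lt_compat. lra.
  - apply Rinv_le_contravar; lra.
Qed.

Definition c2pi : C := / (2 * RtoC PI * Ci).

Lemma two_pi_i_neq_0 : 2 * RtoC PI * Ci <> 0.
Proof.
  pose proof PI_RGT_0. intros E. apply (f_equal Cmod) in E.
  rewrite !Cmod_mult, Cmod_Ci, !Cmod_R, !Rabs_pos_eq in E by lra. lra.
Qed.

Lemma Cmod_c2pi : Cmod c2pi = (/ (2 * PI))%R.
Proof.
  unfold c2pi. pose proof PI_RGT_0. rewrite Cmod_inv by apply two_pi_i_neq_0.
  rewrite !Cmod_mult, Cmod_Ci, !Cmod_R, !Rabs_pos_eq by lra. f_equal. ring.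
Qed.

Lemma Cmod_c2pi_le : 0 < Cmod c2pi <= 1 / 6.
Proof.
  rewrite Cmod_c2pi. pose proof PI2_3_2. unfold PI2 in *.
  split; [apply Rinv_0_lt_compat; lra|].
  unfold Rdiv. rewrite Rmult_1_l. apply Rinv_le_contravar; lra.
Qed.

Lemma atan_le_id (x : R) : 0 <= x -> 0 <= atan x <= x.
Proof.
  intros Hx. destruct (MVT_gen atan 0 x (fun u => / (1 + u ^ 2))%R) as [u [Hu E]].
  - intros u _. apply is_derive_Reals, derivable_pt_lim_atan.
  - intros u _. apply derivable_continuous_pt, derivable_pt_atan.
  - rewrite atan_0, !Rminus_0_r in E. rewrite E.
    assert (0 < / (1 + u ^ 2) <= 1).
    { split; [apply Rinv_0_lt_compat; nra|]. apply Rle_trans with (/ 1)%R; [apply Rinv_le_contravar; nra|lra]. }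
    nra.
Qed.

Lemma is_derive_inv_RC (f : R -> C) (t : R) (l : C) :
  is_derive_RC f t l -> f t <> 0 ->
  is_derive_RC (fun s => / f s) t (- (l / (f t * f t))).
Proof.
  intros Hf H0. apply is_derive_RC_iff. intros eps He.
  set (a := f t) in *.
  assert (Ha : 0 < Cmod a) by now apply Cmod_gt_0.
  set (A := Cmod a) in *. set (K := (Cmod l + 1)%R).
  assert (HK : 0 < K) by (pose proof (Cmod_ge_0 l); unfold K; lra).
  set (e1 := Rmin 1 (eps * A ^ 2 / 2)).
  assert (E0 : 0 < eps * A ^ 2 / 2) by (apply Rdiv_lt_0_compat; [apply Rmult_lt_0_compat; nra|lra]).
  assert (He1 : 0 < e1) by (apply Rmin_pos; lra).
  destruct (proj1 (is_derive_RC_iff _ _ _) Hf e1 He1) as [d [Hd H]].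
  set (e2 := (eps * A ^ 3 / (4 * K ^ 2))%R).
  assert (He2 : 0 < e2) by (apply Rdiv_lt_0_compat; [apply Rmult_lt_0_compat; [lra|apply pow_lt; lra]|nra]).
  set (d1 := Rmin d (Rmin (A / (2 * K)) e2)).
  assert (A2K : 0 < A / (2 * K)) by (apply Rdiv_lt_0_compat; lra).
  exists d1. split; [repeat apply Rmin_pos; auto|].
  intros s Hs.
  assert (S1 : Rabs (s - t) < d) by (eapply Rlt_le_trans; [exact Hs|apply Rmin_l]).
  assert (S2 : Rabs (s - t) < A / (2 * K)).
  { eapply Rlt_le_trans; [exact Hs|]. eapply Rle_trans; [apply Rmin_r|apply Rmin_l]. }
  assert (S3 : Rabs (s - t) < e2).
  { eapply Rlt_le_trans; [exact Hs|]. eapply Rle_trans; [apply Rmin_r|apply Rmin_r]. }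
  specialize (H s S1). set (r := f s - a - RtoC (s - t) * l) in *.
  set (h := Rabs (s - t)) in *. assert (Hh : 0 <= h) by apply Rabs_pos.
  assert (R1 : Cmod r <= 1 * h).
  { eapply Rle_trans; [exact H|]. apply Rmult_le_compat_r; [auto|apply Rmin_l]. }
  assert (R2 : Cmod r <= eps * A ^ 2 / 2 * h).
  { eapply Rle_trans; [exact H|]. apply Rmult_le_compat_r; [auto|apply Rmin_r]. }
  assert (Bh : Cmod (f s - a) <= K * h).
  { replace (f s - a) with (r + RtoC (s - t) * l) by (unfold r; ring).
    eapply Rle_trans; [apply Cmod_triangle|]. rewrite Cmod_mult, Cmod_R. fold h. unfold K. lra. }
  assert (Kh : K * h <= A / 2).
  { replace (A / 2)%R with (K * (A / (2 * K)))%R by (field; lra). apply Rmult_le_compat_l; lra. }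
  assert (Bb : A / 2 <= Cmod (f s)).
  { pose proof (Cmod_le_sub a (f s)) as Q. rewrite Cmod_sub_sym in Q. fold A in Q. lra. }
  assert (b0 : f s <> 0) by (apply Cmod_gt_0; lra).
  (* The remainder splits exactly into a term quadratic in f s - a and the linearisation error of f
     divided by a^2; each gets eps / 2. *)
  replace (/ f s - / a - RtoC (s - t) * - (l / (a * a))) with
    ((f s - a) * (f s - a) / (a * a * f s) - r / (a * a)) by (unfold r; field; auto).
  eapply Rle_trans; [apply Cmod_sub_le|].
  assert (T1 : Cmod ((f s - a) * (f s - a) / (a * a * f s)) <= eps / 2 * h).
  { assert (0 < A * A * (A / 2)) by (apply Rmult_lt_0_compat; nra).
    eapply Rle_trans; [apply (Cmod_div_le _ _ (K ^ 2 * e2 * h) (A * A * (A / 2)))|].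
    - auto.
    - rewrite !Cmod_mult. fold A. apply Rmult_le_compat_l; nra.
    - rewrite Cmod_mult. apply Rle_trans with ((K * h) * (K * h))%R.
      + apply Rmult_le_compat; auto; apply Cmod_ge_0.
      + replace (K * h * (K * h))%R with ((K ^ 2 * h) * h)%R by ring.
        replace (K ^ 2 * e2 * h)%R with ((K ^ 2 * h) * e2)%R by ring.
        apply Rmult_le_compat_l; [|lra]. apply Rmult_le_pos; nra.
    - right. unfold e2. field. split; lra. }
  assert (T2 : Cmod (r / (a * a)) <= eps / 2 * h).
  { eapply Rle_trans; [apply (Cmod_div_le _ _ (eps * A ^ 2 / 2 * h) (A * A))|].
    - nra.
    - rewrite Cmod_mult. fold A. lra.
    - exact R2.
    - right. field. lra. }
  lra.
Qed.

(* Syntactic dispatch: plain [apply] would unfold complex arithmetic down to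
   pairs of reals while unifying. *)
Ltac cts_tac := repeat
  lazymatch goal with
  | H : cts ?f |- cts ?f => exact H
  | |- cts (fun _ => ?c) => exact (cts_const c)
  | |- cts (fun t => @?f t + @?g t) => apply (cts_plus f g)
  | |- cts (fun t => @?f t - @?g t) => apply (cts_minus f g)
  | |- cts (fun t => @?f t * @?g t) => apply (cts_mult f g)
  | |- cts (fun t => @?f t / @?g t) => apply (cts_mult f (fun t => / g t))
  | |- cts (fun t => - @?f t) => apply (cts_opp f)
  | |- cts (fun t => / @?f t) => apply (cts_inv f)
  | |- cts (fun t => ?f t) => change (cts f)
  end; cbv beta; auto.

(** * Cauchy integrals off the loop and the winding number *)

Section Cauchy.
Context (gam : R -> C) (Hreg : regular_loop gam).
Notation dg := (dgam gam).

Let gam_periodic : periodic gam := proj1 Hreg.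
Let gam_derive : forall t, is_derive_RC gam t (dg t) := proj1 (proj2 (proj2 Hreg)).
Let dg_cts : cts dg := proj1 (proj2 (proj2 (proj2 Hreg))).
Let gam_cts : cts gam := loop_cts gam Hreg.

Definition lint (P : R -> C) : C := CInt (fun t => P t * dg t) 0 1.

Lemma lint_ext (P Q : R -> C) : (forall t, P t = Q t) -> lint P = lint Q.
Proof. intros H. apply CInt_ext. intros t. now rewrite H. Qed.

Lemma lint_mult (c : C) (P : R -> C) : cts P -> lint (fun t => c * P t) = c * lint P.
Proof.
  intros H. unfold lint. rewrite <- CInt_mult by (apply cts_mult; auto).
  apply CInt_ext. intros; ring.
Qed.

Lemma lint_minus (P Q : R -> C) : cts P -> cts Q -> lint (fun t => P t - Q t) = lint P - lint Q.
Proof.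
  intros H1 H2. unfold lint. rewrite <- CInt_minus by (apply cts_mult; auto).
  apply CInt_ext. intros; ring.
Qed.

Lemma lint_bound (L : R) : (forall t, Cmod (dg t) <= L) -> forall (P : R -> C) (M : R),
  cts P -> (forall t, Cmod (P t) <= M) -> Cmod (lint P) <= M * L.
Proof.
  intros HL P M HP HM. unfold lint.
  replace (M * L)%R with ((1 - 0) * (M * L))%R by ring.
  apply Cmod_CInt_le_const; [lra|apply cts_mult; auto|].
  intros t _. rewrite Cmod_mult. apply Rmult_le_compat; auto; apply Cmod_ge_0.
Qed.

Lemma cts_sub_gam (z : C) : cts (fun t => gam t - z).
Proof. apply cts_minus; [apply gam_cts|apply cts_const]. Qed.

Lemma offG_neq (z : C) : ~ onG gam z -> forall t, gam t - z <> 0.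
Proof. intros H t. apply Csub_neq_0. intros E. apply H. now exists t. Qed.

Lemma offG_dist (z : C) : ~ onG gam z -> exists d, 0 < d /\ forall t, d <= Cmod (gam t - z).
Proof.
  intros H. apply (periodic_bounded_below (fun t => gam t - z)).
  - apply cts_sub_gam.
  - intros t. now rewrite gam_periodic.
  - now apply offG_neq.
Qed.

Lemma dist_offG (z : C) (d : R) : 0 < d -> (forall t, d <= Cmod (gam t - z)) -> ~ onG gam z.
Proof.
  intros Hd H [t E]. specialize (H t). rewrite E in H.
  replace (z - z) with (RtoC 0) in H by ring. rewrite Cmod_0 in H. lra.
Qed.

Lemma dist_near (z w : C) (d : R) : (forall t, d <= Cmod (gam t - z)) ->
  forall t, d - Cmod (w - z) <= Cmod (gam t - w).
Proof. intros H t. specialize (H t). pose proof (Cmod_tri (gam t) w z). lra. Qed.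

Definition ctsG (F : C -> C) : Prop := cts (fun t => F (gam t)).

Lemma cauchy_lint (F : C -> C) (z : C) :
  cauchy_int gam F z = c2pi * lint (fun t => F (gam t) / (gam t - z)).
Proof. reflexivity. Qed.

Lemma wind_lint (z : C) : wind gam z = c2pi * lint (fun t => / (gam t - z)).
Proof. reflexivity. Qed.

Lemma wind_cauchy (z : C) : wind gam z = cauchy_int gam (fun _ => 1) z.
Proof. rewrite wind_lint, cauchy_lint. f_equal. apply lint_ext. intros; unfold Cdiv; ring. Qed.

Lemma cauchy_diff (F : C -> C) (A z w : C) :
  ctsG F -> ~ onG gam z -> ~ onG gam w ->
  cauchy_int gam F z - cauchy_int gam F w - A * (wind gam z - wind gam w) =
  c2pi * lint (fun t => (F (gam t) - A) * (z - w) / ((gam t - z) * (gam t - w))).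
Proof.
  intros HF Hz Hw. pose proof (offG_neq z Hz) as Nz. pose proof (offG_neq w Hw) as Nw.
  unfold ctsG in HF.
  rewrite !cauchy_lint, !wind_lint.
  assert (E : lint (fun t => (F (gam t) - A) * (z - w) / ((gam t - z) * (gam t - w))) =
    (lint (fun t => F (gam t) / (gam t - z)) - lint (fun t => F (gam t) / (gam t - w)))
    - A * (lint (fun t => / (gam t - z)) - lint (fun t => / (gam t - w)))).
  { set (P := fun t => F (gam t) / (gam t - z)). set (Q := fun t => F (gam t) / (gam t - w)).
    set (U := fun t => / (gam t - z)). set (V := fun t => / (gam t - w)).
    assert (cP : cts P) by (unfold P; cts_tac).
    assert (cQ : cts Q) by (unfold Q; cts_tac).
    assert (cU : cts U) by (unfold U; cts_tac).
    assert (cV : cts V) by (unfold V; cts_tac).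
    rewrite <- (lint_minus P Q), <- (lint_minus U V) by auto.
    rewrite <- (lint_mult A (fun t => U t - V t)) by (apply cts_minus; auto).
    rewrite <- (lint_minus (fun t => P t - Q t) (fun t => A * (U t - V t))) by cts_tac.
    apply lint_ext. intros t. unfold P, Q, U, V. field. split; auto. }
  rewrite E. ring.
Qed.

(** Differentiation under the integral with an explicit remainder: 1/(zeta - w) - 1/(zeta - z) - (w
    - z)/(zeta - z)^2 equals (w - z)^2 / ((zeta - z)^2 (zeta - w)), whose denominator is bounded
    below while w stays within half the distance from z to the loop. *)
Lemma cauchy_expand (F : C -> C) : ctsG F -> forall z, ~ onG gam z ->
  exists K d, 0 < d /\ 0 <= K /\ forall w, Cmod (w - z) < d ->
    Cmod (cauchy_int gam F w - cauchy_int gam F z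
      - (w - z) * (c2pi * lint (fun t => F (gam t) / ((gam t - z) * (gam t - z))))) <= K * Cmod (w - z) ^ 2.
Proof.
  intros HF z Hz. destruct (offG_dist z Hz) as [d [Hd D]].
  destruct (periodic_bounded (fun t => F (gam t)) HF) as [B [HB FB]].
  { intros t. now rewrite gam_periodic. }
  destruct (dgam_bounds gam Hreg) as (m & L & _ & HL & HmL).
  unfold ctsG in HF.
  assert (dp : 0 < d * d * (d / 2)) by (apply Rmult_lt_0_compat; nra).
  assert (K0 : 0 <= B / (d * d * (d / 2)) * L).
  { apply Rmult_le_pos; [|lra]. apply Rle_div_r; lra. }
  exists (1 * (B / (d * d * (d / 2)) * L))%R, (d / 2)%R.
  split; [lra|split; [lra|]]. intros w Hw.
  assert (Dw : forall t, d / 2 <= Cmod (gam t - w)).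
  { intros t. pose proof (dist_near z w d D t). lra. }
  assert (Hw' : ~ onG gam w) by (apply (dist_offG w (d / 2)); [lra|auto]).
  pose proof (offG_neq z Hz) as Nz. pose proof (offG_neq w Hw') as Nw.
  rewrite !cauchy_lint.
  assert (E : c2pi * lint (fun t => F (gam t) / (gam t - w)) - c2pi * lint (fun t => F (gam t) / (gam t - z))
     - (w - z) * (c2pi * lint (fun t => F (gam t) / ((gam t - z) * (gam t - z)))) =
     c2pi * ((w - z) * (w - z) * lint (fun t => F (gam t) / ((gam t - z) * (gam t - z) * (gam t - w))))).
  { set (P := fun t => F (gam t) / (gam t - w)). set (Q := fun t => F (gam t) / (gam t - z)).
    set (U := fun t => F (gam t) / ((gam t - z) * (gam t - z))).
    set (V := fun t => F (gam t) / ((gam t - z) * (gam t - z) * (gam t - w))).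
    assert (cP : cts P) by (unfold P; cts_tac).
    assert (cQ : cts Q) by (unfold Q; cts_tac).
    assert (cU : cts U) by (unfold U; cts_tac; intros; repeat apply Cmult_neq_0; auto).
    assert (cV : cts V) by (unfold V; cts_tac; intros; repeat apply Cmult_neq_0; auto).
    rewrite <- (lint_mult ((w - z) * (w - z)) V) by auto.
    rewrite (lint_ext (fun t => (w - z) * (w - z) * V t) (fun t => (P t - Q t) - (w - z) * U t)).
    2:{ intros t. unfold P, Q, U, V. field. split; auto. }
    rewrite (lint_minus (fun t => P t - Q t) (fun t => (w - z) * U t)), (lint_minus P Q),
      (lint_mult (w - z) U) by cts_tac.
    ring. }
  rewrite E, !Cmod_mult.
  replace (1 * (B / (d * d * (d / 2)) * L) * Cmod (w - z) ^ 2)%R with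
    (1 * ((Cmod (w - z) * Cmod (w - z)) * (B / (d * d * (d / 2)) * L)))%R by ring.
  apply Rmult_le_compat.
  - apply Cmod_ge_0.
  - apply Rmult_le_pos; [apply Rmult_le_pos|]; apply Cmod_ge_0.
  - pose proof Cmod_c2pi_le. lra.
  - apply Rmult_le_compat_l; [apply Rmult_le_pos; apply Cmod_ge_0|].
    apply lint_bound; [apply HmL| |].
    + cts_tac; intros; repeat apply Cmult_neq_0; auto.
    + intros t. apply Cmod_div_le; auto. rewrite !Cmod_mult.
      apply Rmult_le_compat; [nra|lra| |auto]. apply Rmult_le_compat; auto; lra.
Qed.

Lemma cauchy_derive (F : C -> C) (z : C) : ctsG F -> ~ onG gam z ->
  is_derive_CC (cauchy_int gam F) z (c2pi * lint (fun t => F (gam t) / ((gam t - z) * (gam t - z)))).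
Proof.
  intros HF Hz. destruct (cauchy_expand F HF z Hz) as (K & d & Hd & HK & H).
  apply is_derive_CC_iff. intros eps He.
  exists (Rmin d (eps / (K + 1))). split.
  { apply Rmin_pos; auto. apply Rdiv_lt_0_compat; lra. }
  intros w Hw. eapply Rle_trans; [apply H; eapply Rlt_le_trans; [exact Hw|apply Rmin_l]|].
  assert (W : Cmod (w - z) < eps / (K + 1)) by (eapply Rlt_le_trans; [exact Hw|apply Rmin_r]).
  assert (K * Cmod (w - z) <= eps).
  { assert (E : ((K + 1) * (eps / (K + 1)) = eps)%R) by (field; lra).
    pose proof (Cmod_ge_0 (w - z)). nra. }
  pose proof (Cmod_ge_0 (w - z)). nra.
Qed.

(** The differentiated kernel 1/(zeta - z)^2 has the primitive -1/(zeta - z), and the loop is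
    closed. *)
Lemma wind_derive (z : C) : ~ onG gam z -> is_derive_CC (wind gam) z (RtoC 0).
Proof.
  intros Hz. pose proof (offG_neq z Hz) as Nz.
  assert (E : wind gam = cauchy_int gam (fun _ => 1)) by (extensionality w; apply wind_cauchy).
  rewrite E.
  replace (RtoC 0) with (c2pi * lint (fun t => 1 / ((gam t - z) * (gam t - z)))).
  { apply (cauchy_derive (fun _ => 1)); auto. apply cts_const. }
  assert (L0 : lint (fun t => - (1 / ((gam t - z) * (gam t - z)))) = 0).
  { unfold lint. rewrite (CInt_FTC (fun t => / (gam t - z))).
    - replace (gam 1) with (gam 0). ring. rewrite <- (gam_periodic 0). f_equal. ring.
    - intros t. replace (- (1 / ((gam t - z) * (gam t - z))) * dg t) with
        (- (dg t / ((gam t - z) * (gam t - z)))) by (field; auto).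
      apply (is_derive_inv_RC (fun t => gam t - z)); auto.
      apply is_derive_RC_iff. intros eps He.
      destruct (proj1 (is_derive_RC_iff _ _ _) (gam_derive t) eps He) as [d [Hd H]].
      exists d; split; auto. intros s Hs.
      replace (gam s - z - (gam t - z)) with (gam s - gam t) by ring. auto.
    - apply cts_mult; auto. apply cts_opp. cts_tac; intros; repeat apply Cmult_neq_0; auto. }
  assert (cP : cts (fun t => - (1 / ((gam t - z) * (gam t - z))))).
  { apply cts_opp. cts_tac; intros; repeat apply Cmult_neq_0; auto. }
  rewrite (lint_ext (fun t => 1 / ((gam t - z) * (gam t - z)))
    (fun t => (- (1)) * - (1 / ((gam t - z) * (gam t - z))))) by (intros; ring).
  rewrite (lint_mult (- (1)) _ cP), L0. ring.
Qed.

Lemma wind_locally_constant (z w : C) (d : R) :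
  0 < d -> (forall t, d <= Cmod (gam t - z)) -> Cmod (w - z) < d -> wind gam w = wind gam z.
Proof.
  intros Hd D Hw. symmetry.
  set (f := fun s : R => wind gam (z + RtoC s * (w - z))).
  replace (wind gam z) with (f 0%R) by (unfold f; f_equal; ring).
  replace (wind gam w) with (f 1%R) by (unfold f; f_equal; ring).
  apply (eq_is_derive (V := C_R_NormedModule)); [|lra].
  intros s Hs. change (is_derive_RC f s (RtoC 0)). apply is_derive_RC_iff. intros eps He.
  set (u := z + RtoC s * (w - z)).
  assert (Hu : ~ onG gam u).
  { apply (dist_offG u (d - Cmod (w - z))); [lra|]. intros t.
    pose proof (dist_near z u d D t) as Q.
    assert (Cmod (u - z) <= Cmod (w - z)); [|lra].
    replace (u - z) with (RtoC s * (w - z)) by (unfold u; ring).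
    rewrite Cmod_mult, Cmod_R, Rabs_pos_eq by lra. pose proof (Cmod_ge_0 (w - z)). nra. }
  set (K := (Cmod (w - z) + 1)%R).
  assert (HK : 0 < K) by (pose proof (Cmod_ge_0 (w - z)); unfold K; lra).
  assert (HeK : 0 < eps / K) by (apply Rdiv_lt_0_compat; lra).
  destruct (proj1 (is_derive_CC_iff _ _ _) (wind_derive u Hu) (eps / K)%R HeK) as [e [He' H]].
  exists (e / K)%R. split; [apply Rdiv_lt_0_compat; lra|].
  intros s' Hs'.
  assert (E : z + RtoC s' * (w - z) - u = RtoC (s' - s) * (w - z)).
  { unfold u. rewrite RtoC_minus. ring. }
  specialize (H (z + RtoC s' * (w - z))). rewrite E, Cmod_mult, Cmod_R in H.
  assert (A1 : Rabs (s' - s) * Cmod (w - z) <= Rabs (s' - s) * K).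
  { apply Rmult_le_compat_l; [apply Rabs_pos|unfold K; lra]. }
  assert (A2 : Rabs (s' - s) * K < e).
  { replace e with ((e / K) * K)%R by (field; lra). apply Rmult_lt_compat_r; lra. }
  unfold f. fold u. replace (RtoC (s' - s) * 0) with (RtoC (s' - s) * (w - z) * 0) by ring.
  eapply Rle_trans; [apply H; lra|].
  replace (eps * Rabs (s' - s))%R with (eps / K * (Rabs (s' - s) * K))%R by (field; lra).
  apply Rmult_le_compat_l; lra.
Qed.

Lemma cauchy_at_infinity (F : C -> C) (eps : R) : ctsG F -> 0 < eps ->
  exists M, forall z, M < Cmod z -> Cmod (cauchy_int gam F z) < eps.
Proof.
  intros HF He.
  destruct (periodic_bounded (fun t => F (gam t)) HF) as [B [HB FB]].
  { intros t. now rewrite gam_periodic. }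
  destruct (periodic_bounded gam gam_cts gam_periodic) as [G [HG GB]].
  destruct (dgam_bounds gam Hreg) as (m & L & _ & HL & HmL).
  unfold ctsG in HF.
  set (d := (B * L / eps + 1)%R).
  assert (BLe : 0 < B * L / eps) by (apply Rdiv_lt_0_compat; nra).
  exists (G + d)%R. intros z Hz.
  assert (D : forall t, d <= Cmod (gam t - z)).
  { intros t. pose proof (Cmod_le_sub z (gam t)) as Q. rewrite Cmod_sub_sym in Q.
    specialize (GB t). lra. }
  assert (Nz : forall t, gam t - z <> 0).
  { intros t. apply Cmod_gt_0. specialize (D t). unfold d in D. lra. }
  rewrite cauchy_lint, Cmod_mult.
  assert (Cmod (lint (fun t => F (gam t) / (gam t - z))) <= B / d * L).
  { apply lint_bound; [apply HmL| |].
    - cts_tac; auto.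
    - intros t. apply Cmod_div_le; auto. unfold d; lra. }
  assert (B / d * L < eps).
  { replace (B / d * L)%R with (B * L / d)%R by (field; unfold d; lra).
    apply Rlt_div_l; [unfold d; lra|].
    replace (B * L)%R with (eps * (B * L / eps))%R by (field; lra).
    unfold d. apply Rmult_lt_compat_l; lra. }
  pose proof Cmod_c2pi_le. pose proof (Cmod_ge_0 (lint (fun t => F (gam t) / (gam t - z)))). nra.
Qed.

Lemma wind_ext (z : C) : extD gam z -> wind gam z = 0.
Proof.
  intros [Hz H]. apply eq_of_Cmod_le_all. intros eps He.
  replace (wind gam z - 0) with (wind gam z) by ring.
  destruct (cauchy_at_infinity (fun _ => 1) eps (cts_const 1) He) as [M HM].
  destruct (H M) as (p & Hp & P0 & P1 & Poff).
  assert (E : wind gam (p 0%R) = wind gam (p 1%R)).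
  (* The path is merely continuous, but [wind] is constant on a disk about each of its points, so
     the composite is locally constant and has derivative 0. *)
  { apply (eq_is_derive (V := C_R_NormedModule) (fun s => wind gam (p s))); [|lra].
    intros s Hs. change (is_derive_RC (fun s => wind gam (p s)) s (RtoC 0)).
    apply is_derive_RC_iff. intros e He'.
    destruct (offG_dist (p s) (Poff s Hs)) as [d [Hd D]].
    destruct (proj1 (cpt_iff p s) (Hp s Hs) d Hd) as [d' [Hd' K]].
    exists d'. split; auto. intros s' Hs'.
    rewrite (wind_locally_constant (p s) (p s') d Hd D (K s' Hs')).
    replace (wind gam (p s) - wind gam (p s) - RtoC (s' - s) * 0) with (RtoC 0) by ring.
    rewrite Cmod_0. pose proof (Rabs_pos (s' - s)). nra. }
  rewrite <- P0, E, wind_cauchy. left. now apply HM.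
Qed.

Lemma is_derive_atan_scale (tau u : R) : 0 < tau ->
  is_derive (fun u => atan (u / tau)) u (tau / (u ^ 2 + tau ^ 2))%R.
Proof.
  intros Ht. auto_derive; auto. assert ((u ^ 2 + tau ^ 2 <> 0)%R) by nra. field.
  split; [nra|]. lra.
Qed.

Lemma continuous_atan_kernel (tau u : R) : 0 < tau -> continuous (fun u => tau / (u ^ 2 + tau ^ 2))%R u.
Proof.
  intros Ht. apply (ex_derive_continuous (V := R_NormedModule)). auto_derive. simpl. nra.
Qed.

End Cauchy.

(** * The jump of the winding number and the two sides of the loop *)

Section Sides.
Context (gam : R -> C) (Hreg : regular_loop gam).
Notation dg := (dgam gam).
Notation npt := (normal_pt gam).

Let gam_periodic : periodic gam := proj1 Hreg.
Let dg_cts : cts dg := proj1 (proj2 (proj2 (proj2 Hreg))).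
Let gam_cts : cts gam := loop_cts gam Hreg.
Let dg_periodic := dgam_periodic gam Hreg.

Lemma exists_shift_half (t u : R) : exists s n, Rabs s <= 1 / 2 /\ u = (t + s + IZR n)%R.
Proof.
  destruct (reduce_mod_1 (u - t)) as [n Hn].
  destruct (Rle_dec (u - t + IZR n) (1 / 2)).
  - exists (u - t + IZR n)%R, (- n)%Z. split; [rewrite Rabs_pos_eq; lra|]. rewrite opp_IZR. ring.
  - exists (u - t + IZR n - 1)%R, (- n + 1)%Z. split; [rewrite Rabs_left; lra|].
    rewrite plus_IZR, opp_IZR. ring.
Qed.

Lemma loop_lower_bound_all (t d c : R) (z : C) : 0 <= c ->
  (forall s, Rabs s <= 1 / 2 -> c * (d + Rabs s) <= Cmod (gam (t + s) - z)) ->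
  forall u, c * d <= Cmod (gam u - z).
Proof.
  intros Hc H u. destruct (exists_shift_half t u) as (s & n & Hs & ->).
  rewrite periodic_IZR by auto. eapply Rle_trans; [|apply H; auto].
  pose proof (Rabs_pos s). nra.
Qed.

(** Here a = gam' t, g = gam (t + s) - gam t, and r1, r2 are the errors of the tangent approximation
    of gam and gam'. With r1 = r2 = 0 the kernel is exactly 2 i tau / (s^2 + tau^2); the claim is a
    relative error of order eta. *)
Lemma jump_kernel_estimate (a g r1 r2 : C) (s tau eta L c : R) :
  0 < c -> 0 < tau -> 0 < eta <= 1 -> a <> 0 -> Cmod a <= L ->
  Cmod r1 <= eta * Rabs s -> Cmod r2 <= eta ->
  g = RtoC s * a + r1 ->
  c * (Rabs s + tau) <= Cmod (g - Ci * RtoC tau * a) ->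
  c * (Rabs s + tau) <= Cmod (g + Ci * RtoC tau * a) ->
  Cmod (2 * Ci * RtoC tau * a / ((g - Ci * RtoC tau * a) * (g + Ci * RtoC tau * a)) * (a + r2)
        - (2 * Ci) * RtoC (tau / (s ^ 2 + tau ^ 2)))
  <= 2 * (3 * L + 1) * eta / c ^ 2 * (tau / (s ^ 2 + tau ^ 2)).
Proof.
  intros Hc Ht He Ha HL H1 H2 Hg B1 B2.
  pose proof (Rabs_pos s) as Ps.
  assert (Q : 0 < s ^ 2 + tau ^ 2) by nra.
  assert (Q2 : c ^ 2 * (s ^ 2 + tau ^ 2) <= (c * (Rabs s + tau)) * (c * (Rabs s + tau))).
  { rewrite <- (pow2_abs s). assert (0 <= Rabs s * tau) by nra.
    replace (c * (Rabs s + tau) * (c * (Rabs s + tau)))%R with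
      (c ^ 2 * (Rabs s ^ 2 + tau ^ 2 + 2 * (Rabs s * tau)))%R by ring.
    apply Rmult_le_compat_l; [nra|lra]. }
  assert (P0 : 0 < c * (Rabs s + tau)) by (apply Rmult_lt_0_compat; lra).
  set (X := g - Ci * RtoC tau * a) in *. set (Y := g + Ci * RtoC tau * a) in *.
  assert (NX : X <> 0) by (apply Cmod_gt_0; lra).
  assert (NY : Y <> 0) by (apply Cmod_gt_0; lra).
  assert (NQ : RtoC (s ^ 2 + tau ^ 2) <> 0) by (apply Cmod_gt_0; rewrite Cmod_R, Rabs_pos_eq; lra).
  assert (XY : X * Y = g * g + RtoC tau * RtoC tau * a * a).
  { unfold X, Y. replace ((g - Ci * RtoC tau * a) * (g + Ci * RtoC tau * a)) with
      (g * g - (Ci * Ci) * (RtoC tau * RtoC tau * a * a)) by ring.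
    replace (Ci * Ci) with (- (1)) by (unfold Ci, Copp, Cmult, RtoC; simpl; f_equal; ring). ring. }
  assert (EQ : RtoC (s ^ 2 + tau ^ 2) = RtoC s * RtoC s + RtoC tau * RtoC tau).
  { rewrite <- !RtoC_mult, <- RtoC_plus. f_equal. ring. }
  (* The numerator a (a + r2) (s^2 + tau^2) - X Y after cancellation of the a^2 terms: every
     remaining term contains r1 or r2. *)
  set (N := a * r2 * RtoC (s ^ 2 + tau ^ 2) - 2 * a * RtoC s * r1 - r1 * r1).
  replace (2 * Ci * RtoC tau * a / (X * Y) * (a + r2) - (2 * Ci) * RtoC (tau / (s ^ 2 + tau ^ 2)))
    with ((2 * Ci * RtoC tau * N) / (X * Y * RtoC (s ^ 2 + tau ^ 2))).
  2:{ rewrite RtoC_div by lra.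
      assert (EN : N = a * (a + r2) * RtoC (s ^ 2 + tau ^ 2) - X * Y).
      { unfold N. rewrite XY, EQ, Hg. ring. }
      rewrite EN. field. repeat split; auto. }
  (* The terms contribute L, 2 L and 1 to the factor 3 L + 1; eta <= 1 turns the square of r1 into a
     single eta. *)
  assert (NB : Cmod N <= (3 * L + 1) * eta * (s ^ 2 + tau ^ 2)).
  { unfold N. eapply Rle_trans; [apply Cmod_sub_le|].
    pose proof (Cmod_sub_le (a * r2 * RtoC (s ^ 2 + tau ^ 2)) (2 * a * RtoC s * r1)) as T.
    rewrite !Cmod_mult, !Cmod_R, (Rabs_pos_eq 2), (Rabs_pos_eq (s ^ 2 + tau ^ 2)) in T by lra.
    rewrite Cmod_mult.
    assert (A1 : Cmod a * Cmod r2 * (s ^ 2 + tau ^ 2) <= L * eta * (s ^ 2 + tau ^ 2)).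
    { apply Rmult_le_compat_r; [lra|]. apply Rmult_le_compat; auto; apply Cmod_ge_0. }
    assert (A2 : 2 * Cmod a * Rabs s * Cmod r1 <= 2 * L * eta * (s ^ 2)).
    { rewrite <- (pow2_abs s).
      replace (2 * L * eta * Rabs s ^ 2)%R with ((2 * L * Rabs s) * (eta * Rabs s))%R by ring.
      apply Rmult_le_compat; auto; [|apply Cmod_ge_0|].
      - pose proof (Cmod_ge_0 a). apply Rmult_le_pos; lra.
      - apply Rmult_le_compat_r; lra. }
    assert (A3 : Cmod r1 * Cmod r1 <= eta * s ^ 2).
    { rewrite <- (pow2_abs s).
      apply Rle_trans with ((eta * Rabs s) * (eta * Rabs s))%R.
      - apply Rmult_le_compat; auto; apply Cmod_ge_0.
      - replace (eta * Rabs s * (eta * Rabs s))%R with (eta * (eta * Rabs s ^ 2))%R by ring.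
        apply Rmult_le_compat_l; [lra|]. nra. }
    assert (0 <= L) by (eapply Rle_trans; [apply Cmod_ge_0|exact HL]).
    assert (0 <= L * eta * tau ^ 2) by (apply Rmult_le_pos; nra).
    assert (0 <= eta * tau ^ 2) by (apply Rmult_le_pos; nra).
    lra. }
  replace (2 * (3 * L + 1) * eta / c ^ 2 * (tau / (s ^ 2 + tau ^ 2)))%R with
    (2 * tau * ((3 * L + 1) * eta * (s ^ 2 + tau ^ 2)) /
      ((c ^ 2 * (s ^ 2 + tau ^ 2)) * (s ^ 2 + tau ^ 2)))%R by (field; split; lra).
  assert (C2 : 0 < c ^ 2) by nra.
  apply Cmod_div_le.
  - repeat apply Rmult_lt_0_compat; lra.
  - rewrite !Cmod_mult, Cmod_R, (Rabs_pos_eq (s ^ 2 + tau ^ 2)) by lra.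
    apply Rmult_le_compat_r; [lra|]. eapply Rle_trans; [exact Q2|].
    apply Rmult_le_compat; lra.
  - rewrite !Cmod_mult, Cmod_Ci, !Cmod_R, !Rabs_pos_eq by lra.
    rewrite Rmult_1_r. apply Rmult_le_compat_l; lra.
Qed.

Lemma CInt_atan_kernel (k tau s0 : R) : 0 < tau ->
  CInt (fun u => (RtoC k * Ci) * RtoC (tau / (u ^ 2 + tau ^ 2))) 0 s0 = RtoC k * Ci * RtoC (atan (s0 / tau)).
Proof.
  intros Ht. apply CInt_unique.
  assert (H : is_RInt (fun u => tau / (u ^ 2 + tau ^ 2))%R 0 s0 (atan (s0 / tau))).
  { pose proof (is_RInt_derive (V := R_CompleteNormedModule) (fun u => atan (u / tau))
      (fun u => tau / (u ^ 2 + tau ^ 2))%R 0 s0) as D.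
    replace (atan (s0 / tau)) with (minus (atan (s0 / tau)) (atan (0 / tau))).
    - apply D; intros; [now apply is_derive_atan_scale|now apply continuous_atan_kernel].
    - replace (0 / tau)%R with 0%R by (field; lra). rewrite atan_0. apply Rminus_0_r. }
  assert (E : forall x : R, RtoC k * Ci * RtoC x = (0%R, (k * x)%R)).
  { intros x. unfold RtoC, Ci, Cmult; simpl. f_equal; ring. }
  rewrite E.
  apply (is_RInt_ext (V := C_R_NormedModule) (fun u => (0%R, (k * (tau / (u ^ 2 + tau ^ 2)))%R))).
  { intros u _. symmetry. apply E. }
  apply (is_RInt_fct_extend_pair (U := R_NormedModule) (V := R_NormedModule)).
  - pose proof (is_RInt_const (V := R_NormedModule) 0 s0 0%R) as Z.
    unfold scal in Z; simpl in Z. unfold mult in Z; simpl in Z. rewrite Rmult_0_r in Z. exact Z.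
  - exact (is_RInt_scal (V := R_NormedModule) _ _ _ k _ H).
Qed.

(* The kernel is compared with its value 2 i tau / (s^2 + tau^2) for the tangent
   line, whose integral over the line is 2 pi i. *)
Lemma wind_jump_estimate : exists tau0, 0 < tau0 /\ forall t tau, 0 < tau <= tau0 ->
  Cmod (wind gam (npt t tau) - wind gam (npt t (- tau)) - 1) <= 1 / 2.
Proof.
  destruct (dgam_bounds gam Hreg) as (m & L & Hm & HL & HmL).
  destruct (normal_pt_lower_bound gam Hreg) as (c & tau1 & Hc & Ht1 & LB).
  (* Makes the relative error of the tangent kernel at most 1/4. *)
  set (eta := Rmin 1 (c ^ 2 / (8 * (3 * L + 1)))).
  assert (C2 : 0 < c ^ 2) by nra.
  assert (He : 0 < eta <= 1).
  { split; [|apply Rmin_l]. apply Rmin_pos; [lra|]. apply Rdiv_lt_0_compat; lra. }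
  assert (He2 : 2 * (3 * L + 1) * eta / c ^ 2 <= 1 / 4).
  { apply Rle_div_l; [lra|]. apply Rle_trans with (2 * (3 * L + 1) * (c ^ 2 / (8 * (3 * L + 1))))%R.
    - apply Rmult_le_compat_l; [lra|apply Rmin_r].
    - right. field. lra. }
  destruct (loop_uniform_derive gam Hreg eta) as (s0 & Hs0 & U); [lra|].
  (* For |s| >= s0 the integrand is at most 2 tau L^2 / (c s0)^2 = (tau / q) / 2, so tau <= q bounds
     it by 1/2. The condition tau <= s0 / 8 makes the missing tail 4 atan (tau / s0) of the main
     term at most 1/2. *)
  set (q := (c ^ 2 * s0 ^ 2 / (4 * L ^ 2))%R).
  assert (Hq : 0 < q).
  { assert (0 < s0 ^ 2) by nra. assert (0 < L ^ 2) by nra. apply Rdiv_lt_0_compat; nra. }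
  set (tau0 := Rmin tau1 (Rmin (s0 / 8) q)).
  assert (T0 : 0 < tau0) by (repeat apply Rmin_pos; lra).
  exists tau0. split; [auto|]. intros t tau Htau.
  assert (Ta : tau <= tau1) by (eapply Rle_trans; [apply Htau|apply Rmin_l]).
  assert (Tb : tau <= s0 / 8).
  { eapply Rle_trans; [apply Htau|]. eapply Rle_trans; [apply Rmin_r|apply Rmin_l]. }
  assert (Tc : tau <= q).
  { eapply Rle_trans; [apply Htau|]. eapply Rle_trans; [apply Rmin_r|apply Rmin_r]. }
  set (z := npt t tau). set (w := npt t (- tau)).
  assert (LBz : forall s, Rabs s <= 1 / 2 -> c * (Rabs s + tau) <= Cmod (gam (t + s) - z)).
  { intros s Hs. pose proof (LB t s tau Hs) as B. rewrite (Rabs_pos_eq tau) in B by lra. now apply B. }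
  assert (LBw : forall s, Rabs s <= 1 / 2 -> c * (Rabs s + tau) <= Cmod (gam (t + s) - w)).
  { intros s Hs. pose proof (LB t s (- tau)%R Hs) as B. rewrite Rabs_Ropp, (Rabs_pos_eq tau) in B by lra. now apply B. }
  assert (Oz : ~ onG gam z).
  { apply (dist_offG gam z (c * tau)); [nra|]. apply (loop_lower_bound_all t); [lra|].
    intros s Hs. rewrite Rplus_comm. auto. }
  assert (Ow : ~ onG gam w).
  { apply (dist_offG gam w (c * tau)); [nra|]. apply (loop_lower_bound_all t); [lra|].
    intros s Hs. rewrite Rplus_comm. auto. }
  set (phi := fun u => (z - w) / ((gam u - z) * (gam u - w)) * dg u).
  pose proof (offG_neq gam z Oz) as Nz. pose proof (offG_neq gam w Ow) as Nw.
  assert (cphi : cts phi).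
  { unfold phi. cts_tac. intros u. now apply Cmult_neq_0. }
  assert (pphi : periodic phi).
  { intros u. unfold phi. now rewrite gam_periodic, dg_periodic. }
  assert (E0 : wind gam z - wind gam w = c2pi * CInt phi 0 1).
  { pose proof (cauchy_diff gam Hreg (fun _ => 1) 0 z w (cts_const 1) Oz Ow) as E.
    rewrite <- !wind_cauchy in E.
    replace (wind gam z - wind gam w) with (wind gam z - wind gam w - 0 * (wind gam z - wind gam w)) by ring.
    rewrite E. f_equal. unfold lint. apply CInt_ext. intros u. unfold phi. f_equal. f_equal. ring. }
  set (psi := fun u => phi (u + t)%R + phi (t - u)%R).
  assert (cpsi : cts psi).
  { unfold psi. apply (cts_plus (fun u => phi (u + t)%R) (fun u => phi (t - u)%R));
    apply (cts_comp phi); auto; intros u.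
    - apply (continuous_plus (V := R_NormedModule)); [apply continuous_id|apply continuous_const].
    - apply (continuous_minus (V := R_NormedModule)); [apply continuous_const|apply continuous_id]. }
  rewrite (CInt_period_sym phi t) in E0 by auto. fold psi in E0.
  rewrite <- (CInt_Chasles psi 0 s0 (1 / 2)) in E0 by auto.
  assert (Zw : z - w = 2 * Ci * RtoC tau * dg t).
  { unfold z, w, normal_pt. rewrite RtoC_opp. ring. }
  assert (P1 : forall s, Rabs s <= s0 -> Cmod (phi (t + s)%R - (2 * Ci) * RtoC (tau / (s ^ 2 + tau ^ 2)))
     <= 1 / 4 * (tau / (s ^ 2 + tau ^ 2))).
  { intros s Hs. destruct (U t s Hs) as [U1 U2].
    assert (Hs' : Rabs s <= 1 / 2) by lra.
    set (r1 := gam (t + s) - gam t - RtoC s * dg t) in *.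
    set (r2 := dg (t + s) - dg t) in *.
    assert (Xz : gam (t + s) - gam t - Ci * RtoC tau * dg t = gam (t + s) - z) by (unfold z, normal_pt; ring).
    assert (Xw : gam (t + s) - gam t + Ci * RtoC tau * dg t = gam (t + s) - w).
    { unfold w, normal_pt; rewrite RtoC_opp; ring. }
    pose proof (jump_kernel_estimate (dg t) (gam (t + s) - gam t) r1 r2 s tau eta L c Hc (proj1 Htau) He
      (proj2 (proj2 (proj2 (proj2 Hreg))) t) (proj2 (HmL t)) U2 U1) as J.
    rewrite Xz, Xw in J.
    unfold phi. rewrite Zw. replace (dg (t + s)) with (dg t + r2) by (unfold r2; ring).
    eapply Rle_trans; [apply J; auto; unfold r1; ring|].
    apply Rmult_le_compat_r; [|exact He2]. assert (0 < s ^ 2 + tau ^ 2) by nra.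
    left; apply Rdiv_lt_0_compat; lra. }
  (* The factor 4 i is twice 2 i: after folding, s = u and s = -u contribute equally. *)
  set (main := fun u => (RtoC 4 * Ci) * RtoC (tau / (u ^ 2 + tau ^ 2))).
  assert (cmain : cts main).
  { unfold main. apply (cts_mult (fun _ => RtoC 4 * Ci)); [apply cts_const|].
    apply (cts_RtoC (fun u => tau / (u ^ 2 + tau ^ 2))%R). intros u. apply continuous_atan_kernel. lra. }
  assert (B1 : Cmod (CInt psi 0 s0 - CInt main 0 s0) <= 1).
  { rewrite <- CInt_minus by auto.
    apply Rle_trans with (1 / 2 * atan (s0 / tau) - 1 / 2 * atan (0 / tau))%R.
    - apply (Cmod_CInt_le_derive (fun u => psi u - main u) (fun u => 1 / 2 * atan (u / tau))%R
        (fun u => 1 / 2 * (tau / (u ^ 2 + tau ^ 2)))%R); [lra|apply cts_minus; auto| | |].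
      + intros u Hu. unfold psi, main.
        pose proof (P1 u ltac:(rewrite Rabs_pos_eq; lra)) as A1.
        pose proof (P1 (- u)%R ltac:(rewrite Rabs_Ropp, Rabs_pos_eq; lra)) as A2.
        replace ((- u) ^ 2)%R with (u ^ 2)%R in A2 by ring.
        rewrite (Rplus_comm u t).
        set (k := (tau / (u ^ 2 + tau ^ 2))%R) in *.
        replace (phi (t + u)%R + phi (t - u)%R - RtoC 4 * Ci * RtoC k) with
          ((phi (t + u)%R - 2 * Ci * RtoC k) + (phi (t + - u)%R - 2 * Ci * RtoC k)).
        2:{ change (t - u)%R with (t + - u)%R. replace (RtoC 4) with (2 + 2) by (rewrite <- RtoC_plus; f_equal; ring). ring. }
        eapply Rle_trans; [apply Cmod_triangle|]. lra.
      + intros u Hu. apply (is_derive_scal (fun u => atan (u / tau))). apply is_derive_atan_scale. lra.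
      + intros u Hu. apply (continuous_mult (K := R_AbsRing)); [apply continuous_const|].
        apply continuous_atan_kernel. lra.
    - replace (0 / tau)%R with 0%R by (field; lra). rewrite atan_0.
      pose proof (atan_bound (s0 / tau)). pose proof PI_4. lra. }
  assert (B2 : Cmod (CInt main 0 s0 - 2 * RtoC PI * Ci) <= 1 / 2).
  { unfold main. rewrite CInt_atan_kernel by lra.
    replace (s0 / tau)%R with (/ (tau / s0))%R by (field; lra).
    rewrite atan_inv by (apply Rdiv_lt_0_compat; lra).
    set (A := atan (tau / s0)).
    replace (RtoC 4 * Ci * RtoC (PI / 2 - A) - 2 * RtoC PI * Ci) with (- (Ci * RtoC (4 * A))).
    2:{ unfold RtoC, Ci, Cmult, Cminus, Cplus, Copp; simpl. f_equal; field. }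
    rewrite Cmod_opp, Cmod_mult, Cmod_Ci, Cmod_R.
    assert (TS : tau / s0 <= 1 / 8) by (apply Rle_div_l; lra).
    assert (TS0 : 0 <= tau / s0) by (left; apply Rdiv_lt_0_compat; lra).
    pose proof (atan_le_id (tau / s0) TS0) as AA. fold A in AA.
    rewrite Rabs_pos_eq; lra. }
  assert (B3 : Cmod (CInt psi s0 (1 / 2)) <= 1 / 2).
  { assert (K : forall s, s0 <= Rabs s <= 1 / 2 -> Cmod (phi (t + s)%R) <= 1 / 2).
    { intros s Hs. unfold phi. rewrite Cmod_mult.
      pose proof (LBz s (proj2 Hs)) as Bz. pose proof (LBw s (proj2 Hs)) as Bw.
      assert (cs : c * s0 <= c * (Rabs s + tau)) by (apply Rmult_le_compat_l; lra).
      assert (csp : 0 < c * s0) by nra.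
      assert (K1 : Cmod ((z - w) / ((gam (t + s) - z) * (gam (t + s) - w))) <= (2 * tau * L) / ((c * s0) * (c * s0))).
      { apply Cmod_div_le; [nra| |].
        - rewrite Cmod_mult. apply Rmult_le_compat; lra.
        - rewrite Zw, !Cmod_mult, Cmod_Ci, !Cmod_R, !Rabs_pos_eq by lra. rewrite Rmult_1_r.
          apply Rmult_le_compat_l; [lra|apply HmL]. }
      apply Rle_trans with ((2 * tau * L) / ((c * s0) * (c * s0)) * L)%R.
      { apply Rmult_le_compat; auto; try apply Cmod_ge_0. apply HmL. }
      replace ((2 * tau * L) / ((c * s0) * (c * s0)) * L)%R with (1 / 2 * (tau / q))%R by (unfold q; field; lra).
      assert (tau / q <= 1) by (apply Rle_div_l; lra). lra. }
    apply Rle_trans with ((1 / 2 - s0) * 1)%R; [|lra].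
    apply Cmod_CInt_le_const; [lra|auto|].
    intros u Hu. unfold psi. eapply Rle_trans; [apply Cmod_triangle|].
    pose proof (K u ltac:(rewrite Rabs_pos_eq; lra)) as A1.
    pose proof (K (- u)%R ltac:(rewrite Rabs_Ropp, Rabs_pos_eq; lra)) as A2.
    rewrite (Rplus_comm u t). change (t - u)%R with (t + - u)%R. lra. }
  (* The three errors are at most 1, 1/2 and 1/2, and |1 / (2 pi i)| <= 1/6, so the total is at most
     1/3. *)
  replace (wind gam z - wind gam w - 1) with
    (c2pi * ((CInt psi 0 s0 - CInt main 0 s0) + (CInt main 0 s0 - 2 * RtoC PI * Ci) + CInt psi s0 (1 / 2))).
  2:{ rewrite E0.
      replace (RtoC 1) with (c2pi * (2 * RtoC PI * Ci)) by (unfold c2pi; apply Cinv_l, two_pi_i_neq_0).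
      ring. }
  rewrite Cmod_mult.
  pose proof (Cmod_triangle ((CInt psi 0 s0 - CInt main 0 s0) + (CInt main 0 s0 - 2 * RtoC PI * Ci)) (CInt psi s0 (1 / 2))).
  pose proof (Cmod_triangle (CInt psi 0 s0 - CInt main 0 s0) (CInt main 0 s0 - 2 * RtoC PI * Ci)).
  pose proof Cmod_c2pi_le.
  apply Rle_trans with (1 / 6 * 2)%R; [|lra].
  apply Rmult_le_compat; try apply Cmod_ge_0; lra.
Qed.

(** The Jordan curve theorem is bypassed: off the loop, [intD] is by definition the complement of
    [extD], and [pos_oriented] prescribes the value on it. *)
Lemma wind_0_or_1 (z : C) : pos_oriented gam -> ~ onG gam z ->
  (wind gam z = 0 /\ extD gam z) \/ (wind gam z = 1 /\ intD gam z).
Proof.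
  intros Hpos Hz. destruct (classic (extD gam z)) as [H|H].
  - left. split; auto. now apply (wind_ext gam Hreg).
  - right. assert (intD gam z) by (split; auto). split; auto.
Qed.

(** Two numbers from {0, 1} whose difference is within 1/2 of 1 must be 1 and 0, in this order. In
    particular the interior is not empty. *)
Lemma sides_of_loop : pos_oriented gam -> exists tau0, 0 < tau0 /\
  forall t tau, 0 < tau <= tau0 -> intD gam (npt t tau) /\ extD gam (npt t (- tau)).
Proof.
  intros Hpos. destruct wind_jump_estimate as (tau0 & H0 & J).
  destruct (normal_pt_lower_bound gam Hreg) as (c & tau1 & Hc & Ht1 & LB).
  exists (Rmin tau0 tau1). split; [now apply Rmin_pos|].
  intros t tau Htau. pose proof (Rmin_l tau0 tau1). pose proof (Rmin_r tau0 tau1).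
  assert (off : forall x, Rabs x = tau -> ~ onG gam (npt t x)).
  { intros x Hx. apply (dist_offG gam _ (c * tau)); [nra|].
    apply (loop_lower_bound_all t); [lra|].
    intros s Hs. rewrite <- Hx, Rplus_comm. apply LB; lra. }
  specialize (J t tau ltac:(lra)).
  destruct (wind_0_or_1 (npt t tau) Hpos) as [[E1 D1]|[E1 D1]]; [apply off, Rabs_pos_eq; lra| |];
  destruct (wind_0_or_1 (npt t (- tau)) Hpos) as [[E2 D2]|[E2 D2]];
    try (apply off; rewrite Rabs_Ropp, Rabs_pos_eq; lra); auto; exfalso;
  rewrite E1, E2 in J.
  - replace (0 - 0 - 1) with (RtoC (- 1)) in J by (unfold RtoC, Cminus, Cplus, Copp; simpl; f_equal; ring).
    rewrite Cmod_R, Rabs_left in J; lra.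
  - replace (0 - 1 - 1) with (RtoC (- 2)) in J.
    + rewrite Cmod_R, Rabs_left in J; lra.
    + unfold RtoC, Cminus, Cplus, Copp; simpl. f_equal; ring.
  - replace (1 - 1 - 1) with (RtoC (- 1)) in J by (unfold RtoC, Cminus, Cplus, Copp; simpl; f_equal; ring).
    rewrite Cmod_R, Rabs_left in J; lra.
Qed.

End Sides.

(** * Hölder functions *)

Lemma Rpower_pos (x a : R) : 0 < Rpower x a.
Proof. apply exp_pos. Qed.

Lemma Rpower_le_mono (x y a : R) : 0 <= a -> 0 < x <= y -> Rpower x a <= Rpower y a.
Proof. intros Ha Hxy. apply Rle_Rpower_l; auto. Qed.

Lemma Rpower_double (x a : R) : 0 < x -> 0 <= a <= 1 -> Rpower (2 * x) a <= 2 * Rpower x a.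
Proof.
  intros Hx Ha. rewrite <- Rpower_mult_distr by lra.
  apply Rmult_le_compat_r; [left; apply Rpower_pos|].
  rewrite <- (Rpower_1 2) at 2 by lra. apply Rle_Rpower; lra.
Qed.

Lemma Rpower_small (K eps a : R) : 0 < a -> 0 <= K -> 0 < eps ->
  exists r, 0 < r /\ forall x, 0 < x <= r -> K * Rpower x a <= eps.
Proof.
  intros Ha HK He. set (y := (eps / (K + 1))%R).
  assert (Hy : 0 < y) by (apply Rdiv_lt_0_compat; lra).
  exists (Rpower y (/ a)). split; [apply Rpower_pos|]. intros x Hx.
  apply Rle_trans with (K * y)%R.
  - apply Rmult_le_compat_l; auto.
    replace y with (Rpower (Rpower y (/ a)) a).
    + apply Rpower_le_mono; lra.
    + rewrite Rpower_mult, Rinv_l, Rpower_1; lra.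
  - assert (E : ((K + 1) * y = eps)%R) by (unfold y; field; lra). nra.
Qed.

(** Any positive upper bound r of the distance is allowed, which spares the case z = w: [Rpower] is
    positive even at 0, so [holder] itself has to exclude that case. *)
Lemma holder_bound (sigma : R) (S : C -> Prop) (f : C -> C) : 0 < sigma -> holder sigma S f ->
  exists K, 0 <= K /\ forall z w r, S z -> S w -> 0 < r -> Cmod (z - w) <= r ->
    Cmod (f z - f w) <= K * Rpower r sigma.
Proof.
  intros Hs [K H]. exists (Rabs K). split; [apply Rabs_pos|].
  intros z w r Hz Hw Hr Hzw. pose proof (Rpower_pos r sigma) as P.
  destruct (classic (z = w)) as [E|E].
  - subst w. replace (f z - f z) with (RtoC 0) by ring. rewrite Cmod_0.
    apply Rmult_le_pos; [apply Rabs_pos|lra].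
  - eapply Rle_trans; [apply H; auto|].
    pose proof (Cmod_sub_gt_0 _ _ E). pose proof (Rpower_pos (Cmod (z - w)) sigma).
    apply Rle_trans with (Rabs K * Rpower (Cmod (z - w)) sigma)%R.
    + apply Rmult_le_compat_r; [lra|apply Rle_abs].
    + apply Rmult_le_compat_l; [apply Rabs_pos|]. apply Rpower_le_mono; lra.
Qed.

Lemma holder_subset (sigma : R) (S T : C -> Prop) (f : C -> C) :
  (forall z, S z -> T z) -> holder sigma T f -> holder sigma S f.
Proof. intros ST [K H]. exists K. auto. Qed.

Lemma holder_ext (sigma : R) (S : C -> Prop) (f g : C -> C) :
  (forall z, S z -> f z = g z) -> holder sigma S f -> holder sigma S g.
Proof. intros E [K H]. exists K. intros z w Hz Hw N. rewrite <- !E by auto. auto. Qed.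

Lemma holder_const (sigma : R) (S : C -> Prop) (c : C) : holder sigma S (fun _ => c).
Proof.
  exists 0%R. intros z w _ _ _. replace (c - c) with (RtoC 0) by ring. rewrite Cmod_0. lra.
Qed.

Lemma holder_opp (sigma : R) (S : C -> Prop) (f : C -> C) :
  holder sigma S f -> holder sigma S (fun z => - f z).
Proof.
  intros [K H]. exists K. intros z w Hz Hw N.
  replace (- f z - - f w) with (- (f z - f w)) by ring. rewrite Cmod_opp. auto.
Qed.

Lemma holder_conj (sigma : R) (S : C -> Prop) (f : C -> C) :
  holder sigma S f -> holder sigma S (fun z => Cconj (f z)).
Proof.
  intros [K H]. exists K. intros z w Hz Hw N.
  rewrite <- Cminus_conj, Cmod_conj. auto.
Qed.

(** The choice term inside [Hop] with function and side made parameters, so that [Hop] is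
    convertible to an instance. Taken at all points of the closure of S it also serves as the
    extension of f to that closure. *)
Definition lim_at (f : C -> C) (S : C -> Prop) (z : C) : C :=
  epsilon (inhabits (RtoC 0))
    (fun l => filterlim f (within S (locally z)) (locally l)).

Lemma filterlim_within_iff (f : C -> C) (S : C -> Prop) (z l : C) :
  filterlim f (within S (locally z)) (locally l) <->
  forall eps : R, 0 < eps -> exists d, 0 < d /\
    forall w, S w -> Cmod (w - z) < d -> Cmod (f w - l) < eps.
Proof.
  rewrite (filterlim_Cmod (within S (locally z))). unfold within. split; intros H eps He.
  - destruct (proj1 (locally_Cmod _ _) (H eps He)) as [d [Hd K]]. exists d; auto.
  - apply locally_Cmod. destruct (H eps He) as [d [Hd K]]. exists d; auto.
Qed.

Lemma lim_at_unique (f : C -> C) (S : C -> Prop) (z l : C) : clos S z ->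
  filterlim f (within S (locally z)) (locally l) -> lim_at f S z = l.
Proof.
  intros Hz Hl.
  assert (H2 : filterlim f (within S (locally z)) (locally (lim_at f S z))).
  { unfold lim_at. apply epsilon_spec. now exists l. }
  apply eq_of_Cmod_le_all. intros eps He.
  destruct (proj1 (filterlim_within_iff _ _ _ _) Hl (eps / 2)%R ltac:(lra)) as [d1 [D1 K1]].
  destruct (proj1 (filterlim_within_iff _ _ _ _) H2 (eps / 2)%R ltac:(lra)) as [d2 [D2 K2]].
  destruct (Hz (Rmin d1 d2)) as [w [Hw Wz]]; [now apply Rmin_pos|].
  specialize (K1 w Hw ltac:(eapply Rlt_le_trans; [exact Wz|apply Rmin_l])).
  specialize (K2 w Hw ltac:(eapply Rlt_le_trans; [exact Wz|apply Rmin_r])).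
  pose proof (Cmod_tri (lim_at f S z) (f w) l). rewrite (Cmod_sub_sym _ (f w)) in H. lra.
Qed.

(** A Hölder function sends the trace on S of the neighbourhoods of z to a Cauchy filter, and C is
    complete. That z lies in the closure makes this trace a proper filter. *)
Lemma lim_at_holder_spec (sigma : R) (f : C -> C) (S : C -> Prop) (z : C) :
  0 < sigma -> holder sigma S f -> clos S z ->
  filterlim f (within S (locally z)) (locally (lim_at f S z)).
Proof.
  intros Hs Hf Hz. destruct (holder_bound _ _ _ Hs Hf) as [K [HK H]].
  unfold lim_at. apply epsilon_spec.
  assert (PF : ProperFilter (within S (@locally C_UniformSpace z))).
  { constructor; [|apply within_filter, locally_filter].
    intros P HP. apply locally_Cmod in HP. destruct HP as [d [Hd HP]].
    destruct (Hz d Hd) as [w [Hw Wz]]. exists w. auto. }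
  apply (filterlim_locally_cauchy (U := C_R_CompleteNormedModule)).
  intros eps.
  destruct (Rpower_small K (eps / 2) sigma Hs HK) as [r [Hr Kr]]; [pose proof (cond_pos eps); lra|].
  exists (fun w => S w /\ Cmod (w - z) < r / 2). split.
  - apply locally_Cmod. exists (r / 2)%R. split; [lra|]. auto.
  - intros u v [Su Hu] [Sv Hv]. apply (ball_C_Cmod (f u) (f v) eps).
    assert (Cmod (v - u) <= r).
    { pose proof (Cmod_tri v z u). rewrite (Cmod_sub_sym z u) in H0. lra. }
    eapply Rle_lt_trans; [apply (H v u r); auto|]. specialize (Kr r ltac:(lra)).
    pose proof (cond_pos eps). lra.
Qed.

Lemma subset_clos (S : C -> Prop) (z : C) : S z -> clos S z.
Proof.
  intros Hz eps He. exists z. split; auto. replace (z - z) with (RtoC 0) by ring. now rewrite Cmod_0.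
Qed.

Lemma lim_at_eq (sigma : R) (f G : C -> C) (S : C -> Prop) (z : C) : 0 < sigma ->
  holder sigma (clos S) G -> (forall w, S w -> f w = G w) -> clos S z -> lim_at f S z = G z.
Proof.
  intros Hs HG E Hz. apply lim_at_unique; auto. apply filterlim_within_iff. intros eps He.
  destruct (holder_bound _ _ _ Hs HG) as [K [HK H]].
  destruct (Rpower_small K (eps / 2) sigma Hs HK) as [r [Hr Kr]]; [lra|].
  exists r. split; auto. intros w Hw Wz. rewrite E by auto.
  eapply Rle_lt_trans; [apply (H w z r)|]; auto; [now apply subset_clos|lra|].
  specialize (Kr r ltac:(lra)). lra.
Qed.

Lemma lim_at_on (sigma : R) (f : C -> C) (S : C -> Prop) (z : C) :
  0 < sigma -> holder sigma S f -> S z -> lim_at f S z = f z.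
Proof.
  intros Hs Hf Hz. apply lim_at_unique; [now apply subset_clos|].
  apply filterlim_within_iff. intros eps He.
  destruct (holder_bound _ _ _ Hs Hf) as [K [HK H]].
  destruct (Rpower_small K (eps / 2) sigma Hs HK) as [r [Hr Kr]]; [lra|].
  exists r. split; auto. intros w Hw Wz.
  eapply Rle_lt_trans; [apply (H w z r)|]; auto; [lra|].
  specialize (Kr r ltac:(lra)). lra.
Qed.

Lemma holder_lim_at (sigma : R) (f : C -> C) (S : C -> Prop) : 0 < sigma < 1 ->
  holder sigma S f -> holder sigma (clos S) (lim_at f S).
Proof.
  intros Hs Hf. destruct (holder_bound _ _ _ (proj1 Hs) Hf) as [K [HK H]].
  (* Points of S within r/2 of z and w are at most 2 r apart, which costs K (2 r)^sigma <= 2 K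
     r^sigma; replacing each limit by a value of f costs another r^sigma. *)
  exists (2 * K + 2)%R. intros z w Hz Hw N.
  set (r := Cmod (z - w)). assert (Hr : 0 < r) by now apply Cmod_sub_gt_0.
  pose proof (Rpower_pos r sigma) as P.
  pose proof (lim_at_holder_spec _ _ _ z (proj1 Hs) Hf Hz) as Lz.
  pose proof (lim_at_holder_spec _ _ _ w (proj1 Hs) Hf Hw) as Lw.
  destruct (proj1 (filterlim_within_iff _ _ _ _) Lz _ P) as [d1 [D1 K1]].
  destruct (proj1 (filterlim_within_iff _ _ _ _) Lw _ P) as [d2 [D2 K2]].
  destruct (Hz (Rmin d1 (r / 2))) as [z' [Hz' Z]]; [apply Rmin_pos; lra|].
  destruct (Hw (Rmin d2 (r / 2))) as [w' [Hw' W]]; [apply Rmin_pos; lra|].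
  specialize (K1 z' Hz' ltac:(eapply Rlt_le_trans; [exact Z|apply Rmin_l])).
  specialize (K2 w' Hw' ltac:(eapply Rlt_le_trans; [exact W|apply Rmin_l])).
  assert (Z2 : Cmod (z' - z) <= r / 2) by (left; eapply Rlt_le_trans; [exact Z|apply Rmin_r]).
  assert (W2 : Cmod (w' - w) <= r / 2) by (left; eapply Rlt_le_trans; [exact W|apply Rmin_r]).
  assert (D : Cmod (z' - w') <= 2 * r).
  { pose proof (Cmod_tri z' z w'). pose proof (Cmod_tri z w w').
    rewrite (Cmod_sub_sym w w') in H1. fold r in H1. lra. }
  pose proof (H z' w' (2 * r)%R Hz' Hw' ltac:(lra) D) as HH.
  pose proof (Rpower_double r sigma Hr ltac:(lra)) as RD.
  pose proof (Cmod_tri (lim_at f S z) (f z') (lim_at f S w)) as T1.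
  pose proof (Cmod_tri (f z') (f w') (lim_at f S w)) as T2.
  rewrite (Cmod_sub_sym _ (f z')) in T1.
  assert (K * Rpower (2 * r) sigma <= K * (2 * Rpower r sigma)) by (apply Rmult_le_compat_l; lra).
  lra.
Qed.

(** * Singular kernel estimates *)

Lemma is_derive_Rpower_shift (d a u : R) : 0 < d + u ->
  is_derive (fun u => Rpower (d + u) a) u (a * Rpower (d + u) (a - 1))%R.
Proof.
  intros H. apply is_derive_Reals.
  replace (a * Rpower (d + u) (a - 1))%R with (a * Rpower (d + u) (a - 1) * 1)%R by ring.
  apply (derivable_pt_lim_comp (fun u => d + u)%R (fun x => Rpower x a)).
  - replace 1%R with (0 + 1)%R by ring.
    apply derivable_pt_lim_plus; [apply derivable_pt_lim_const|apply derivable_pt_lim_id].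
  - now apply derivable_pt_lim_power.
Qed.

Lemma continuous_Rpower_shift (d a u : R) : 0 < d + u -> continuous (fun u => Rpower (d + u) a) u.
Proof.
  intros H. apply (ex_derive_continuous (V := R_NormedModule)).
  eexists. now apply is_derive_Rpower_shift.
Qed.

Lemma Rpower_minus_1 (x a : R) : 0 < x -> (Rpower x (a - 1) = Rpower x a / x)%R.
Proof.
  intros Hx. unfold Rminus. rewrite Rpower_plus, Rpower_Ropp, Rpower_1 by auto. reflexivity.
Qed.

(** The part u <= delta of the singular integral yields 2 / sigma, the tail 1 / (1 - sigma); they
    blow up at the two ends of the admissible range of sigma. *)
Definition Ksig (sigma : R) : R := (2 / sigma + 1 / (1 - sigma))%R.

Lemma Ksig_pos (sigma : R) : 0 < sigma < 1 -> 0 < Ksig sigma.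
Proof.
  intros Hs. unfold Ksig.
  assert (0 < 2 / sigma) by (apply Rdiv_lt_0_compat; lra).
  assert (0 < 1 / (1 - sigma)) by (apply Rdiv_lt_0_compat; lra). lra.
Qed.

(** The second factor of the majorant is at most 1 on [0, delta], and at most delta / (d + u)
    beyond, because d <= delta. Both resulting majorants have power functions as primitives, and the
    bound does not degenerate as d tends to 0. *)
Lemma singular_integral_bound (sigma N d delta : R) (psi : R -> C) :
  0 < sigma < 1 -> 0 <= N -> 0 < d <= delta -> delta <= 1 / 2 -> cts psi ->
  (forall u, 0 <= u <= 1 / 2 ->
    Cmod (psi u) <= N * (Rpower (d + u) (sigma - 1) * (delta / (delta + u)))) ->
  Cmod (CInt psi 0 (1 / 2)) <= N * Ksig sigma * Rpower delta sigma.
Proof.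
  intros Hs HN Hd Hdel Hc H.
  rewrite <- (CInt_Chasles psi 0 delta (1 / 2)) by auto.
  eapply Rle_trans; [apply Cmod_triangle|].
  pose proof (Rpower_pos delta sigma) as Pd.
  assert (A1 : Cmod (CInt psi 0 delta) <= N * (2 / sigma) * Rpower delta sigma).
  { apply Rle_trans with (N / sigma * Rpower (d + delta) sigma - N / sigma * Rpower (d + 0) sigma)%R.
    - apply (Cmod_CInt_le_derive psi (fun u => N / sigma * Rpower (d + u) sigma)%R
        (fun u => N / sigma * (sigma * Rpower (d + u) (sigma - 1)))%R); [lra|auto| | |].
      + intros u Hu. eapply Rle_trans; [apply H; lra|].
        replace (N / sigma * (sigma * Rpower (d + u) (sigma - 1)))%R with
          (N * (Rpower (d + u) (sigma - 1) * 1))%R by (field; lra).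
        apply Rmult_le_compat_l; auto. apply Rmult_le_compat_l; [left; apply Rpower_pos|].
        apply Rle_div_l; lra.
      + intros u Hu. apply (is_derive_scal (fun u => Rpower (d + u) sigma)).
        apply is_derive_Rpower_shift. lra.
      + intros u Hu. apply (continuous_mult (K := R_AbsRing)); [apply continuous_const|].
        apply (continuous_mult (K := R_AbsRing)); [apply continuous_const|].
        apply continuous_Rpower_shift. lra.
    - assert (Q : Rpower (d + delta) sigma <= 2 * Rpower delta sigma).
      { eapply Rle_trans; [|apply Rpower_double; lra]. apply Rpower_le_mono; lra. }
      assert (0 <= N / sigma) by (apply Rle_div_r; lra).
      pose proof (Rpower_pos (d + 0) sigma).
      replace (N * (2 / sigma))%R with (N / sigma * 2)%R by (field; lra).
      assert (N / sigma * Rpower (d + delta) sigma <= N / sigma * (2 * Rpower delta sigma)) by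
        (apply Rmult_le_compat_l; lra). nra. }
  assert (A2 : Cmod (CInt psi delta (1 / 2)) <= N * (1 / (1 - sigma)) * Rpower delta sigma).
  { set (k := (- (N * delta / (1 - sigma)))%R).
    apply Rle_trans with (k * Rpower (d + 1 / 2) (sigma - 1) - k * Rpower (d + delta) (sigma - 1))%R.
    - apply (Cmod_CInt_le_derive psi (fun u => k * Rpower (d + u) (sigma - 1))%R
        (fun u => k * ((sigma - 1) * Rpower (d + u) (sigma - 1 - 1)))%R); [lra|auto| | |].
      + intros u Hu. eapply Rle_trans; [apply H; lra|].
        rewrite (Rpower_minus_1 _ (sigma - 1)) by lra.
        set (p := Rpower (d + u) (sigma - 1)).
        replace (k * ((sigma - 1) * (p / (d + u))))%R with (N * (p * (delta / (d + u))))%R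
          by (unfold k; field; split; lra).
        apply Rmult_le_compat_l; auto. apply Rmult_le_compat_l; [left; apply Rpower_pos|].
        apply Rmult_le_compat_l; [lra|]. apply Rinv_le_contravar; lra.
      + intros u Hu. apply (is_derive_scal (fun u => Rpower (d + u) (sigma - 1))).
        apply is_derive_Rpower_shift. lra.
      + intros u Hu. apply (continuous_mult (K := R_AbsRing)); [apply continuous_const|].
        apply (continuous_mult (K := R_AbsRing)); [apply continuous_const|].
        apply continuous_Rpower_shift. lra.
    - assert (Q : delta * Rpower (d + delta) (sigma - 1) <= Rpower delta sigma).
      { replace (Rpower delta sigma) with (delta * Rpower delta (sigma - 1))%R.
        2:{ rewrite Rpower_minus_1 by lra. field. lra. }
        apply Rmult_le_compat_l; [lra|].
        replace (sigma - 1)%R with (- (1 - sigma))%R by ring. rewrite !Rpower_Ropp.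
        apply Rinv_le_contravar; [apply Rpower_pos|]. apply Rpower_le_mono; lra. }
      pose proof (Rpower_pos (d + 1 / 2) (sigma - 1)).
      assert (0 <= N / (1 - sigma)) by (apply Rle_div_r; lra).
      assert (0 <= N * delta / (1 - sigma)).
      { apply Rle_div_r; [lra|]. rewrite Rmult_0_l. apply Rmult_le_pos; lra. }
      replace (k * Rpower (d + 1 / 2) (sigma - 1) - k * Rpower (d + delta) (sigma - 1))%R with
        (N / (1 - sigma) * (delta * Rpower (d + delta) (sigma - 1))
         - N * delta / (1 - sigma) * Rpower (d + 1 / 2) (sigma - 1))%R by (unfold k; field; lra).
      replace (N * (1 / (1 - sigma)))%R with (N / (1 - sigma))%R by (field; lra).
      assert (N / (1 - sigma) * (delta * Rpower (d + delta) (sigma - 1)) <=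
        N / (1 - sigma) * Rpower delta sigma) by (apply Rmult_le_compat_l; lra).
      assert (0 <= N * delta / (1 - sigma) * Rpower (d + 1 / 2) (sigma - 1)) by (apply Rmult_le_pos; lra).
      lra. }
  unfold Ksig. lra.
Qed.

(** * Hölder continuity and jump of the Cauchy integral *)

Section Plemelj.
Context (gam : R -> C) (Hreg : regular_loop gam) (sigma : R) (Hsig : 0 < sigma < 1).
Notation dg := (dgam gam).
Notation npt := (normal_pt gam).

Let gam_periodic : periodic gam := proj1 Hreg.
Let dg_cts : cts dg := proj1 (proj2 (proj2 (proj2 Hreg))).
Let gam_cts : cts gam := loop_cts gam Hreg.
Let dg_periodic := dgam_periodic gam Hreg.

Lemma Lambda_param (F : C -> C) : Lambda sigma gam F ->
  exists K, 0 <= K /\ forall t s r, 0 < r -> Rabs s <= r ->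
    Cmod (F (gam (t + s)%R) - F (gam t)) <= K * Rpower r sigma.
Proof.
  intros HF. destruct (holder_bound _ _ _ (proj1 Hsig) HF) as [K [HK H]].
  destruct (dgam_bounds gam Hreg) as (m & L & Hm & HL & HmL).
  exists (K * Rpower L sigma)%R. split; [apply Rmult_le_pos; [auto|left; apply Rpower_pos]|].
  intros t s r Hr Hs. rewrite Rmult_assoc, Rpower_mult_distr by auto.
  apply H; [now exists (t + s)%R|now exists t|nra|].
  eapply Rle_trans; [apply (loop_lipschitz gam Hreg L); apply HmL|].
  replace (t + s - t)%R with s by ring. apply Rmult_le_compat_l; lra.
Qed.

Lemma Lambda_ctsG (F : C -> C) : Lambda sigma gam F -> ctsG gam F.
Proof.
  intros HF t. apply cpt_iff. intros eps He.
  destruct (Lambda_param F HF) as [K [HK H]].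
  destruct (Rpower_small K (eps / 2) sigma (proj1 Hsig) HK) as [r [Hr Kr]]; [lra|].
  exists r. split; auto. intros s Hs.
  replace (gam s) with (gam (t + (s - t))%R) by (f_equal; ring).
  eapply Rle_lt_trans; [apply (H t (s - t)%R r); lra|]. specialize (Kr r ltac:(lra)). lra.
Qed.

(** With z at height d and w at height delta over [gam t], the Hölder factor (d + |s|)^sigma reduces
    the pole 1 / (d + |s|) to an integrable one, while delta / (delta + |s|) gives decay. The
    constant B depends on F and on c and M, but not on the positions; the lemma serves with d <
    delta (moving a point off the loop), with d = delta on one side, and with d = delta across the
    loop. *)
Lemma cauchy_diff_bound (F : C -> C) : Lambda sigma gam F -> forall c M, 0 < c -> 0 <= M ->
  exists B, 0 <= B /\ forall t d delta z w,
    0 < d <= delta -> delta <= 1 / 2 ->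
    (forall s, Rabs s <= 1 / 2 -> c * (d + Rabs s) <= Cmod (gam (t + s) - z)) ->
    (forall s, Rabs s <= 1 / 2 -> c * (delta + Rabs s) <= Cmod (gam (t + s) - w)) ->
    Cmod (z - w) <= M * delta ->
    Cmod (cauchy_int gam F z - cauchy_int gam F w - F (gam t) * (wind gam z - wind gam w))
      <= B * Rpower delta sigma.
Proof.
  intros HF c M Hc HM.
  destruct (Lambda_param F HF) as [K [HK HP]].
  pose proof (Lambda_ctsG F HF) as cF. unfold ctsG in cF.
  destruct (dgam_bounds gam Hreg) as (m & L & Hm & HL & HmL).
  set (N := (K * M * L / (c * c))%R).
  assert (cc : 0 < c * c) by nra.
  assert (HN : 0 <= N).
  { apply Rle_div_r; [auto|]. rewrite Rmult_0_l. repeat apply Rmult_le_pos; lra. }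
  pose proof (Ksig_pos sigma Hsig) as KS.
  exists (2 * N * Ksig sigma)%R. split; [apply Rmult_le_pos; lra|].
  intros t d delta z w Hd Hdel Bz Bw Hzw.
  assert (Oz : ~ onG gam z).
  { apply (dist_offG gam z (c * d)); [nra|]. apply (loop_lower_bound_all gam Hreg t); [lra|auto]. }
  assert (Ow : ~ onG gam w).
  { apply (dist_offG gam w (c * delta)); [nra|]. apply (loop_lower_bound_all gam Hreg t); [lra|auto]. }
  pose proof (offG_neq gam z Oz) as Nz. pose proof (offG_neq gam w Ow) as Nw.
  rewrite (cauchy_diff gam Hreg) by auto.
  set (phi := fun u => (F (gam u) - F (gam t)) * (z - w) / ((gam u - z) * (gam u - w)) * dg u).
  assert (cphi : cts phi).
  { unfold phi. cts_tac. intros u. now apply Cmult_neq_0. }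
  assert (pphi : periodic phi).
  { intros u. unfold phi. now rewrite gam_periodic, dg_periodic. }
  change (lint gam _) with (CInt phi 0 1).
  rewrite (CInt_period_sym phi t) by auto.
  assert (P : forall s, Rabs s <= 1 / 2 ->
    Cmod (phi (t + s)%R) <= N * (Rpower (d + Rabs s) (sigma - 1) * (delta / (delta + Rabs s)))).
  { intros s Hs. pose proof (Rabs_pos s) as Ps.
    specialize (Bz s Hs). specialize (Bw s Hs).
    set (a := (d + Rabs s)%R) in *. set (b := (delta + Rabs s)%R) in *.
    assert (Ha : 0 < a) by (unfold a; lra). assert (Hb : 0 < b) by (unfold b; lra).
    unfold phi. rewrite Cmod_mult.
    assert (Q : Cmod ((F (gam (t + s)%R) - F (gam t)) * (z - w) / ((gam (t + s) - z) * (gam (t + s) - w)))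
      <= (K * Rpower a sigma * (M * delta)) / ((c * a) * (c * b))).
    { apply Cmod_div_le.
      - apply Rmult_lt_0_compat; nra.
      - rewrite Cmod_mult. apply Rmult_le_compat; auto; nra.
      - rewrite Cmod_mult. apply Rmult_le_compat; auto; try apply Cmod_ge_0.
        apply HP; auto. unfold a; lra. }
    apply Rle_trans with ((K * Rpower a sigma * (M * delta)) / ((c * a) * (c * b)) * L)%R.
    - apply Rmult_le_compat; auto; try apply Cmod_ge_0. apply HmL.
    - right. rewrite Rpower_minus_1 by auto. unfold N. field. repeat split; lra. }
  rewrite Cmod_mult.
  assert (I : Cmod (CInt (fun u => phi (u + t)%R + phi (t - u)%R) 0 (1 / 2)) <= (2 * N) * Ksig sigma * Rpower delta sigma).
  { apply (singular_integral_bound sigma (2 * N) d delta); auto; [lra| |].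
    - apply (cts_plus (fun u => phi (u + t)%R) (fun u => phi (t - u)%R));
      apply (cts_comp phi); auto; intros u.
      + apply (continuous_plus (V := R_NormedModule)); [apply continuous_id|apply continuous_const].
      + apply (continuous_minus (V := R_NormedModule)); [apply continuous_const|apply continuous_id].
    - intros u Hu. eapply Rle_trans; [apply Cmod_triangle|].
      pose proof (P u ltac:(rewrite Rabs_pos_eq; lra)) as A1.
      pose proof (P (- u)%R ltac:(rewrite Rabs_Ropp, Rabs_pos_eq; lra)) as A2.
      rewrite Rabs_Ropp in A2. rewrite Rabs_pos_eq in A1, A2 by lra.
      rewrite (Rplus_comm u t). change (t - u)%R with (t + - u)%R. lra. }
  pose proof Cmod_c2pi_le. pose proof (Cmod_ge_0 (CInt (fun u => phi (u + t)%R + phi (t - u)%R) 0 (1 / 2))). nra.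
Qed.

(* [U] is the side of the loop towards which the normal [e i gam'] points. *)
Lemma cauchy_holder_side (F : C -> C) (U : C -> Prop) (e kappa tau0 c d0 : R) :
  Lambda sigma gam F -> Rabs e = 1 -> 0 < tau0 <= 1 / 2 -> 0 < c -> 0 < d0 ->
  (forall z, U z -> ~ onG gam z /\ wind gam z = RtoC kappa) ->
  (forall t tau, 0 < tau <= tau0 -> U (npt t (e * tau))) ->
  (forall t s tau, Rabs s <= 1 / 2 -> 0 < tau <= tau0 ->
     c * (tau + Rabs s) <= Cmod (gam (t + s) - npt t (e * tau))) ->
  (forall z, U z -> (exists t tau, 0 < tau <= tau0 /\ z = npt t (e * tau)) \/
                    (forall t, d0 <= Cmod (gam t - z))) ->
  holder sigma U (cauchy_int gam F).
Proof.
  intros HF He Ht0 Hc Hd0 HU HUn HLB HUz.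
  pose proof (Lambda_ctsG F HF) as cF.
  destruct (dgam_bounds gam Hreg) as (m & L & Hm & HL & HmL).
  set (E := cauchy_int gam F).
  destruct (cauchy_diff_bound F HF c L Hc ltac:(lra)) as (B1 & HB1 & K1).
  set (c' := Rmin c d0).
  assert (Hc' : 0 < c') by now apply Rmin_pos.
  assert (c'c : c' <= c) by apply Rmin_l. assert (c'd : c' <= d0) by apply Rmin_r.
  (* Raises a point along its normal to height delta unless it is already that far from the loop.
     Both points are in [U], where the winding number is kappa, so the correction term of
     [cauchy_diff_bound] vanishes. *)
  assert (Lift : forall z delta, U z -> 0 < delta <= tau0 -> exists z' t, U z' /\
    (forall s, Rabs s <= 1 / 2 -> c' * (delta + Rabs s) <= Cmod (gam (t + s) - z')) /\
    Cmod (z - z') <= L * delta /\ Cmod (E z - E z') <= B1 * Rpower delta sigma).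
  { intros z delta Hz Hdel. pose proof (Rpower_pos delta sigma) as Pd.
    assert (triv : Cmod (z - z) <= L * delta /\ Cmod (E z - E z) <= B1 * Rpower delta sigma).
    { replace (z - z) with (RtoC 0) by ring. replace (E z - E z) with (RtoC 0) by ring.
      rewrite Cmod_0. split; [nra|apply Rmult_le_pos; lra]. }
    destruct (HUz z Hz) as [(t & tau & Htau & Ez)|Far].
    - destruct (Rle_dec delta tau) as [P|P].
      + exists z, t. split; [auto|split; [|apply triv]].
        intros s Hs. eapply Rle_trans; [|rewrite Ez; apply HLB; auto].
        pose proof (Rabs_pos s). apply Rmult_le_compat; lra.
      + assert (Lo : forall s, Rabs s <= 1 / 2 -> c * (delta + Rabs s) <= Cmod (gam (t + s) - npt t (e * delta))).
        { intros s Hs. apply HLB; auto. }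
        assert (Dz : Cmod (z - npt t (e * delta)) <= L * delta).
        { rewrite Ez. unfold normal_pt.
          replace (gam t + Ci * RtoC (e * tau) * dg t - (gam t + Ci * RtoC (e * delta) * dg t)) with
            (Ci * RtoC (e * (tau - delta)) * dg t).
          2:{ rewrite !RtoC_mult, RtoC_minus. ring. }
          rewrite !Cmod_mult, Cmod_Ci, Cmod_R, Rabs_mult, He, (Rabs_left (tau - delta)) by lra.
          rewrite Rmult_comm, !Rmult_1_l. apply Rmult_le_compat; [apply Cmod_ge_0|lra|apply HmL|lra]. }
        exists (npt t (e * delta)), t. split; [auto|split; [|split; auto]].
        * intros s Hs. eapply Rle_trans; [|apply Lo; auto].
          pose proof (Rabs_pos s). apply Rmult_le_compat_r; lra.
        * pose proof (K1 t tau delta z (npt t (e * delta)) ltac:(lra) ltac:(lra)) as Q.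
          rewrite (proj2 (HU z Hz)), (proj2 (HU _ (HUn t delta Hdel))) in Q.
          replace (E z - E (npt t (e * delta))) with
            (E z - E (npt t (e * delta)) - F (gam t) * (RtoC kappa - RtoC kappa)) by ring.
          apply Q; auto. intros s Hs. rewrite Ez. now apply HLB.
    (* A far point needs no foot, and the parameter 0 is arbitrary: delta + |s| <= 1/2 + 1/2. *)
    - exists z, 0%R. split; [auto|split; [|apply triv]].
      intros s Hs. eapply Rle_trans; [|apply Far].
      pose proof (Rabs_pos s). apply Rle_trans with (c' * 1)%R; [|lra].
      apply Rmult_le_compat_l; lra. }
  set (M := (2 * L + 1)%R).
  (* The estimate needs both lifted points measured from the same foot t. As r <= |gam u - w'| / c'
     for all u, the shift of length M r from w' to z' costs the factor 1 + M / c'. *)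
  set (c2 := (c' / (1 + M / c'))%R).
  assert (Mc : 0 < M / c') by (apply Rdiv_lt_0_compat; unfold M; lra).
  assert (Hc2 : 0 < c2) by (apply Rdiv_lt_0_compat; lra).
  assert (c2c : c2 <= c') by (apply Rle_div_l; nra).
  destruct (cauchy_diff_bound F HF c2 M Hc2 ltac:(unfold M; lra)) as (B2 & HB2 & K2).
  destruct (periodic_bounded (fun t => F (gam t)) cF) as [B [HB FB]].
  { intros t. now rewrite gam_periodic. }
  set (M2 := (B / (c' * tau0) * L)%R).
  assert (ct : 0 < c' * tau0) by nra.
  assert (HM2 : 0 < M2) by (apply Rmult_lt_0_compat; [apply Rdiv_lt_0_compat|]; lra).
  (* At height tau0 the Cauchy integral is simply bounded, which settles pairs at distance more than
     tau0. *)
  assert (Far : forall z t, U z -> (forall s, Rabs s <= 1 / 2 -> c' * (tau0 + Rabs s) <= Cmod (gam (t + s) - z)) ->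
     Cmod (E z) <= M2).
  { intros z t Hz Hl. destruct (HU z Hz) as [Oz _]. pose proof (offG_neq gam z Oz) as Nz.
    unfold E. rewrite cauchy_lint, Cmod_mult. unfold ctsG in cF.
    assert (Cmod (lint gam (fun t => F (gam t) / (gam t - z))) <= M2).
    { apply (lint_bound gam Hreg); [apply HmL| |].
      - cts_tac.
      - intros u. apply Cmod_div_le; auto. apply (loop_lower_bound_all gam Hreg t); [lra|auto]. }
    pose proof Cmod_c2pi_le.
    pose proof (Cmod_ge_0 (lint gam (fun t => F (gam t) / (gam t - z)))). nra. }
  pose proof (Rpower_pos tau0 sigma) as Pt.
  exists (2 * B1 + B2 + 2 * M2 / Rpower tau0 sigma)%R.
  assert (HMt : 0 < 2 * M2 / Rpower tau0 sigma) by (apply Rdiv_lt_0_compat; lra).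
  intros z w Hz Hw Nzw. set (r := Cmod (z - w)). assert (Hr : 0 < r) by now apply Cmod_sub_gt_0.
  fold E. pose proof (Rpower_pos r sigma) as Pr.
  (* Close points are both lifted to height r, their own distance; the remaining pairs are lifted to
     tau0. *)
  destruct (Rle_dec r tau0) as [P|P].
  - destruct (Lift z r Hz ltac:(lra)) as (z' & t & Uz' & Lz & Dz & Ez).
    destruct (Lift w r Hw ltac:(lra)) as (w' & t' & Uw' & Lw & Dw & Ew).
    assert (Dzw : Cmod (z' - w') <= M * r).
    { pose proof (Cmod_tri z' z w') as T1. pose proof (Cmod_tri z w w') as T2.
      rewrite (Cmod_sub_sym z' z) in T1. fold r in T2. unfold M. lra. }
    assert (Q : Cmod (E z' - E w') <= B2 * Rpower r sigma).
    { replace (E z' - E w') with (E z' - E w' - F (gam t) * (wind gam z' - wind gam w')).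
      2:{ rewrite (proj2 (HU _ Uz')), (proj2 (HU _ Uw')). ring. }
      apply (K2 t r r); auto; [lra|lra| |].
      - intros s Hs. eapply Rle_trans; [|apply Lz; auto]. pose proof (Rabs_pos s).
        apply Rmult_le_compat_r; lra.
      - intros s Hs.
        pose proof (loop_lower_bound_all gam Hreg t' r c' w' ltac:(lra) Lw (t + s)) as W.
        pose proof (Lz s Hs) as Z. pose proof (Cmod_tri (gam (t + s)) w' z') as T.
        rewrite (Cmod_sub_sym w' z') in T.
        set (X := Cmod (gam (t + s) - w')) in *.
        assert (M * r <= M / c' * X).
        { replace (M * r)%R with (M / c' * (c' * r))%R by (field; lra). apply Rmult_le_compat_l; lra. }
        unfold c2. replace (c' / (1 + M / c') * (r + Rabs s))%R with
          ((c' * (r + Rabs s)) / (1 + M / c'))%R by (unfold Rdiv; ring).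
        apply Rle_div_l; [lra|]. lra. }
    pose proof (Cmod_tri (E z) (E z') (E w)) as T1. pose proof (Cmod_tri (E z') (E w') (E w)) as T2.
    rewrite (Cmod_sub_sym (E w') (E w)) in T2.
    assert (0 < 2 * M2 / Rpower tau0 sigma * Rpower r sigma) by (apply Rmult_lt_0_compat; lra). lra.
  - destruct (Lift z tau0 Hz ltac:(lra)) as (z' & t & Uz' & Lz & Dz & Ez).
    destruct (Lift w tau0 Hw ltac:(lra)) as (w' & t' & Uw' & Lw & Dw & Ew).
    pose proof (Far z' t Uz' Lz). pose proof (Far w' t' Uw' Lw).
    pose proof (Cmod_tri (E z) (E z') (E w)) as T1. pose proof (Cmod_tri (E z') (E w') (E w)) as T2.
    rewrite (Cmod_sub_sym (E w') (E w)) in T2. pose proof (Cmod_sub_le (E z') (E w')).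
    assert (RR : Rpower tau0 sigma <= Rpower r sigma) by (apply Rpower_le_mono; lra).
    assert (2 * M2 <= 2 * M2 / Rpower tau0 sigma * Rpower r sigma).
    { replace (2 * M2)%R with (2 * M2 / Rpower tau0 sigma * Rpower tau0 sigma)%R at 1 by (field; lra).
      apply Rmult_le_compat_l; lra. }
    assert (B1 * Rpower tau0 sigma <= B1 * Rpower r sigma) by (apply Rmult_le_compat_l; lra).
    assert (0 <= B2 * Rpower r sigma) by (apply Rmult_le_pos; lra). lra.
Qed.

Lemma near_loop (z : C) (tau0 m : R) : ~ onG gam z -> 0 < tau0 ->
  (forall t, m <= Cmod (dg t)) -> 0 < m ->
  (exists t tau, 0 < Rabs tau <= tau0 /\ z = npt t tau) \/ (forall t, tau0 * m <= Cmod (gam t - z)).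
Proof.
  intros Hz Ht Hm Hm0. destruct (nearest_point gam Hreg z) as (t & Min & tau & E).
  destruct (Rle_dec (Rabs tau) tau0) as [P|P].
  - left. exists t, tau. split; auto. split; auto. apply Rabs_pos_lt. intros ->.
    apply Hz. exists t. rewrite E. unfold normal_pt. ring.
  - right. intros u. eapply Rle_trans; [|apply Min].
    rewrite E. unfold normal_pt.
    replace (gam t - (gam t + Ci * RtoC tau * dg t)) with (- (Ci * RtoC tau * dg t)) by ring.
    rewrite Cmod_opp, !Cmod_mult, Cmod_Ci, Cmod_R, Rmult_1_l. apply Rmult_le_compat; auto; lra.
Qed.

Lemma plemelj (F : C -> C) : pos_oriented gam -> Lambda sigma gam F ->
  holder sigma (intD gam) (cauchy_int gam F) /\ holder sigma (extD gam) (cauchy_int gam F) /\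
  exists tau0 B, 0 < tau0 /\ 0 <= B /\ forall t tau, 0 < tau <= tau0 ->
    Cmod (cauchy_int gam F (npt t tau) - cauchy_int gam F (npt t (- tau)) - F (gam t)) <= B * Rpower tau sigma.
Proof.
  intros Hpos HF.
  destruct (dgam_bounds gam Hreg) as (m & L & Hm & HL & HmL).
  destruct (normal_pt_lower_bound gam Hreg) as (c & tau1 & Hc & Ht1 & LB).
  destruct (sides_of_loop gam Hreg Hpos) as (tau2 & Ht2 & Sides).
  set (tau0 := Rmin (1 / 2) (Rmin tau1 tau2)).
  assert (Ht0 : 0 < tau0 <= 1 / 2).
  { split; [repeat apply Rmin_pos; lra|apply Rmin_l]. }
  assert (T1 : tau0 <= tau1) by (eapply Rle_trans; [apply Rmin_r|apply Rmin_l]).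
  assert (T2 : tau0 <= tau2) by (eapply Rle_trans; [apply Rmin_r|apply Rmin_r]).
  assert (LB' : forall e, Rabs e = 1 -> forall t s tau, Rabs s <= 1 / 2 -> 0 < tau <= tau0 ->
     c * (tau + Rabs s) <= Cmod (gam (t + s) - npt t (e * tau))).
  { intros e He t s tau Hs Htau. pose proof (LB t s (e * tau)%R Hs) as Q.
    rewrite Rabs_mult, He, Rmult_1_l, (Rabs_pos_eq tau) in Q by lra.
    rewrite Rplus_comm. apply Q. lra. }
  assert (A1 : Rabs 1 = 1) by (apply Rabs_pos_eq; lra).
  assert (A2 : Rabs (- (1)) = 1) by (rewrite Rabs_Ropp; auto).
  assert (mt : 0 < tau0 * m) by nra.
  split; [|split].
  - apply (cauchy_holder_side F (intD gam) 1 1 tau0 c (tau0 * m)); auto.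
    + intros z Hz. split; [apply Hz|now apply Hpos].
    + intros t tau Htau. rewrite Rmult_1_l. apply Sides. lra.
    + intros z Hz. destruct (near_loop z tau0 m (proj1 Hz)) as [(t & tau & Htau & E)|]; auto; [lra|apply HmL|].
      (* A negative height would place z in the exterior by [Sides]. *)
      left. destruct (Rle_dec 0 tau) as [P|P].
      * rewrite Rabs_pos_eq in Htau by auto. exists t, tau. split; auto. now rewrite Rmult_1_l.
      * exfalso. rewrite Rabs_left in Htau by lra. apply (proj2 Hz). rewrite E.
        replace tau with (- - tau)%R by ring. apply Sides. lra.
  - apply (cauchy_holder_side F (extD gam) (- (1)) 0 tau0 c (tau0 * m)); auto.
    + intros z Hz. split; [apply Hz|now apply (wind_ext gam Hreg)].
    + intros t tau Htau. replace (- (1) * tau)%R with (- tau)%R by ring. apply Sides. lra.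
    + intros z Hz. destruct (near_loop z tau0 m (proj1 Hz)) as [(t & tau & Htau & E)|]; auto; [lra|apply HmL|].
      left. destruct (Rle_dec 0 tau) as [P|P].
      * exfalso. rewrite Rabs_pos_eq in Htau by auto.
        apply (proj2 (proj1 (Sides t tau ltac:(lra)))). now rewrite <- E.
      * rewrite Rabs_left in Htau by lra. exists t, (- tau)%R. split; auto.
        now replace (- (1) * - tau)%R with tau by ring.
  - destruct (cauchy_diff_bound F HF c (2 * L) Hc ltac:(lra)) as (B & HB & K).
    exists tau0, B. split; [lra|split; [auto|]]. intros t tau Htau.
    destruct (Sides t tau ltac:(lra)) as [S1 S2].
    replace (F (gam t)) with (F (gam t) * (wind gam (npt t tau) - wind gam (npt t (- tau)))).
    2:{ rewrite (Hpos _ S1), (wind_ext gam Hreg _ S2). ring. }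
    apply (K t tau tau); [lra|lra| | |].
    + intros s Hs. pose proof (LB' 1%R A1 t s tau Hs Htau) as Q. now rewrite Rmult_1_l in Q.
    + intros s Hs. pose proof (LB' (- (1))%R A2 t s tau Hs Htau) as Q.
      now replace (- (1) * tau)%R with (- tau)%R in Q by ring.
    + unfold normal_pt. rewrite RtoC_opp.
      replace (gam t + Ci * RtoC tau * dg t - (gam t + Ci * - RtoC tau * dg t)) with
        (RtoC 2 * Ci * RtoC tau * dg t).
      2:{ replace (RtoC 2) with (1 + 1) by (rewrite <- RtoC_plus; f_equal; ring). ring. }
      rewrite !Cmod_mult, Cmod_Ci, !Cmod_R, !Rabs_pos_eq by lra.
      pose proof (proj2 (HmL t)). nra.
Qed.

End Plemelj.

(** * Integrals over rectangles, and removability of thin sets *)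

Definition ctsC (f : C -> C) : Prop := forall z (eps : R), 0 < eps -> exists d : R, 0 < d /\
  forall w, Cmod (w - z) < d -> Cmod (f w - f z) < eps.

Lemma cts_horizontal (f : C -> C) (y : R) :
  (forall x (eps : R), 0 < eps -> exists d : R, 0 < d /\
    forall w, Cmod (w - (x, y)) < d -> Cmod (f w - f (x, y)) < eps) ->
  cts (fun x => f (x, y)).
Proof.
  intros H x. apply cpt_iff. intros eps He. destruct (H x eps He) as [d [Hd K]].
  exists d. split; auto. intros s Hs. apply K.
  eapply Rle_lt_trans; [apply Cmod_le_Re_Im|]. simpl.
  replace (y + - y)%R with 0%R by ring. rewrite Rabs_R0, Rplus_0_r. exact Hs.
Qed.

Lemma cts_vertical (f : C -> C) (x : R) :
  (forall y (eps : R), 0 < eps -> exists d : R, 0 < d /\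
    forall w, Cmod (w - (x, y)) < d -> Cmod (f w - f (x, y)) < eps) ->
  cts (fun y => f (x, y)).
Proof.
  intros H y. apply cpt_iff. intros eps He. destruct (H y eps He) as [d [Hd K]].
  exists d. split; auto. intros s Hs. apply K.
  eapply Rle_lt_trans; [apply Cmod_le_Re_Im|]. simpl.
  replace (x + - x)%R with 0%R by ring. rewrite Rabs_R0, Rplus_0_l. exact Hs.
Qed.

(** The integral of f dz along the boundary, counterclockwise: bottom minus top, plus i times right
    minus left. *)
Definition rect (f : C -> C) (x1 x2 y1 y2 : R) : C :=
  CInt (fun x => f (x, y1)) x1 x2 - CInt (fun x => f (x, y2)) x1 x2
  + Ci * (CInt (fun y => f (x2, y)) y1 y2 - CInt (fun y => f (x1, y)) y1 y2).

Definition square_int (f : C -> C) (x y l : R) : C := rect f x (x + l) y (y + l).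

Lemma rect_split_h (f : C -> C) (x1 x2 x3 y1 y2 : R) : ctsC f ->
  rect f x1 x3 y1 y2 = rect f x1 x2 y1 y2 + rect f x2 x3 y1 y2.
Proof.
  intros Hf. unfold rect.
  rewrite <- (CInt_Chasles (fun x => f (x, y1)) x1 x2 x3),
    <- (CInt_Chasles (fun x => f (x, y2)) x1 x2 x3) by (apply cts_horizontal; intros; apply Hf; auto).
  ring.
Qed.

Lemma rect_split_v (f : C -> C) (x1 x2 y1 y2 y3 : R) : ctsC f ->
  rect f x1 x2 y1 y3 = rect f x1 x2 y1 y2 + rect f x1 x2 y2 y3.
Proof.
  intros Hf. unfold rect.
  rewrite <- (CInt_Chasles (fun y => f (x1, y)) y1 y2 y3),
    <- (CInt_Chasles (fun y => f (x2, y)) y1 y2 y3) by (apply cts_vertical; intros; apply Hf; auto).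
  ring.
Qed.

Lemma CInt_const (c : C) (a b : R) : CInt (fun _ => c) a b = RtoC (b - a) * c.
Proof.
  apply CInt_unique. rewrite <- scal_R_Cmult. apply (is_RInt_const (V := C_R_NormedModule)).
Qed.

Lemma is_RInt_id (a b : R) : is_RInt (fun x : R => x) a b ((b ^ 2 - a ^ 2) / 2)%R.
Proof.
  replace ((b ^ 2 - a ^ 2) / 2)%R with (minus (b ^ 2 / 2) (a ^ 2 / 2))%R.
  - apply (is_RInt_derive (V := R_CompleteNormedModule) (fun x => x ^ 2 / 2)%R (fun x => x)).
    + intros x _. auto_derive; auto; field.
    + intros x _. apply continuous_id.
  - unfold minus, plus, opp; simpl. field.
Qed.

Lemma is_RInt_cst (c a b : R) : is_RInt (fun _ : R => c) a b ((b - a) * c)%R.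
Proof. apply (is_RInt_const (V := R_NormedModule)). Qed.

Lemma CInt_id_h (a b y : R) : CInt (fun x => (x, y)) a b = (((b ^ 2 - a ^ 2) / 2)%R, ((b - a) * y)%R).
Proof.
  apply CInt_unique. apply (is_RInt_fct_extend_pair (U := R_NormedModule) (V := R_NormedModule)); simpl.
  - apply is_RInt_id.
  - apply is_RInt_cst.
Qed.

Lemma CInt_id_v (a b x : R) : CInt (fun y => (x, y)) a b = (((b - a) * x)%R, ((b ^ 2 - a ^ 2) / 2)%R).
Proof.
  apply CInt_unique. apply (is_RInt_fct_extend_pair (U := R_NormedModule) (V := R_NormedModule)); simpl.
  - apply is_RInt_cst.
  - apply is_RInt_id.
Qed.

Lemma cts_id_h (y : R) : cts (fun x => ((x, y) : C)).
Proof. intros t. apply cpt_components; simpl; [apply continuous_id|apply continuous_const]. Qed.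

Lemma cts_id_v (x : R) : cts (fun y => ((x, y) : C)).
Proof. intros t. apply cpt_components; simpl; [apply continuous_const|apply continuous_id]. Qed.

Lemma rect_minus (f g : C -> C) (x1 x2 y1 y2 : R) :
  cts (fun x => f (x, y1)) -> cts (fun x => f (x, y2)) -> cts (fun y => f (x1, y)) -> cts (fun y => f (x2, y)) ->
  cts (fun x => g (x, y1)) -> cts (fun x => g (x, y2)) -> cts (fun y => g (x1, y)) -> cts (fun y => g (x2, y)) ->
  rect (fun z => f z - g z) x1 x2 y1 y2 = rect f x1 x2 y1 y2 - rect g x1 x2 y1 y2.
Proof.
  intros. unfold rect.
  rewrite (CInt_minus (fun x => f (x, y1)) (fun x => g (x, y1))),
    (CInt_minus (fun x => f (x, y2)) (fun x => g (x, y2))),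
    (CInt_minus (fun y => f (x1, y)) (fun y => g (x1, y))),
    (CInt_minus (fun y => f (x2, y)) (fun y => g (x2, y))) by auto.
  ring.
Qed.

Lemma rect_mult (c : C) (f : C -> C) (x1 x2 y1 y2 : R) :
  cts (fun x => f (x, y1)) -> cts (fun x => f (x, y2)) -> cts (fun y => f (x1, y)) -> cts (fun y => f (x2, y)) ->
  rect (fun z => c * f z) x1 x2 y1 y2 = c * rect f x1 x2 y1 y2.
Proof.
  intros. unfold rect.
  rewrite (CInt_mult c (fun x => f (x, y1))), (CInt_mult c (fun x => f (x, y2))),
    (CInt_mult c (fun y => f (x1, y))), (CInt_mult c (fun y => f (x2, y))) by auto.
  ring.
Qed.

Lemma rect_bound (f : C -> C) (x1 x2 y1 y2 M : R) : x1 <= x2 -> y1 <= y2 ->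
  cts (fun x => f (x, y1)) -> cts (fun x => f (x, y2)) -> cts (fun y => f (x1, y)) -> cts (fun y => f (x2, y)) ->
  (forall x, x1 <= x <= x2 -> Cmod (f (x, y1)) <= M /\ Cmod (f (x, y2)) <= M) ->
  (forall y, y1 <= y <= y2 -> Cmod (f (x1, y)) <= M /\ Cmod (f (x2, y)) <= M) ->
  Cmod (rect f x1 x2 y1 y2) <= 2 * (x2 - x1) * M + 2 * (y2 - y1) * M.
Proof.
  intros Hx Hy c1 c2 c3 c4 Hh Hv. unfold rect.
  pose proof (Cmod_CInt_le_const _ M x1 x2 Hx c1 (fun x H => proj1 (Hh x H))) as B1.
  pose proof (Cmod_CInt_le_const _ M x1 x2 Hx c2 (fun x H => proj2 (Hh x H))) as B2.
  pose proof (Cmod_CInt_le_const _ M y1 y2 Hy c3 (fun y H => proj1 (Hv y H))) as B3.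
  pose proof (Cmod_CInt_le_const _ M y1 y2 Hy c4 (fun y H => proj2 (Hv y H))) as B4.
  eapply Rle_trans; [apply Cmod_triangle|]. rewrite Cmod_mult, Cmod_Ci, Rmult_1_l.
  pose proof (Cmod_sub_le (CInt (fun x => f (x, y1)) x1 x2) (CInt (fun x => f (x, y2)) x1 x2)).
  pose proof (Cmod_sub_le (CInt (fun y => f (x2, y)) y1 y2) (CInt (fun y => f (x1, y)) y1 y2)).
  lra.
Qed.

Definition in_square (x y l : R) (w : C) : Prop := x <= fst w <= x + l /\ y <= snd w <= y + l.

(** Affine functions integrate to zero around a square, so only the deviation counts, times the
    perimeter 4 l. It is used with the tangent map for differentiable f and with a constant for
    merely continuous f. *)
Lemma square_int_affine_bound (f : C -> C) (A B : C) (x y l M : R) : ctsC f -> 0 <= l ->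
  (forall w, in_square x y l w -> Cmod (f w - (A + B * w)) <= M) ->
  Cmod (square_int f x y l) <= 4 * l * M.
Proof.
  intros Hf Hl HM. unfold square_int.
  set (g := fun w => A + B * w).
  assert (cgh : forall v, cts (fun u => g (u, v))).
  { intros v. apply (cts_plus (fun _ => A) (fun u => B * (u, v))); [apply cts_const|].
    apply (cts_mult (fun _ => B) (fun u => (u, v))); [apply cts_const|apply cts_id_h]. }
  assert (cgv : forall u, cts (fun v => g (u, v))).
  { intros u. apply (cts_plus (fun _ => A) (fun v => B * (u, v))); [apply cts_const|].
    apply (cts_mult (fun _ => B) (fun v => (u, v))); [apply cts_const|apply cts_id_v]. }
  assert (cfh : forall v, cts (fun u => f (u, v))) by (intros; apply cts_horizontal; intros; apply Hf; auto).
  assert (cfv : forall u, cts (fun v => f (u, v))) by (intros; apply cts_vertical; intros; apply Hf; auto).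
  assert (g0 : rect g x (x + l) y (y + l) = 0).
  { unfold rect, g.
    assert (Eh : forall v a b, CInt (fun u => A + B * (u, v)) a b = RtoC (b - a) * A + B * (((b ^ 2 - a ^ 2) / 2)%R, ((b - a) * v)%R)).
    { intros v a b. rewrite <- CInt_id_h, <- CInt_const, <- CInt_mult by apply cts_id_h.
      apply (CInt_plus (fun _ => A) (fun u => B * (u, v))); [apply cts_const|].
      apply (cts_mult (fun _ => B) (fun u => (u, v))); [apply cts_const|apply cts_id_h]. }
    assert (Ev : forall u a b, CInt (fun v => A + B * (u, v)) a b = RtoC (b - a) * A + B * (((b - a) * u)%R, ((b ^ 2 - a ^ 2) / 2)%R)).
    { intros u a b. rewrite <- CInt_id_v, <- CInt_const, <- CInt_mult by apply cts_id_v.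
      apply (CInt_plus (fun _ => A) (fun v => B * (u, v))); [apply cts_const|].
      apply (cts_mult (fun _ => B) (fun v => (u, v))); [apply cts_const|apply cts_id_v]. }
    rewrite !Eh, !Ev. destruct A as [a1 a2], B as [b1 b2].
    unfold Ci, RtoC, Cminus, Cplus, Copp, Cmult; simpl. f_equal; field. }
  replace (rect f x (x + l) y (y + l)) with (rect (fun w => f w - g w) x (x + l) y (y + l)).
  2:{ rewrite rect_minus, g0 by auto. ring. }
  replace (4 * l * M)%R with (2 * (x + l - x) * M + 2 * (y + l - y) * M)%R by ring.
  apply (rect_bound (fun w => f w - g w)); [lra|lra| | | | | |].
  - exact (cts_minus _ _ (cfh y) (cgh y)).
  - exact (cts_minus _ _ (cfh (y + l)%R) (cgh (y + l)%R)).
  - exact (cts_minus _ _ (cfv x) (cgv x)).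
  - exact (cts_minus _ _ (cfv (x + l)%R) (cgv (x + l)%R)).
  - intros u Hu. split; apply HM; unfold in_square; simpl; lra.
  - intros u Hu. split; apply HM; unfold in_square; simpl; lra.
Qed.

(** * Subdivision of squares and Goursat's theorem *)

Lemma grid_bound_h (f : C -> C) (x y1 y2 h : R) (N : nat) : ctsC f ->
  Cmod (rect f x (x + INR (S N) * h) y1 y2) <=
  sum_f_R0 (fun i => Cmod (rect f (x + INR i * h) (x + INR i * h + h) y1 y2)) N.
Proof.
  intros Hf. induction N as [|N IH].
  - simpl. replace (x + 0 * h)%R with x by ring. replace (x + 1 * h)%R with (x + h)%R by ring. lra.
  - rewrite (rect_split_h f x (x + INR (S N) * h)) by auto.
    eapply Rle_trans; [apply Cmod_triangle|].
    change (sum_f_R0 ?a (S N)) with (sum_f_R0 a N + a (S N))%R.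
    apply Rplus_le_compat; [exact IH|]. right. f_equal. f_equal.
    rewrite (S_INR (S N)). ring.
Qed.

Lemma grid_bound_v (f : C -> C) (y x1 x2 h : R) (N : nat) : ctsC f ->
  Cmod (rect f x1 x2 y (y + INR (S N) * h)) <=
  sum_f_R0 (fun i => Cmod (rect f x1 x2 (y + INR i * h) (y + INR i * h + h))) N.
Proof.
  intros Hf. induction N as [|N IH].
  - simpl. replace (y + 0 * h)%R with y by ring. replace (y + 1 * h)%R with (y + h)%R by ring. lra.
  - rewrite (rect_split_v f x1 x2 y (y + INR (S N) * h)) by auto.
    eapply Rle_trans; [apply Cmod_triangle|].
    change (sum_f_R0 ?a (S N)) with (sum_f_R0 a N + a (S N))%R.
    apply Rplus_le_compat; [exact IH|]. right. f_equal. f_equal.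
    rewrite (S_INR (S N)). ring.
Qed.

Lemma square_grid_bound (f : C -> C) (x y h : R) (N : nat) (a : nat -> nat -> R) : ctsC f ->
  (forall i j, (i <= N)%nat -> (j <= N)%nat ->
     Cmod (square_int f (x + INR i * h) (y + INR j * h) h) <= a i j) ->
  Cmod (square_int f x y (INR (S N) * h)) <= sum_f_R0 (fun i => sum_f_R0 (fun j => a i j) N) N.
Proof.
  intros Hf Ha. unfold square_int. eapply Rle_trans; [apply grid_bound_h; auto|].
  apply sum_Rle. intros i Hi. eapply Rle_trans; [apply grid_bound_v; auto|].
  apply sum_Rle. intros j Hj. now apply Ha.
Qed.

(** The threshold is proportional to the area, so if all four quarters respected it, their sum would
    too. *)
Lemma square_bisect (f : C -> C) (eps x y l : R) : ctsC f ->
  eps * l ^ 2 < Cmod (square_int f x y l) ->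
  exists x' y', (x' = x \/ x' = x + l / 2)%R /\ (y' = y \/ y' = y + l / 2)%R /\
    eps * (l / 2) ^ 2 < Cmod (square_int f x' y' (l / 2)).
Proof.
  intros Hf H. apply NNPP. intros N.
  assert (B : forall x' y', (x' = x \/ x' = x + l / 2)%R -> (y' = y \/ y' = y + l / 2)%R ->
    Cmod (square_int f x' y' (l / 2)) <= eps * (l / 2) ^ 2).
  { intros x' y' Hx Hy. apply Rnot_lt_le. intros L. apply N. now exists x', y'. }
  pose proof (square_grid_bound f x y (l / 2) 1 (fun _ _ => eps * (l / 2) ^ 2)%R Hf) as G.
  replace (INR 2 * (l / 2))%R with l in G by (simpl; field).
  assert (C : forall i (c : R), (i <= 1)%nat -> (c + INR i * (l / 2) = c \/ c + INR i * (l / 2) = c + l / 2)%R).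
  { intros i c Hi. destruct i as [|[|i]]; [left|right|lia]; simpl; ring. }
  specialize (G ltac:(intros i j Hi Hj; apply B; apply C; auto)).
  simpl in G. lra.
Qed.

(** Bisection yields nested squares whose integrals exceed eps times their areas; at their common
    point the derivative makes the integral smaller than that. *)
Lemma goursat (f : C -> C) (x y l : R) : ctsC f -> 0 < l ->
  (forall w, in_square x y l w -> exists D, is_derive_CC f w D) -> square_int f x y l = 0.
Proof.
  intros Hf Hl HD. apply NNPP. intros NZ.
  assert (NZ' : 0 < Cmod (square_int f x y l)) by now apply Cmod_gt_0.
  assert (l2 : 0 < l ^ 2) by nra.
  (* Half the ratio of integral to area, so that the initial square strictly exceeds the
     threshold. *)
  set (eps := (Cmod (square_int f x y l) / (2 * l ^ 2))%R).
  assert (He : 0 < eps) by (apply Rdiv_lt_0_compat; lra).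
  assert (H0 : eps * l ^ 2 < Cmod (square_int f x y l)).
  { replace (eps * l ^ 2)%R with (Cmod (square_int f x y l) / 2)%R by (unfold eps; field; lra). lra. }
  set (side := fun n : nat => (l / 2 ^ n)%R).
  assert (Sp : forall n, 0 < side n) by (intros n; apply Rdiv_lt_0_compat; [lra|apply pow_lt; lra]).
  assert (S2 : forall n, side (S n) = (side n / 2)%R).
  { intros n. unfold side. simpl. field. apply pow_nonzero. lra. }
  set (Bad := fun n (p : R * R) => eps * side n ^ 2 < Cmod (square_int f (fst p) (snd p) (side n))).
  set (Next := fun n (p q : R * R) => Bad (S n) q /\
     (fst q = fst p \/ fst q = fst p + side n / 2)%R /\ (snd q = snd p \/ snd q = snd p + side n / 2)%R).
  assert (Step : forall n p, Bad n p -> exists q, Next n p q).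
  { intros n p Hp. destruct (square_bisect f eps (fst p) (snd p) (side n) Hf Hp) as (x' & y' & Hx & Hy & K).
    exists (x', y'). split; [|split]; simpl; auto. unfold Bad. rewrite S2. exact K. }
  (* Only the positions of the squares are chosen recursively; that the choices succeed is proved
     afterwards, by induction in [SB]. *)
  set (sq := fix sq n : R * R := match n with O => (x, y) | S n =>
      epsilon (inhabits (0%R, 0%R)) (fun q => Next n (sq n) q) end).
  assert (SB : forall n, Bad n (sq n)).
  { induction n as [|n IH].
    - unfold Bad, side. simpl. replace (l / 1)%R with l by field. exact H0.
    - pose proof (epsilon_spec (inhabits (0%R, 0%R)) (fun q => Next n (sq n) q) (Step n _ IH)) as Q.
      apply Q. }
  assert (SN : forall n, Next n (sq n) (sq (S n))).
  { intros n. apply (epsilon_spec (inhabits (0%R, 0%R)) (fun q => Next n (sq n) q) (Step n _ (SB n))). }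
  assert (Nested : forall u : nat -> R, (forall n, u (S n) = u n \/ u (S n) = u n + side n / 2)%R ->
    exists X, forall n, u n <= X <= u n + side n).
  { intros u Hu.
    assert (Mono : forall n k, u n <= u (n + k)%nat /\ u (n + k)%nat + side (n + k)%nat <= u n + side n).
    { intros n. induction k as [|k IH].
      - rewrite Nat.add_0_r. lra.
      - rewrite Nat.add_succ_r. pose proof (S2 (n + k)%nat). pose proof (Sp (n + k)%nat).
        destruct (Hu (n + k)%nat) as [E|E]; rewrite E; lra. }
    assert (Up : forall n k, u k <= u n + side n).
    { intros n k. destruct (Nat.le_ge_cases n k) as [Hk|Hk].
      - destruct (Mono n (k - n)%nat) as [_ Q]. replace (n + (k - n))%nat with k in Q by lia.
        pose proof (Sp k). lra.
      - destruct (Mono k (n - k)%nat) as [Q _]. replace (k + (n - k))%nat with n in Q by lia.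
        pose proof (Sp n). lra. }
    destruct (completeness (fun r => exists n, r = u n)) as [X [X1 X2]].
    - exists (u 0%nat + side 0%nat)%R. intros r [n ->]. apply Up.
    - exists (u 0%nat). now exists 0%nat.
    - exists X. intros n. split; [apply X1; now exists n|]. apply X2. intros r [k ->]. apply Up. }
  destruct (Nested (fun n => fst (sq n))) as [X HX]; [intros n; apply SN|].
  destruct (Nested (fun n => snd (sq n))) as [Y HY]; [intros n; apply SN|].
  destruct (HD (X, Y)) as [D Der].
  { pose proof (HX 0%nat) as A. pose proof (HY 0%nat) as B. unfold side in A, B. simpl in A, B.
    replace (l / 1)%R with l in A, B by field. split; simpl; lra. }
  (* A point of the n-th square is within 2 side n of (X, Y), so the deviation is at most (eps / 8)
     (2 side n); times the perimeter 4 side n this is eps (side n)^2. *)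
  destruct (proj1 (is_derive_CC_iff _ _ _) Der (eps / 8)%R ltac:(lra)) as [d [Hd K]].
  assert (exists n, side n < d / 2) as [n Hn].
  { destruct (pow_lt_1_zero (/ 2)%R ltac:(rewrite Rabs_pos_eq; lra) (d / 2 / l)%R) as [n Hn].
    { apply Rdiv_lt_0_compat; lra. }
    exists n. specialize (Hn n (Nat.le_refl n)).
    rewrite Rabs_pos_eq in Hn by (apply pow_le; lra). rewrite pow_inv in Hn.
    unfold side. unfold Rdiv. replace (d * / 2)%R with (l * (d / 2 / l))%R by (field; lra).
    apply Rmult_lt_compat_l; auto. }
  specialize (SB n). unfold Bad in SB. apply (Rlt_not_le _ _ SB).
  replace (eps * side n ^ 2)%R with (4 * side n * (eps / 8 * (2 * side n)))%R by field.
  specialize (HX n). specialize (HY n). simpl in HX, HY.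
  apply (square_int_affine_bound f (f (X, Y) - (X, Y) * D) D); auto; [left; apply Sp|].
  intros w [W1 W2].
  assert (Wd : Cmod (w - (X, Y)) <= 2 * side n).
  { eapply Rle_trans; [apply Cmod_le_Re_Im|].
    change (Rabs (fst w - X) + Rabs (snd w - Y) <= 2 * side n).
    assert (Rabs (fst w - X) <= side n) by (apply Rabs_le; lra).
    assert (Rabs (snd w - Y) <= side n) by (apply Rabs_le; lra). lra. }
  replace (f w - (f (X, Y) - (X, Y) * D + D * w)) with (f w - f (X, Y) - (w - (X, Y)) * D) by ring.
  eapply Rle_trans; [apply K; lra|]. apply Rmult_le_compat_l; lra.
Qed.

(** At every scale 1/(N + 1) the set is covered by N + m + 1 disks of comparable radius, as for a
    set of finite length. The offset m leaves room for adding finitely many points. *)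
Definition thin (S : C -> Prop) : Prop := exists (rho : R) (m : nat), 0 <= rho /\
  forall N : nat, exists p : nat -> C, forall s, S s ->
    exists k, (k <= N + m)%nat /\ Cmod (s - p k) <= rho / INR (Datatypes.S N).

Definition chi (a q r : R) : R := if Rle_dec (Rabs (a - q)) r then 1 else 0.

Lemma chi_count (x h q r : R) (N : nat) : 0 < h -> 0 <= r ->
  0 <= sum_f_R0 (fun i => chi (x + INR i * h) q r) N <= 2 * r / h + 1.
Proof.
  intros Hh Hr. split.
  { apply cond_pos_sum. intros n. unfold chi. destruct (Rle_dec _ _); lra. }
  set (lo := ((q - r - x) / h)%R). set (hi := ((q + r - x) / h)%R).
  assert (E : forall i, chi (x + INR i * h) q r <= 1 /\ (0 < chi (x + INR i * h) q r -> lo <= INR i <= hi)).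
  { intros i. unfold chi. destruct (Rle_dec _ _) as [P|P]; [|lra]. split; [lra|intros _].
    apply Rabs_le_between in P. unfold lo, hi. split.
    - apply Rle_div_l; lra.
    - apply Rle_div_r; lra. }
  (* The indices counted so far are integers between lo and min (hi, n), whence at most min (hi, n)
     - lo + 1 of them; the maximum with 0 covers the case where none has occurred. *)
  assert (I : forall n, sum_f_R0 (fun i => chi (x + INR i * h) q r) n <= Rmax 0 (Rmin hi (INR n) - lo + 1)).
  { assert (Up : forall n, 0 < chi (x + INR n * h) q r -> (Rmin hi (INR n) = INR n)%R).
    { intros n P. destruct (E n) as [_ Q]. apply Rmin_right. apply Q, P. }
    induction n as [|n IH].
    - change (sum_f_R0 (fun i => chi (x + INR i * h) q r) 0) with (chi (x + INR 0 * h) q r). destruct (Rle_dec (chi (x + INR 0 * h) q r) 0) as [P|P].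
      + eapply Rle_trans; [exact P|apply Rmax_l].
      + rewrite Up by lra. destruct (E 0%nat) as [E1 E2]. specialize (E2 ltac:(lra)).
        eapply Rle_trans; [|apply Rmax_r]. lra.
    - change (sum_f_R0 (fun i => chi (x + INR i * h) q r) (S n)) with
        (sum_f_R0 (fun i => chi (x + INR i * h) q r) n + chi (x + INR (S n) * h) q r)%R.
      destruct (Rle_dec (chi (x + INR (S n) * h) q r) 0) as [P|P].
      + assert (Rmin hi (INR n) <= Rmin hi (INR (S n))).
        { apply Rle_min_compat_l. rewrite S_INR. lra. }
        assert (Rmax 0 (Rmin hi (INR n) - lo + 1) <= Rmax 0 (Rmin hi (INR (S n)) - lo + 1)).
        { apply Rle_max_compat_l. lra. }
        lra.
      + rewrite Up by lra. destruct (E (S n)) as [E1 E2]. specialize (E2 ltac:(lra)).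
        rewrite S_INR in *.
        assert (Rmax 0 (Rmin hi (INR n) - lo + 1) <= INR n + 1 - lo).
        { apply Rmax_lub; [lra|]. pose proof (Rmin_r hi (INR n)). lra. }
        eapply Rle_trans; [|apply Rmax_r]. lra. }
  eapply Rle_trans; [apply I|].
  assert (hi - lo + 1 = 2 * r / h + 1)%R by (unfold hi, lo; field; lra).
  assert (0 <= 2 * r / h) by (apply Rle_div_r; lra).
  apply Rmax_lub; [lra|]. pose proof (Rmin_l hi (INR N)). lra.
Qed.

Lemma sum_f_R0_swap (u : nat -> nat -> R) (m n : nat) :
  sum_f_R0 (fun i => sum_f_R0 (fun j => u i j) n) m = sum_f_R0 (fun j => sum_f_R0 (fun i => u i j) m) n.
Proof.
  induction m as [|m IH]; [reflexivity|].
  simpl. rewrite IH. rewrite <- plus_sum. reflexivity.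
Qed.

(** Summing over cells first, each centre is near at most (2 r / h + 1)^2 grid corners, whatever the
    number of cells. *)
Lemma chi_double_count (x y h r e : R) (N M : nat) (p : nat -> C) : 0 < h -> 0 <= r -> 0 <= e ->
  sum_f_R0 (fun i => sum_f_R0 (fun j => sum_f_R0 (fun k =>
    e * (chi (x + INR i * h) (fst (p k)) r * chi (y + INR j * h) (snd (p k)) r))%R M) N) N
  <= INR (S M) * (e * (2 * r / h + 1) ^ 2).
Proof.
  intros Hh Hr He.
  rewrite (sum_eq _ (fun i => sum_f_R0 (fun k => sum_f_R0 (fun j =>
    e * (chi (x + INR i * h) (fst (p k)) r * chi (y + INR j * h) (snd (p k)) r))%R N) M)).
  2:{ intros i _. apply (sum_f_R0_swap (fun j k => _)%R). }
  rewrite (sum_f_R0_swap (fun i k => _)%R).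
  rewrite Rmult_comm. rewrite <- sum_cte. apply sum_Rle. intros k _.
  set (Sx := sum_f_R0 (fun i => chi (x + INR i * h) (fst (p k)) r) N).
  set (Sy := sum_f_R0 (fun j => chi (y + INR j * h) (snd (p k)) r) N).
  replace (sum_f_R0 (fun i => sum_f_R0 (fun j => e * (chi (x + INR i * h) (fst (p k)) r * chi (y + INR j * h) (snd (p k)) r))%R N) N)
    with (e * Sy * Sx)%R.
  2:{ unfold Sx. rewrite scal_sum. apply sum_eq. intros i _.
      replace (chi (x + INR i * h) (fst (p k)) r * (e * Sy))%R with ((e * chi (x + INR i * h) (fst (p k)) r) * Sy)%R by ring.
      unfold Sy. rewrite scal_sum. apply sum_eq. intros j _. ring. }
  destruct (chi_count x h (fst (p k)) r N Hh Hr) as [X1 X2]. fold Sx in X1, X2.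
  destruct (chi_count y h (snd (p k)) r N Hh Hr) as [Y1 Y2]. fold Sy in Y1, Y2.
  replace (e * Sy * Sx)%R with (e * (Sy * Sx))%R by ring.
  apply Rmult_le_compat_l; auto. simpl. rewrite Rmult_1_r. apply Rmult_le_compat; auto.
Qed.

Lemma ctsC_unif_square (f : C -> C) (x y l omega : R) : ctsC f -> 0 < omega ->
  exists d, 0 < d /\ forall w w', in_square x y l w -> in_square x y l w' ->
    Rabs (fst w - fst w') < d -> Rabs (snd w - snd w') < d -> Cmod (f w - f w') <= omega.
Proof.
  intros Hf Ho. assert (Ho2 : 0 < omega / 2) by lra.
  assert (C : forall (pr : C -> R), (forall w w', Rabs (pr w - pr w') <= Cmod (w - w')) ->
     forall u v, continuity_2d_pt (fun u v => pr (f (u, v))) u v).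
  { intros pr Hpr u v eps. destruct (Hf (u, v) eps (cond_pos eps)) as [d [Hd K]].
    assert (Hd2 : 0 < d / 2) by lra. exists (mkposreal _ Hd2). simpl. intros u' v' Hu Hv.
    eapply Rle_lt_trans; [apply Hpr|]. apply K.
    eapply Rle_lt_trans; [apply Cmod_le_Re_Im|].
    change (Rabs (u' - u) + Rabs (v' - v) < d). lra. }
  destruct (uniform_continuity_2d (fun u v => fst (f (u, v))) x (x + l) y (y + l)) with (eps := mkposreal _ Ho2) as [d1 K1].
  { intros u v _ _. apply (C fst). intros w w'. apply (Re_le_Cmod (w - w')). }
  destruct (uniform_continuity_2d (fun u v => snd (f (u, v))) x (x + l) y (y + l)) with (eps := mkposreal _ Ho2) as [d2 K2].
  { intros u v _ _. apply (C snd). intros w w'. apply (Im_le_Cmod (w - w')). }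
  exists (Rmin d1 d2). split; [apply Rmin_pos; apply cond_pos|].
  intros [u v] [u' v'] [A1 A2] [B1 B2] H1 H2. simpl in *.
  eapply Rle_trans; [apply Cmod_le_Re_Im|].
  pose proof (Rmin_l d1 d2). pose proof (Rmin_r d1 d2).
  specialize (K1 u' v' u v B1 B2 A1 A2 ltac:(lra) ltac:(lra)).
  specialize (K2 u' v' u v B1 B2 A1 A2 ltac:(lra) ltac:(lra)).
  change (Rabs (fst (f (u, v)) - fst (f (u', v'))) + Rabs (snd (f (u, v)) - snd (f (u', v'))) <= omega). lra.
Qed.

(* On an [n] by [n] grid only [O(n)] cells meet the thin set, each contributing [o(1/n)];
   the others contribute nothing. *)
Lemma thin_removable (f : C -> C) (S : C -> Prop) (x y l : R) : ctsC f -> thin S -> 0 < l ->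
  (forall w, ~ S w -> exists D, is_derive_CC f w D) -> square_int f x y l = 0.
Proof.
  intros Hf (rho & m & Hrho & HS) Hl HD.
  set (Q := (2 * (l + rho) / l + 1)%R).
  assert (HQ : 0 <= 2 * (l + rho) / l) by (apply Rle_div_r; lra).
  (* The total charge is at most (N + m + 1) Q^2 times 4 h omega. Since N + m + 1 <= (m + 1) (N + 1)
     and h (N + 1) = l, this is at most K omega for every N. *)
  set (K := (4 * l * (INR m + 1) * Q ^ 2)%R).
  assert (HK : 0 < K).
  { pose proof (pos_INR m). unfold K. assert (0 < Q ^ 2) by (unfold Q; nra).
    apply Rmult_lt_0_compat; [|auto]. apply Rmult_lt_0_compat; lra. }
  apply eq_of_Cmod_le_all. intros eps He. replace (square_int f x y l - 0) with (square_int f x y l) by ring.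
  set (omega := (eps / K)%R). assert (Ho : 0 < omega) by (apply Rdiv_lt_0_compat; lra).
  destruct (ctsC_unif_square f x y l omega Hf Ho) as [d [Hd Unif]].
  destruct (archimed_cor1 (d / l)) as [n [Hn1 Hn2]]; [apply Rdiv_lt_0_compat; lra|].
  destruct n as [|N]; [lia|].
  assert (HN : 0 < INR (Datatypes.S N)) by (apply lt_0_INR; lia).
  set (h := (l / INR (Datatypes.S N))%R).
  assert (Hh : 0 < h) by (apply Rdiv_lt_0_compat; lra).
  assert (hd : h < d).
  { unfold h, Rdiv. replace d with (l * (d / l))%R by (field; lra). apply Rmult_lt_compat_l; auto. }
  assert (hl : (INR (Datatypes.S N) * h = l)%R) by (unfold h; field; lra).
  destruct (HS N) as [p Hp].
  (* Equals h plus the covering radius: the lower left corner of a cell meeting S is, in each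
     coordinate, within r of some centre. *)
  set (r := ((l + rho) / INR (Datatypes.S N))%R).
  assert (Hr : 0 <= r) by (apply Rle_div_r; lra).
  set (e := (4 * h * omega)%R).
  assert (He0 : 0 < e) by (unfold e; apply Rmult_lt_0_compat; lra).
  rewrite <- hl.
  (* A cell is charged e for every centre near its corner: at least once if it meets S, and possibly
     without need otherwise. *)
  eapply Rle_trans; [apply (square_grid_bound f x y h N (fun i j => sum_f_R0 (fun k =>
    e * (chi (x + INR i * h) (fst (p k)) r * chi (y + INR j * h) (snd (p k)) r))%R (N + m))); auto|].
  - intros i j Hi Hj. set (x' := (x + INR i * h)%R). set (y' := (y + INR j * h)%R).
    assert (TP : forall k, 0 <= e * (chi x' (fst (p k)) r * chi y' (snd (p k)) r)).
    { intros k. unfold chi. destruct (Rle_dec (Rabs (x' - fst (p k))) r), (Rle_dec (Rabs (y' - snd (p k))) r); lra. }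
    destruct (classic (exists s, S s /\ in_square x' y' h s)) as [[s [Ss Is]]|No].
    + destruct (Hp s Ss) as [k [Hk Dk]].
      assert (rr : (r = h + rho / INR (Datatypes.S N))%R) by (unfold r, h; field; lra).
      assert (C1 : chi x' (fst (p k)) r = 1%R).
      { unfold chi. destruct (Rle_dec _ _) as [P|P]; auto. exfalso. apply P.
        pose proof (Re_le_Cmod (s - p k)) as Z. simpl in Z. destruct Is as [I1 _].
        replace (x' - fst (p k))%R with ((x' - fst s) + (fst s + - fst (p k)))%R by ring.
        eapply Rle_trans; [apply Rabs_triang|].
        assert (Rabs (x' - fst s) <= h) by (apply Rabs_le; lra). lra. }
      assert (C2 : chi y' (snd (p k)) r = 1%R).
      { unfold chi. destruct (Rle_dec _ _) as [P|P]; auto. exfalso. apply P.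
        pose proof (Im_le_Cmod (s - p k)) as Z. simpl in Z. destruct Is as [_ I2].
        replace (y' - snd (p k))%R with ((y' - snd s) + (snd s + - snd (p k)))%R by ring.
        eapply Rle_trans; [apply Rabs_triang|].
        assert (Rabs (y' - snd s) <= h) by (apply Rabs_le; lra). lra. }
      apply Rle_trans with e.
      * unfold e. apply (square_int_affine_bound f (f (x', y')) 0); [auto|lra|].
        intros w [W1 W2]. replace (f w - (f (x', y') + 0 * w)) with (f w - f (x', y')) by ring.
        assert (Bi : forall (c : R) (i : nat), (i <= N)%nat -> c <= c + INR i * h /\ c + INR i * h + h <= c + l).
        { intros c i' Hi'. pose proof (pos_INR i'). assert (INR i' + 1 <= INR (Datatypes.S N)).
          { rewrite <- S_INR. apply le_INR. lia. }
          split; [nra|]. rewrite <- hl. nra. }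
        destruct (Bi x i Hi) as [X1 X2]. destruct (Bi y j Hj) as [Y1 Y2]. fold x' in X1, X2. fold y' in Y1, Y2.
        apply Unif; try (split; simpl; lra); apply Rabs_lt_between; simpl; lra.
      * apply Rle_trans with (e * (chi x' (fst (p k)) r * chi y' (snd (p k)) r))%R.
        { rewrite C1, C2. lra. }
        (* A single term is at most the whole sum of nonnegative terms. *)
        clear - Hk TP. revert Hk. induction (N + m)%nat as [|n IH]; intros Hk.
        { replace k with 0%nat by lia. simpl. lra. }
        simpl. destruct (Nat.eq_dec k (Datatypes.S n)) as [->|Nk].
        { pose proof (cond_pos_sum (fun k => e * (chi x' (fst (p k)) r * chi y' (snd (p k)) r))%R n TP). lra. }
        { specialize (IH ltac:(lia)). specialize (TP (Datatypes.S n)). lra. }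
    + rewrite (goursat f x' y' h Hf Hh), Cmod_0.
      * now apply cond_pos_sum.
      * intros w Hw. apply HD. intros Sw. apply No. now exists w.
  - eapply Rle_trans; [apply chi_double_count; lra|].
    assert (rh : (2 * r / h = 2 * (l + rho) / l)%R) by (unfold r, h; field; lra).
    rewrite rh. fold Q.
    replace eps with (K * omega)%R by (unfold omega; field; lra).
    unfold e, K, h.
    assert (INR (Datatypes.S (N + m)) <= (INR m + 1) * INR (Datatypes.S N)).
    { rewrite !S_INR, plus_INR. pose proof (pos_INR m). pose proof (pos_INR N). nra. }
    assert (Q2 : 0 <= Q ^ 2) by nra.
    replace (4 * l * (INR m + 1) * Q ^ 2 * omega)%R with
      ((INR m + 1) * INR (Datatypes.S N) * (4 * (l / INR (Datatypes.S N)) * omega * Q ^ 2))%R by (field; lra).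
    apply Rmult_le_compat_r; [|auto]. fold h. fold e. apply Rmult_le_pos; lra.
Qed.

(** Meant for the centre of a difference quotient, where continuity is known but differentiability
    is not. *)
Lemma thin_add_point (S : C -> Prop) (z0 : C) : thin S -> thin (fun z => S z \/ z = z0).
Proof.
  intros (rho & m & Hrho & H). exists rho, (Datatypes.S m). split; auto. intros N.
  destruct (H N) as [p Hp].
  exists (fun k => if Nat.leb k (N + m) then p k else z0). intros s [Ss| ->].
  - destruct (Hp s Ss) as [k [Hk Dk]]. exists k. split; [lia|].
    now rewrite (proj2 (Nat.leb_le _ _) Hk).
  - exists (N + Datatypes.S m)%nat. split; [lia|].
    replace (Nat.leb (N + Datatypes.S m) (N + m)) with false.
    2:{ symmetry. apply Nat.leb_gt. lia. }
    replace (z0 - z0) with (RtoC 0) by ring. rewrite Cmod_0.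
    apply Rle_div_r; [apply lt_0_INR; lia|lra].
Qed.

Lemma thin_loop (gam : R -> C) : regular_loop gam -> thin (onG gam).
Proof.
  intros Hreg. destruct (dgam_bounds gam Hreg) as (m & L & _ & HL & HmL).
  exists L, 0%nat. split; [lra|]. intros N.
  assert (HN : 0 < INR (S N)) by (apply lt_0_INR; lia).
  exists (fun k => gam (INR k / INR (S N))%R). intros s [t <-].
  destruct (reduce_mod_1 t) as [n Hn]. rewrite <- (periodic_IZR gam n t) by exact (proj1 Hreg).
  set (u := (t + IZR n)%R) in *.
  set (M := INR (S N)) in *.
  assert (Hu : 0 <= u * M < M).
  { split; [apply Rmult_le_pos; lra|]. rewrite <- (Rmult_1_l M) at 2. apply Rmult_lt_compat_r; lra. }
  destruct (base_Int_part (u * M)) as [I1 I2].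
  set (k := Int_part (u * M)) in *.
  assert (k0 : (0 <= k)%Z).
  { assert (-1 < k)%Z; [apply lt_IZR; lra|lia]. }
  exists (Z.to_nat k).
  assert (Ik : INR (Z.to_nat k) = IZR k) by (rewrite INR_IZR_INZ, Z2Nat.id; auto).
  split.
  - assert (LT : INR (Z.to_nat k) < INR (S N)) by (fold M; lra). apply INR_lt in LT. lia.
  - eapply Rle_trans; [apply (loop_lipschitz gam Hreg L); apply HmL|].
    unfold Rdiv at 2. apply Rmult_le_compat_l; [lra|]. rewrite Ik.
    replace (u - IZR k / M)%R with ((u * M - IZR k) * / M)%R by (field; lra).
    assert (PM : 0 < / M) by (apply Rinv_0_lt_compat; lra).
    rewrite Rabs_mult, (Rabs_pos_eq (/ M)) by lra.
    apply Rle_trans with (1 * / M)%R; [|lra].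
    apply Rmult_le_compat_r; [lra|]. apply Rabs_le. lra.
Qed.

(** * Difference quotients and Liouville's theorem *)

Definition slope (h : C -> C) (z0 D w : C) : C :=
  if excluded_middle_informative (w = z0) then D else (h w - h z0) / (w - z0).

Lemma slope_neq (h : C -> C) (z0 D w : C) : w <> z0 -> slope h z0 D w = (h w - h z0) / (w - z0).
Proof. intros H. unfold slope. destruct (excluded_middle_informative (w = z0)); tauto. Qed.

(** Away from z0, both the continuity and the derivative of the quotient follow from this identity,
    because w - z0 stays bounded below there. *)
Lemma slope_diff (h : C -> C) (z0 D z w : C) : z <> z0 -> w <> z0 ->
  slope h z0 D w - slope h z0 D z = ((h w - h z) - (w - z) * slope h z0 D z) / (w - z0).
Proof.
  intros Hz Hw. rewrite !slope_neq by auto. field. split; now apply Csub_neq_0.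
Qed.

Lemma near_neq (z0 z w : C) : Cmod (w - z) < Cmod (z - z0) / 2 ->
  Cmod (z - z0) / 2 <= Cmod (w - z0).
Proof.
  intros H. pose proof (Cmod_tri z w z0) as T. rewrite (Cmod_sub_sym z w) in T. lra.
Qed.

Lemma slope_ctsC (h : C -> C) (z0 D : C) : ctsC h -> is_derive_CC h z0 D -> ctsC (slope h z0 D).
Proof.
  intros Hh HD z eps He. destruct (classic (z = z0)) as [->|N].
  - destruct (proj1 (is_derive_CC_iff _ _ _) HD (eps / 2)%R ltac:(lra)) as [d [Hd K]].
    exists d. split; auto. intros w Hw.
    replace (slope h z0 D z0) with D.
    2:{ unfold slope. destruct (excluded_middle_informative (z0 = z0)); tauto. }
    destruct (classic (w = z0)) as [->|Nw].
    + unfold slope. destruct (excluded_middle_informative (z0 = z0)); [|tauto].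
      replace (D - D) with (RtoC 0) by ring. now rewrite Cmod_0.
    + rewrite slope_neq by auto. pose proof (Cmod_sub_gt_0 _ _ Nw) as P.
      replace ((h w - h z0) / (w - z0) - D) with ((h w - h z0 - (w - z0) * D) / (w - z0)).
      2:{ field. now apply Csub_neq_0. }
      eapply Rle_lt_trans; [apply (Cmod_div_le _ _ _ _ P (Rle_refl _) (K w Hw))|].
      replace (eps / 2 * Cmod (w - z0) / Cmod (w - z0))%R with (eps / 2)%R by (field; lra). lra.
  - set (a := Cmod (z - z0)). assert (Ha : 0 < a) by now apply Cmod_sub_gt_0.
    set (s := Cmod (slope h z0 D z)). assert (Hs : 0 <= s) by apply Cmod_ge_0.
    assert (e1 : 0 < eps * a / 8) by (apply Rdiv_lt_0_compat; nra).
    destruct (Hh z _ e1) as [d [Hd K]].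
    assert (e2 : 0 < eps * a / 8 / (s + 1)) by (apply Rdiv_lt_0_compat; lra).
    exists (Rmin d (Rmin (a / 2) (eps * a / 8 / (s + 1)))). split; [repeat apply Rmin_pos; lra|].
    intros w Hw.
    assert (W1 : Cmod (w - z) < d) by (eapply Rlt_le_trans; [exact Hw|apply Rmin_l]).
    assert (W2 : Cmod (w - z) < a / 2).
    { eapply Rlt_le_trans; [exact Hw|]. eapply Rle_trans; [apply Rmin_r|apply Rmin_l]. }
    assert (W3 : Cmod (w - z) < eps * a / 8 / (s + 1)).
    { eapply Rlt_le_trans; [exact Hw|]. eapply Rle_trans; [apply Rmin_r|apply Rmin_r]. }
    pose proof (near_neq z0 z w W2) as B. fold a in B.
    assert (Nw : w <> z0).
    { intros ->. replace (z0 - z0) with (RtoC 0) in B by ring. rewrite Cmod_0 in B. lra. }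
    rewrite slope_diff by auto.
    assert (Q : Cmod (h w - h z - (w - z) * slope h z0 D z) <= eps * a / 4).
    { eapply Rle_trans; [apply Cmod_sub_le|]. rewrite Cmod_mult. fold s.
      assert (Cmod (w - z) * s <= eps * a / 8).
      { replace (eps * a / 8)%R with (eps * a / 8 / (s + 1) * (s + 1))%R by (field; lra).
        apply Rmult_le_compat; try lra. apply Cmod_ge_0. }
      specialize (K w W1). lra. }
    eapply Rle_lt_trans; [apply (Cmod_div_le _ _ (eps * a / 4) (a / 2)); auto; lra|].
    replace (eps * a / 4 / (a / 2))%R with (eps / 2)%R by (field; lra). lra.
Qed.

Lemma slope_derive (h : C -> C) (z0 D z Dz : C) : z <> z0 -> is_derive_CC h z Dz ->
  is_derive_CC (slope h z0 D) z ((Dz - slope h z0 D z) / (z - z0)).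
Proof.
  intros N HD. apply is_derive_CC_iff. intros eps He.
  set (a := Cmod (z - z0)). assert (Ha : 0 < a) by now apply Cmod_sub_gt_0.
  set (D1 := (Dz - slope h z0 D z) / (z - z0)).
  set (s := Cmod D1). assert (Hs : 0 <= s) by apply Cmod_ge_0.
  assert (e1 : 0 < eps * a / 4) by (apply Rdiv_lt_0_compat; nra).
  destruct (proj1 (is_derive_CC_iff _ _ _) HD _ e1) as [d [Hd K]].
  assert (e2 : 0 < eps * a / 4 / (s + 1)) by (apply Rdiv_lt_0_compat; lra).
  exists (Rmin d (Rmin (a / 2) (eps * a / 4 / (s + 1)))). split; [repeat apply Rmin_pos; lra|].
  intros w Hw.
  assert (W1 : Cmod (w - z) < d) by (eapply Rlt_le_trans; [exact Hw|apply Rmin_l]).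
  assert (W2 : Cmod (w - z) < a / 2).
  { eapply Rlt_le_trans; [exact Hw|]. eapply Rle_trans; [apply Rmin_r|apply Rmin_l]. }
  assert (W3 : Cmod (w - z) < eps * a / 4 / (s + 1)).
  { eapply Rlt_le_trans; [exact Hw|]. eapply Rle_trans; [apply Rmin_r|apply Rmin_r]. }
  pose proof (near_neq z0 z w W2) as B. fold a in B.
  assert (Nw : w <> z0).
  { intros ->. replace (z0 - z0) with (RtoC 0) in B by ring. rewrite Cmod_0 in B. lra. }
  rewrite slope_diff by auto. specialize (K w W1).
  set (r := h w - h z - (w - z) * Dz) in *.
  replace ((h w - h z - (w - z) * slope h z0 D z) / (w - z0) - (w - z) * D1) with
    ((r - (w - z) * (w - z) * D1) / (w - z0)).
  2:{ assert (E : Dz = D1 * (z - z0) + slope h z0 D z) by (unfold D1; field; now apply Csub_neq_0).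
      unfold r. rewrite E. clearbody D1. field. now apply Csub_neq_0. }
  pose proof (Cmod_ge_0 (w - z)) as P.
  assert (Q : Cmod (r - (w - z) * (w - z) * D1) <= eps * a / 2 * Cmod (w - z)).
  { eapply Rle_trans; [apply Cmod_sub_le|]. rewrite !Cmod_mult. fold s.
    assert (Cmod (w - z) * s <= eps * a / 4).
    { replace (eps * a / 4)%R with (eps * a / 4 / (s + 1) * (s + 1))%R by (field; lra).
      apply Rmult_le_compat; lra. }
    nra. }
  eapply Rle_trans; [apply (Cmod_div_le _ _ (eps * a / 2 * Cmod (w - z)) (a / 2)); auto; lra|].
  right. field. lra.
Qed.

Lemma rect_ext (f g : C -> C) (x1 x2 y1 y2 : R) :
  (forall x, f (x, y1) = g (x, y1)) -> (forall x, f (x, y2) = g (x, y2)) ->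
  (forall y, f (x1, y) = g (x1, y)) -> (forall y, f (x2, y) = g (x2, y)) ->
  rect f x1 x2 y1 y2 = rect g x1 x2 y1 y2.
Proof.
  intros H1 H2 H3 H4. unfold rect.
  now rewrite (CInt_ext _ _ x1 x2 H1), (CInt_ext _ _ x1 x2 H2), (CInt_ext _ _ y1 y2 H3), (CInt_ext _ _ y1 y2 H4).
Qed.

Lemma snd_CInt_ge (f : R -> C) (a b k : R) : a <= b -> cts f ->
  (forall t, a <= t <= b -> k <= snd (f t)) -> (b - a) * k <= snd (CInt f a b).
Proof.
  intros Hab Hf Hk. apply (is_RInt_le (fun _ => k) (fun t => snd (f t)) a b); auto.
  - apply is_RInt_cst.
  - now apply CInt_snd.
  - intros t Ht. apply Hk. lra.
Qed.

Lemma fst_CInt_ge (f : R -> C) (a b k : R) : a <= b -> cts f ->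
  (forall t, a <= t <= b -> k <= fst (f t)) -> (b - a) * k <= fst (CInt f a b).
Proof.
  intros Hab Hf Hk. apply (is_RInt_le (fun _ => k) (fun t => fst (f t)) a b); auto.
  - apply is_RInt_cst.
  - now apply CInt_fst.
  - intros t Ht. apply Hk. lra.
Qed.

Lemma pair_neq_fst (z0 : C) (x y : R) : x <> fst z0 -> (x, y) - z0 <> 0.
Proof. intros H. apply Csub_neq_0. intros E. apply H. now rewrite <- E. Qed.

Lemma pair_neq_snd (z0 : C) (x y : R) : y <> snd z0 -> (x, y) - z0 <> 0.
Proof. intros H. apply Csub_neq_0. intros E. apply H. now rewrite <- E. Qed.

Lemma cts_inv_h (z0 : C) (y : R) : y <> snd z0 -> cts (fun x => / ((x, y) - z0)).
Proof.
  intros H. apply (cts_inv (fun x => (x, y) - z0)).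
  - apply (cts_minus (fun x => (x, y)) (fun _ => z0)); [apply cts_id_h|apply cts_const].
  - intros x. now apply pair_neq_snd.
Qed.

Lemma cts_inv_v (z0 : C) (x : R) : x <> fst z0 -> cts (fun y => / ((x, y) - z0)).
Proof.
  intros H. apply (cts_inv (fun y => (x, y) - z0)).
  - apply (cts_minus (fun y => (x, y)) (fun _ => z0)); [apply cts_id_v|apply cts_const].
  - intros y. now apply pair_neq_fst.
Qed.

(* Only a lower bound on the imaginary part of the value 2 pi i is needed. *)
Lemma rect_inv_lower_bound (x0 y0 r : R) : 0 < r ->
  4 <= Cmod (rect (fun w => / (w - (x0, y0))) (x0 - r) (x0 + r) (y0 - r) (y0 + r)).
Proof.
  intros Hr. eapply Rle_trans; [|apply Im_le_Cmod]. eapply Rle_trans; [|apply Rle_abs].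
  unfold rect.
  set (I1 := CInt _ (x0 - r) (x0 + r)). set (I2 := CInt _ (x0 - r) (x0 + r)).
  set (I3 := CInt _ (y0 - r) (y0 + r)). set (I4 := CInt _ (y0 - r) (y0 + r)).
  assert (E : (snd (I1 - I2 + Ci * (I3 - I4))%C = snd I1 - snd I2 + (fst I3 - fst I4))%R).
  { unfold Ci, Cminus, Cplus, Copp, Cmult; simpl. ring. }
  rewrite E.
  (* Each side contributes the integral of r / (u^2 + r^2) over a length 2 r, hence at least 1
     (exactly pi / 2); four sides give the 4. *)
  assert (Q : forall u, Rabs u <= r -> / (2 * r) <= r / (u ^ 2 + r ^ 2)).
  { intros u Hu. assert (0 < u ^ 2 + r ^ 2) by nra. apply Rle_div_r; [auto|].
    apply Rabs_le_between in Hu. apply Rle_trans with (/ (2 * r) * (2 * r ^ 2))%R.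
    - apply Rmult_le_compat_l; [left; apply Rinv_0_lt_compat; lra|nra].
    - right. field. lra. }
  assert (R1 : 1 <= snd I1).
  { apply Rle_trans with ((x0 + r - (x0 - r)) * / (2 * r))%R; [right; field; lra|].
    apply snd_CInt_ge; [lra|apply cts_inv_h; simpl; lra|].
    intros x Hx. specialize (Q (x - x0)%R ltac:(apply Rabs_le; lra)).
    simpl. replace (- (y0 - r + - y0))%R with r by ring.
    replace (y0 - r + - y0)%R with (- r)%R by ring.
    eapply Rle_trans; [exact Q|]. right. f_equal. ring. }
  (* The top and left sides enter [rect] with a minus sign; negating them first turns their bounds
     into lower bounds. *)
  assert (R2 : 1 <= snd ((- (1)) * I2)).
  { unfold I2. rewrite <- CInt_mult by (apply cts_inv_h; simpl; lra).
    apply Rle_trans with ((x0 + r - (x0 - r)) * / (2 * r))%R; [right; field; lra|].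
    apply snd_CInt_ge; [lra| |].
    { apply (cts_mult (fun _ => - (1))); [apply cts_const|apply cts_inv_h; simpl; lra]. }
    intros x Hx. specialize (Q (x - x0)%R ltac:(apply Rabs_le; lra)).
    simpl. replace (y0 + r + - y0)%R with r by ring.
    eapply Rle_trans; [exact Q|]. right. unfold Rdiv.
    replace ((x + - x0) * ((x + - x0) * 1) + r * (r * 1))%R with ((x - x0) ^ 2 + r ^ 2)%R by ring.
    ring. }
  assert (R3 : 1 <= fst I3).
  { apply Rle_trans with ((y0 + r - (y0 - r)) * / (2 * r))%R; [right; field; lra|].
    apply fst_CInt_ge; [lra|apply cts_inv_v; simpl; lra|].
    intros y Hy. specialize (Q (y - y0)%R ltac:(apply Rabs_le; lra)).
    simpl. replace (x0 + r + - x0)%R with r by ring.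
    eapply Rle_trans; [exact Q|]. right. f_equal. ring. }
  assert (R4 : 1 <= fst ((- (1)) * I4)).
  { unfold I4. rewrite <- CInt_mult by (apply cts_inv_v; simpl; lra).
    apply Rle_trans with ((y0 + r - (y0 - r)) * / (2 * r))%R; [right; field; lra|].
    apply fst_CInt_ge; [lra| |].
    { apply (cts_mult (fun _ => - (1))); [apply cts_const|apply cts_inv_v; simpl; lra]. }
    intros y Hy. specialize (Q (y - y0)%R ltac:(apply Rabs_le; lra)).
    simpl. replace (x0 - r + - x0)%R with (- r)%R by ring.
    eapply Rle_trans; [exact Q|]. right. unfold Rdiv.
    replace (- r * (- r * 1) + (y + - y0) * ((y + - y0) * 1))%R with ((y - y0) ^ 2 + r ^ 2)%R by ring.
    ring. }
  assert (Sg : forall z : C, snd ((- (1)) * z) = (- snd z)%R /\ fst ((- (1)) * z) = (- fst z)%R).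
  { intros [a b]. unfold Copp, Cmult, RtoC; simpl. split; ring. }
  rewrite (proj1 (Sg I2)) in R2. rewrite (proj2 (Sg I4)) in R4. lra.
Qed.

(* Liouville: [(h w - h z0) / (w - z0)] has zero integral over large squares around
   [z0], where [h] itself contributes arbitrarily little. *)
Lemma thin_liouville (h : C -> C) (S : C -> Prop) (z0 : C) :
  ctsC h -> thin S -> (forall z, ~ S z -> exists D, is_derive_CC h z D) ->
  (forall eps : R, 0 < eps -> exists M, forall z, M < Cmod z -> Cmod (h z) < eps) ->
  ~ S z0 -> h z0 = 0.
Proof.
  intros Hh HS HD Hinf Hz0. destruct (HD z0 Hz0) as [D HD0].
  apply eq_of_Cmod_le_all. intros eps He. replace (h z0 - 0) with (h z0) by ring.
  destruct (Hinf (eps / 2)%R ltac:(lra)) as [M HM].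
  (* Points at distance at least r from z0 have modulus greater than M. *)
  set (r := (Rabs M + Cmod z0 + 1)%R).
  pose proof (Rabs_pos M). pose proof (Cmod_ge_0 z0).
  assert (Hr : 0 < r) by (unfold r; lra).
  assert (Far : forall w, r <= Cmod (w - z0) -> Cmod (h w) <= eps / 2).
  { intros w Hw. left. apply HM. pose proof (Cmod_sub_le w z0). pose proof (Rle_abs M). unfold r in Hw. lra. }
  set (q := slope h z0 D).
  assert (Q0 : square_int q (fst z0 - r) (snd z0 - r) (2 * r) = 0).
  { apply (thin_removable q (fun z => S z \/ z = z0)); [now apply slope_ctsC|now apply thin_add_point|lra|].
    intros w Hw. destruct (HD w) as [Dw HDw]; [tauto|].
    exists ((Dw - q w) / (w - z0)). apply slope_derive; auto. }
  unfold square_int in Q0.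
  replace (fst z0 - r + 2 * r)%R with (fst z0 + r)%R in Q0 by ring.
  replace (snd z0 - r + 2 * r)%R with (snd z0 + r)%R in Q0 by ring.
  set (K := fun w => / (w - z0)).
  assert (chh : forall y, cts (fun x => h (x, y))) by (intros; apply cts_horizontal; intros; apply Hh; auto).
  assert (chv : forall x, cts (fun y => h (x, y))) by (intros; apply cts_vertical; intros; apply Hh; auto).
  assert (cKh : forall y, y <> snd z0 -> cts (fun x => K (x, y))) by (intros; now apply cts_inv_h).
  assert (cKv : forall x, x <> fst z0 -> cts (fun y => K (x, y))) by (intros; now apply cts_inv_v).
  assert (chKh : forall y, y <> snd z0 -> cts (fun x => h (x, y) * K (x, y))).
  { intros y Hy. exact (cts_mult _ _ (chh y) (cKh y Hy)). }
  assert (chKv : forall x, x <> fst z0 -> cts (fun y => h (x, y) * K (x, y))).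
  { intros x Hx. exact (cts_mult _ _ (chv x) (cKv x Hx)). }
  assert (ccKh : forall y, y <> snd z0 -> cts (fun x => h z0 * K (x, y))).
  { intros y Hy. exact (cts_mult _ _ (cts_const (h z0)) (cKh y Hy)). }
  assert (ccKv : forall x, x <> fst z0 -> cts (fun y => h z0 * K (x, y))).
  { intros x Hx. exact (cts_mult _ _ (cts_const (h z0)) (cKv x Hx)). }
  assert (n1 : (snd z0 - r <> snd z0)%R) by lra. assert (n2 : (snd z0 + r <> snd z0)%R) by lra.
  assert (n3 : (fst z0 - r <> fst z0)%R) by lra. assert (n4 : (fst z0 + r <> fst z0)%R) by lra.
  assert (Eq : forall w, w - z0 <> 0 -> q w = h w * K w - h z0 * K w).
  { intros w Nw. unfold q, K. rewrite slope_neq.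
    - field. auto.
    - intros ->. apply Nw. ring. }
  rewrite (rect_ext q (fun w => h w * K w - h z0 * K w)) in Q0
    by (intros; apply Eq; (now apply pair_neq_fst) || (now apply pair_neq_snd)).
  rewrite (rect_minus (fun w => h w * K w) (fun w => h z0 * K w)) in Q0 by auto.
  rewrite (rect_mult (h z0) K) in Q0 by auto.
  pose proof (rect_inv_lower_bound (fst z0) (snd z0) r Hr) as LB.
  rewrite <- surjective_pairing in LB. fold K in LB.
  set (J := rect K (fst z0 - r) (fst z0 + r) (snd z0 - r) (snd z0 + r)) in *.
  set (I := rect (fun w => h w * K w) (fst z0 - r) (fst z0 + r) (snd z0 - r) (snd z0 + r)) in *.
  (* The perimeter 8 r times (eps / 2) / r. With |J| >= 4 and I = h z0 J this gives |h z0| <=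
     eps. *)
  assert (IB : Cmod I <= 4 * eps).
  { apply Rle_trans with (2 * (fst z0 + r - (fst z0 - r)) * (eps / 2 / r) + 2 * (snd z0 + r - (snd z0 - r)) * (eps / 2 / r))%R.
    2:{ right. field. lra. }
    assert (B : forall w, r <= Cmod (w - z0) -> Cmod (h w * K w) <= eps / 2 / r).
    { intros w Hw. apply (Cmod_div_le (h w) (w - z0)); auto. }
    assert (Bh : forall x y, Rabs (y - snd z0) = r -> Cmod (h (x, y) * K (x, y)) <= eps / 2 / r).
    { intros x y Hy. apply B. rewrite <- Hy. apply (Im_le_Cmod ((x, y) - z0)). }
    assert (Bv : forall x y, Rabs (x - fst z0) = r -> Cmod (h (x, y) * K (x, y)) <= eps / 2 / r).
    { intros x y Hx. apply B. rewrite <- Hx. apply (Re_le_Cmod ((x, y) - z0)). }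
    assert (A1 : forall c : R, Rabs (c - r - c) = r) by (intros c; replace (c - r - c)%R with (- r)%R by ring; rewrite Rabs_Ropp; apply Rabs_pos_eq; lra).
    assert (A2 : forall c : R, Rabs (c + r - c) = r) by (intros c; replace (c + r - c)%R with r by ring; apply Rabs_pos_eq; lra).
    apply (rect_bound (fun w => h w * K w)); auto; lra. }
  assert (E : I = h z0 * J).
  { replace I with (I - h z0 * J + h z0 * J) by ring. rewrite Q0. ring. }
  rewrite E, Cmod_mult in IB. pose proof (Cmod_ge_0 (h z0)). nra.
Qed.

(** * The Hilbert operator *)

Lemma holder_plus (sigma : R) (S : C -> Prop) (f g : C -> C) :
  holder sigma S f -> holder sigma S g -> holder sigma S (fun z => f z + g z).
Proof.
  intros [K1 H1] [K2 H2]. exists (K1 + K2)%R. intros z w Hz Hw N.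
  replace (f z + g z - (f w + g w)) with ((f z - f w) + (g z - g w)) by ring.
  eapply Rle_trans; [apply Cmod_triangle|]. specialize (H1 z w Hz Hw N). specialize (H2 z w Hz Hw N). lra.
Qed.

Lemma is_derive_CC_ext_ball (f g : C -> C) (z l : C) (d : R) : 0 < d ->
  (forall w, Cmod (w - z) < d -> f w = g w) -> is_derive_CC f z l -> is_derive_CC g z l.
Proof.
  intros Hd E H. apply is_derive_CC_iff. intros eps He.
  destruct (proj1 (is_derive_CC_iff _ _ _) H eps He) as [d1 [D1 K]].
  exists (Rmin d d1). split; [now apply Rmin_pos|]. intros w Hw.
  assert (Cmod (z - z) < d) by (replace (z - z) with (RtoC 0) by ring; now rewrite Cmod_0).
  rewrite <- !E; auto; [apply K|]; (eapply Rlt_le_trans; [exact Hw|]); [apply Rmin_r|apply Rmin_l].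
Qed.

Lemma is_derive_CC_cts (f : C -> C) (z l : C) : is_derive_CC f z l ->
  forall eps : R, 0 < eps -> exists d, 0 < d /\ forall w, Cmod (w - z) < d -> Cmod (f w - f z) < eps.
Proof.
  intros H eps He. destruct (proj1 (is_derive_CC_iff _ _ _) H 1%R ltac:(lra)) as [d [Hd K]].
  pose proof (Cmod_ge_0 l) as L0.
  assert (e2 : 0 < eps / (Cmod l + 2)) by (apply Rdiv_lt_0_compat; lra).
  exists (Rmin d (eps / (Cmod l + 2))). split; [now apply Rmin_pos|]. intros w Hw.
  assert (W1 : Cmod (w - z) < d) by (eapply Rlt_le_trans; [exact Hw|apply Rmin_l]).
  assert (W2 : Cmod (w - z) < eps / (Cmod l + 2)) by (eapply Rlt_le_trans; [exact Hw|apply Rmin_r]).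
  specialize (K w W1). pose proof (Cmod_le_sub (f w - f z) ((w - z) * l)) as T.
  rewrite Cmod_mult in T.
  assert ((Cmod l + 2) * Cmod (w - z) < eps).
  { replace eps with ((Cmod l + 2) * (eps / (Cmod l + 2)))%R by (field; lra). apply Rmult_lt_compat_l; lra. }
  pose proof (Cmod_ge_0 (w - z)). nra.
Qed.

Section Hilbert.
Context (gam : R -> C) (Hreg : regular_loop gam) (Hpos : pos_oriented gam).
Context (sigma : R) (Hsig : 0 < sigma < 1).
Notation npt := (normal_pt gam).
Notation E := (cauchy_int gam).

Lemma normal_pt_dist : exists L, 0 < L /\ forall t tau, Cmod (npt t tau - gam t) <= L * Rabs tau.
Proof.
  destruct (dgam_bounds gam Hreg) as (m & L & _ & HL & HmL). exists L. split; auto. intros t tau.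
  replace (npt t tau - gam t) with (Ci * RtoC tau * dgam gam t) by (unfold normal_pt; ring).
  rewrite !Cmod_mult, Cmod_Ci, Cmod_R, Rmult_1_l, Rmult_comm.
  apply Rmult_le_compat_r; [apply Rabs_pos|apply HmL].
Qed.

Lemma onG_clos (z : C) : onG gam z -> clos (intD gam) z /\ clos (extD gam) z.
Proof.
  intros [t <-]. destruct normal_pt_dist as (L & HL & HD).
  destruct (sides_of_loop gam Hreg Hpos) as (tau0 & H0 & Sides).
  assert (A : forall eps : R, 0 < eps -> exists tau, 0 < tau <= tau0 /\ L * tau < eps).
  { intros eps He. exists (Rmin tau0 (eps / (2 * L))).
    assert (0 < eps / (2 * L)) by (apply Rdiv_lt_0_compat; lra).
    split; [split; [now apply Rmin_pos|apply Rmin_l]|].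
    apply Rle_lt_trans with (L * (eps / (2 * L)))%R.
    - apply Rmult_le_compat_l; [lra|apply Rmin_r].
    - replace (L * (eps / (2 * L)))%R with (eps / 2)%R by (field; lra). lra. }
  split; intros eps He; destruct (A eps He) as (tau & Htau & Lt).
  - exists (npt t tau). split; [apply Sides; auto|].
    eapply Rle_lt_trans; [apply HD|]. rewrite Rabs_pos_eq; lra.
  - exists (npt t (- tau)). split; [apply Sides; auto|].
    eapply Rle_lt_trans; [apply HD|]. rewrite Rabs_Ropp, Rabs_pos_eq; lra.
Qed.

(** On a disk missing the loop the winding number is constant, and its value 0 or 1 tells the sides
    apart. *)
Lemma sides_open (z : C) : ~ onG gam z -> exists d, 0 < d /\ forall w, Cmod (w - z) < d ->
  ~ onG gam w /\ (intD gam w <-> intD gam z) /\ (extD gam w <-> extD gam z).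
Proof.
  intros Hz. destruct (offG_dist gam Hreg z Hz) as [d [Hd D]]. exists d. split; auto.
  intros w Hw. assert (Ow : ~ onG gam w).
  { apply (dist_offG gam w (d - Cmod (w - z))); [lra|]. now apply dist_near. }
  split; auto.
  pose proof (wind_locally_constant gam Hreg z w d Hd D Hw) as W.
  assert (N : RtoC 1 <> 0) by (intros X; apply (f_equal fst) in X; simpl in X; lra).
  destruct (wind_0_or_1 gam Hreg z Hpos Hz) as [[E1 S1]|[E1 S1]];
  destruct (wind_0_or_1 gam Hreg w Hpos Ow) as [[E2 S2]|[E2 S2]]; try (exfalso; congruence);
  unfold intD in *; tauto.
Qed.

(** Far away the winding number has modulus less than 1, so it cannot be 1. *)
Lemma int_bounded : exists M, forall z, M < Cmod z -> extD gam z.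
Proof.
  destruct (cauchy_at_infinity gam Hreg (fun _ => 1) 1%R (cts_const 1) ltac:(lra)) as [M HM].
  destruct (periodic_bounded gam (loop_cts gam Hreg) (proj1 Hreg)) as [G [HG GB]].
  exists (Rmax M G). intros z Hz.
  assert (Oz : ~ onG gam z).
  { intros [t <-]. specialize (GB t). pose proof (Rmax_r M G). lra. }
  destruct (wind_0_or_1 gam Hreg z Hpos Oz) as [[_ S1]|[E1 _]]; auto.
  exfalso. rewrite wind_cauchy in E1. pose proof (Rmax_l M G).
  specialize (HM z ltac:(lra)). rewrite E1, Cmod_1 in HM. lra.
Qed.

(* A pair of one-sided holomorphic functions with equal boundary values is an entire
   function vanishing at infinity. *)
Lemma glue_zero (a b : C -> C) :
  holder sigma (clos (intD gam)) a -> holo (intD gam) a ->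
  holder sigma (clos (extD gam)) b -> holo (extD gam) b ->
  (forall eps : R, 0 < eps -> exists M : R, forall z, extD gam z -> M < Cmod z -> Cmod (b z) < eps) ->
  (forall z, onG gam z -> a z = b z) ->
  forall z, intD gam z -> a z = 0.
Proof.
  intros Ha Da Hb Db Hinf Hab z Hz.
  (* On the loop [h] takes the value of [b], which is also that of [a]; continuity there uses the
     Hölder bound from whichever side the nearby point belongs to. *)
  set (h := fun z => if excluded_middle_informative (intD gam z) then a z else b z).
  assert (hi : forall z, intD gam z -> h z = a z).
  { intros w Hw. unfold h. destruct (excluded_middle_informative (intD gam w)); tauto. }
  assert (he : forall z, ~ intD gam z -> h z = b z).
  { intros w Hw. unfold h. destruct (excluded_middle_informative (intD gam w)); tauto. }
  rewrite <- hi by auto.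
  assert (DD : forall w, ~ onG gam w -> exists D, is_derive_CC h w D).
  { intros w Ow. destruct (sides_open w Ow) as (d & Hd & Op).
    destruct (classic (intD gam w)) as [Iw|Iw].
    - destruct (Da w Iw) as [D HD]. exists D. apply (is_derive_CC_ext_ball a h w D d); auto.
      intros u Hu. symmetry. apply hi. now apply (Op u Hu).
    - assert (Ew : extD gam w) by (apply NNPP; intros X; apply Iw; split; auto).
      destruct (Db w Ew) as [D HD]. exists D. apply (is_derive_CC_ext_ball b h w D d); auto.
      intros u Hu. symmetry. apply he. intros Iu. apply Iw. now apply (Op u Hu). }
  apply (thin_liouville h (onG gam)); auto.
  - intros w eps Heps. destruct (classic (onG gam w)) as [Gw|Ow].
    2:{ destruct (DD w Ow) as [D HD]. now apply (is_derive_CC_cts h w D). }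
    destruct (onG_clos w Gw) as [Ci' Ce'].
    destruct (holder_bound _ _ _ (proj1 Hsig) Ha) as (K1 & HK1 & B1).
    destruct (holder_bound _ _ _ (proj1 Hsig) Hb) as (K2 & HK2 & B2).
    destruct (Rpower_small K1 (eps / 2) sigma (proj1 Hsig) HK1) as (r1 & Hr1 & R1); [lra|].
    destruct (Rpower_small K2 (eps / 2) sigma (proj1 Hsig) HK2) as (r2 & Hr2 & R2); [lra|].
    exists (Rmin r1 r2). split; [now apply Rmin_pos|]. intros u Hu.
    assert (U1 : Cmod (u - w) < r1) by (eapply Rlt_le_trans; [exact Hu|apply Rmin_l]).
    assert (U2 : Cmod (u - w) < r2) by (eapply Rlt_le_trans; [exact Hu|apply Rmin_r]).
    assert (hw : h w = b w) by (apply he; intros [X _]; auto).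
    destruct (classic (intD gam u)) as [Iu|Iu].
    + rewrite (hi u Iu), hw, <- Hab by auto.
      eapply Rle_lt_trans; [apply (B1 u w r1); auto; [now apply subset_clos|lra]|].
      specialize (R1 r1 ltac:(lra)). lra.
    + rewrite (he u Iu), hw.
      assert (clos (extD gam) u).
      { destruct (classic (onG gam u)) as [Gu|Gu]; [now apply onG_clos|].
        apply subset_clos. apply NNPP. intros X. apply Iu. split; auto. }
      eapply Rle_lt_trans; [apply (B2 u w r2); auto; lra|].
      specialize (R2 r2 ltac:(lra)). lra.
  - now apply thin_loop.
  - intros eps Heps. destruct (Hinf eps Heps) as [M HM]. destruct int_bounded as [M' HM'].
    exists (Rmax M M'). intros w Hw. pose proof (Rmax_l M M'). pose proof (Rmax_r M M').
    assert (Ew : extD gam w) by (apply HM'; lra).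
    rewrite he by (intros [_ X]; auto). apply HM; auto; lra.
  - apply Hz.
Qed.

Definition Ei (F : C -> C) : C -> C := lim_at (E F) (intD gam).
Definition Ee (F : C -> C) : C -> C := lim_at (E F) (extD gam).

Lemma Hop_Ei (F : C -> C) : Hop gam F = Ei F.
Proof. reflexivity. Qed.

Lemma Ei_holder (F : C -> C) : Lambda sigma gam F -> holder sigma (clos (intD gam)) (Ei F).
Proof. intros HF. apply holder_lim_at; auto. now apply (plemelj gam Hreg sigma Hsig F Hpos). Qed.

Lemma Ee_holder (F : C -> C) : Lambda sigma gam F -> holder sigma (clos (extD gam)) (Ee F).
Proof. intros HF. apply holder_lim_at; auto. now apply (plemelj gam Hreg sigma Hsig F Hpos). Qed.

Lemma Ei_int (F : C -> C) (z : C) : Lambda sigma gam F -> intD gam z -> Ei F z = E F z.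
Proof.
  intros HF Hz. apply (lim_at_on sigma); auto; [lra|]. now apply (plemelj gam Hreg sigma Hsig F Hpos).
Qed.

Lemma Ee_ext (F : C -> C) (z : C) : Lambda sigma gam F -> extD gam z -> Ee F z = E F z.
Proof.
  intros HF Hz. apply (lim_at_on sigma); auto; [lra|]. now apply (plemelj gam Hreg sigma Hsig F Hpos).
Qed.

Lemma Ei_holo (F : C -> C) : Lambda sigma gam F -> holo (intD gam) (Ei F).
Proof.
  intros HF z Hz. destruct (sides_open z (proj1 Hz)) as (d & Hd & Op).
  eexists. apply (is_derive_CC_ext_ball (E F) (Ei F) z _ d); auto.
  - intros w Hw. symmetry. apply Ei_int; auto. now apply (Op w Hw).
  - apply (cauchy_derive gam Hreg); [now apply (Lambda_ctsG gam Hreg sigma)|apply Hz].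
Qed.

Lemma Ee_holo (F : C -> C) : Lambda sigma gam F -> holo (extD gam) (Ee F).
Proof.
  intros HF z Hz. destruct (sides_open z (proj1 Hz)) as (d & Hd & Op).
  eexists. apply (is_derive_CC_ext_ball (E F) (Ee F) z _ d); auto.
  - intros w Hw. symmetry. apply Ee_ext; auto. now apply (Op w Hw).
  - apply (cauchy_derive gam Hreg); [now apply (Lambda_ctsG gam Hreg sigma)|apply Hz].
Qed.

Lemma Ee_infinity (F : C -> C) (eps : R) : Lambda sigma gam F -> 0 < eps ->
  exists M : R, forall z, extD gam z -> M < Cmod z -> Cmod (Ee F z) < eps.
Proof.
  intros HF He.
  destruct (cauchy_at_infinity gam Hreg F eps (Lambda_ctsG gam Hreg sigma Hsig F HF) He) as [M HM].
  exists M. intros z Hz Mz. rewrite Ee_ext by auto. auto.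
Qed.

(** Both one-sided limits are known to exist, so it suffices to approach along the normal at z,
    where the jump is estimated. The three thirds of eps go to the inner limit, the outer limit and
    the jump remainder. *)
Lemma Ei_Ee_jump (F : C -> C) (z : C) : Lambda sigma gam F -> onG gam z -> Ei F z = Ee F z + F z.
Proof.
  intros HF Gz. destruct (onG_clos z Gz) as [Cz Cz'].
  destruct (plemelj gam Hreg sigma Hsig F Hpos HF) as (_ & _ & tau1 & B & Ht1 & HB & J).
  destruct (holder_bound _ _ _ (proj1 Hsig) (Ei_holder F HF)) as (K1 & HK1 & B1).
  destruct (holder_bound _ _ _ (proj1 Hsig) (Ee_holder F HF)) as (K2 & HK2 & B2).
  destruct (sides_of_loop gam Hreg Hpos) as (tau2 & Ht2 & Sides).
  destruct normal_pt_dist as (L & HL & HD).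
  apply eq_of_Cmod_le_all. intros eps He.
  destruct (Rpower_small K1 (eps / 3) sigma (proj1 Hsig) HK1) as (r1 & Hr1 & R1); [lra|].
  destruct (Rpower_small K2 (eps / 3) sigma (proj1 Hsig) HK2) as (r2 & Hr2 & R2); [lra|].
  destruct (Rpower_small B (eps / 3) sigma (proj1 Hsig) HB) as (r3 & Hr3 & R3); [lra|].
  assert (exists tau, 0 < tau /\ tau <= tau1 /\ tau <= tau2 /\ L * tau <= r1 /\ L * tau <= r2 /\ tau <= r3)
    as (tau & T0 & T1 & T2 & T3 & T4 & T5).
  { set (x := Rmin (Rmin tau1 tau2) (Rmin r3 (Rmin (r1 / L) (r2 / L)))).
    assert (0 < r1 / L) by (apply Rdiv_lt_0_compat; lra).
    assert (0 < r2 / L) by (apply Rdiv_lt_0_compat; lra).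
    assert (X1 : x <= Rmin tau1 tau2) by apply Rmin_l.
    assert (X2 : x <= Rmin r3 (Rmin (r1 / L) (r2 / L))) by apply Rmin_r.
    pose proof (Rmin_l tau1 tau2). pose proof (Rmin_r tau1 tau2).
    pose proof (Rmin_l r3 (Rmin (r1 / L) (r2 / L))). pose proof (Rmin_r r3 (Rmin (r1 / L) (r2 / L))).
    pose proof (Rmin_l (r1 / L) (r2 / L)). pose proof (Rmin_r (r1 / L) (r2 / L)).
    exists x. split; [repeat apply Rmin_pos; lra|].
    assert (Y1 : x <= r1 / L) by lra. assert (Y2 : x <= r2 / L) by lra.
    apply Rle_div_r in Y1; [|auto]. apply Rle_div_r in Y2; [|auto].
    repeat split; lra. }
  destruct Gz as [t <-].
  destruct (Sides t tau ltac:(lra)) as [S1 S2].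
  specialize (J t tau ltac:(lra)).
  assert (D1 : Cmod (gam t - npt t tau) <= r1).
  { rewrite Cmod_sub_sym. eapply Rle_trans; [apply HD|]. rewrite Rabs_pos_eq; lra. }
  assert (D2 : Cmod (npt t (- tau) - gam t) <= r2).
  { eapply Rle_trans; [apply HD|]. rewrite Rabs_Ropp, Rabs_pos_eq; lra. }
  pose proof (B1 (gam t) (npt t tau) r1 Cz (subset_clos _ _ S1) Hr1 D1) as A1.
  pose proof (B2 (npt t (- tau)) (gam t) r2 (subset_clos _ _ S2) Cz' Hr2 D2) as A2.
  rewrite (Ei_int F _ HF S1) in A1. rewrite (Ee_ext F _ HF S2) in A2.
  specialize (R1 r1 ltac:(lra)). specialize (R2 r2 ltac:(lra)). specialize (R3 tau ltac:(lra)).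
  replace (Ei F (gam t) - (Ee F (gam t) + F (gam t))) with
    ((Ei F (gam t) - E F (npt t tau)) + (E F (npt t (- tau)) - Ee F (gam t)) +
     (E F (npt t tau) - E F (npt t (- tau)) - F (gam t))) by ring.
  eapply Rle_trans; [apply Cmod_triangle|].
  pose proof (Cmod_triangle (Ei F (gam t) - E F (npt t tau)) (E F (npt t (- tau)) - Ee F (gam t))). lra.
Qed.

Lemma inA_Lambda (F : C -> C) : inA sigma gam F -> Lambda sigma gam F.
Proof.
  intros (f & Hf & _ & Ef). apply (holder_ext sigma _ f); auto.
  apply (holder_subset sigma _ (clos (intD gam))); auto. intros z Gz. now apply onG_clos.
Qed.

Lemma inA'_Lambda (F : C -> C) : inA' sigma gam F -> Lambda sigma gam F.
Proof.
  intros (f & Hf & _ & _ & Ef). apply (holder_ext sigma _ f); auto.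
  apply (holder_subset sigma _ (clos (extD gam))); auto. intros z Gz. now apply onG_clos.
Qed.

Lemma Hop_inA (F : C -> C) (z : C) : inA sigma gam F -> onG gam z -> Hop gam F z = F z.
Proof.
  intros HA Gz. pose proof (inA_Lambda F HA) as HF. destruct HA as (f & Hf & Df & Ef).
  rewrite <- (Ef z Gz), Hop_Ei. unfold Ei.
  apply (lim_at_eq sigma); auto; [lra| |now apply onG_clos].
  intros w Hw. rewrite <- Ei_int by auto.
  assert (Z : Ei F w + - f w = 0).
  { apply (glue_zero (fun w => Ei F w + - f w) (Ee F)); auto.
    - apply holder_plus; [now apply Ei_holder|now apply holder_opp].
    - intros u Hu. apply (ex_derive_minus (K := C_AbsRing) (V := C_NormedModule)); [now apply Ei_holo|now apply Df].
    - now apply Ee_holder.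
    - now apply Ee_holo.
    - intros eps He. now apply Ee_infinity.
    - intros u Gu. rewrite (Ei_Ee_jump F u HF Gu), (Ef u Gu). ring. }
  replace (Ei F w) with (Ei F w + - f w + f w) by ring. rewrite Z. ring.
Qed.

Lemma Hop_inA' (G : C -> C) (z : C) : inA' sigma gam G -> onG gam z -> Hop gam G z = 0.
Proof.
  intros HA Gz. pose proof (inA'_Lambda G HA) as HF. destruct HA as (g & Hg & Dg & Ig & Eg).
  rewrite Hop_Ei. unfold Ei.
  apply (lim_at_eq sigma (E G) (fun _ => 0)); [lra|apply holder_const| |now apply onG_clos].
  intros w Hw. rewrite <- Ei_int by auto.
  apply (glue_zero (Ei G) (fun w => Ee G w + g w)); auto.
  - now apply Ei_holder.
  - now apply Ei_holo.
  - apply holder_plus; [now apply Ee_holder|auto].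
  - intros u Hu. apply (ex_derive_plus (K := C_AbsRing) (V := C_NormedModule)); [now apply Ee_holo|now apply Dg].
  - intros eps He. destruct (Ee_infinity G (eps / 2) HF ltac:(lra)) as [M1 H1].
    destruct (Ig (eps / 2)%R ltac:(lra)) as [M2 H2].
    exists (Rmax M1 M2). intros u Hu Mu. pose proof (Rmax_l M1 M2). pose proof (Rmax_r M1 M2).
    specialize (H1 u Hu ltac:(lra)). specialize (H2 u Hu ltac:(lra)).
    eapply Rle_lt_trans; [apply Cmod_triangle|]. lra.
  - intros u Gu. rewrite (Ei_Ee_jump G u HF Gu), (Eg u Gu). ring.
Qed.

Lemma Hop_range (F : C -> C) : Lambda sigma gam F -> inA sigma gam (Hop gam F).
Proof.
  intros HF. exists (Ei F). split; [now apply Ei_holder|split; [now apply Ei_holo|auto]].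
Qed.

Lemma Hop_corange (F : C -> C) : Lambda sigma gam F -> inA' sigma gam (fun z => F z - Hop gam F z).
Proof.
  intros HF. exists (fun z => - Ee F z). split; [|split; [|split]].
  - now apply holder_opp, Ee_holder.
  - intros z Hz. apply (ex_derive_opp (K := C_AbsRing) (V := C_NormedModule)). now apply Ee_holo.
  - intros eps He. destruct (Ee_infinity F eps HF He) as [M HM]. exists M. intros z Hz Mz.
    rewrite Cmod_opp. auto.
  - intros z Gz. rewrite Hop_Ei, (Ei_Ee_jump F z HF Gz). ring.
Qed.

(** The Cauchy integrals coincide as functions on the plane, so the conclusion is an equality of
    functions and can be used for rewriting. *)
Lemma Hop_ext (F G : C -> C) : (forall z, onG gam z -> F z = G z) -> Hop gam F = Hop gam G.
Proof.
  intros H. assert (X : E F = E G).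
  { extensionality z. rewrite !cauchy_lint. f_equal. apply lint_ext. intros t.
    rewrite H; auto. now exists t. }
  rewrite !Hop_Ei. unfold Ei. now rewrite X.
Qed.

Lemma inA_ext (F G : C -> C) : (forall z, onG gam z -> F z = G z) -> inA sigma gam F -> inA sigma gam G.
Proof.
  intros H (f & Hf & Df & Ef). exists f. split; [auto|split; [auto|]].
  intros z Gz. now rewrite Ef, H.
Qed.

Lemma inA'_ext (F G : C -> C) : (forall z, onG gam z -> F z = G z) -> inA' sigma gam F -> inA' sigma gam G.
Proof.
  intros H (f & Hf & Df & If & Ef). exists f. split; [auto|split; [auto|split; [auto|]]].
  intros z Gz. now rewrite Ef, H.
Qed.

Lemma inA_const (c : C) : inA sigma gam (fun _ => c).
Proof.
  exists (fun _ => c). split; [apply holder_const|split; auto].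
  intros z _. apply ex_derive_const.
Qed.

(** A constant also belongs to A, so H both fixes it and sends it to 0. *)
Lemma inA'_const (G : C -> C) (c : C) : inA' sigma gam G -> (forall z, onG gam z -> G z = c) -> c = 0.
Proof.
  intros HG Hc. assert (G0 : onG gam (gam 0%R)) by now exists 0%R.
  rewrite <- (Hop_inA' G (gam 0%R) HG G0), (Hop_ext G (fun _ => c) Hc).
  symmetry. apply (Hop_inA (fun _ => c)); auto. apply inA_const.
Qed.

Lemma not_nonconst (F : C -> C) : ~ nonconst gam F -> forall z, onG gam z -> F z = F (gam 0%R).
Proof.
  intros N z Gz. apply NNPP. intros X. apply N. exists z, (gam 0%R).
  split; [auto|split; [now exists 0%R|auto]].
Qed.

End Hilbert.

(** * Fixed points of Pi and conjugate pairs *)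

Theorem theorem1p20 (sigma : R) (gam : R -> C) :
  0 < sigma < 1 ->
  analytic_jordan gam ->
  pos_oriented gam ->
  ((exists F : C -> C, Lambda sigma gam F /\
      (forall z, onG gam z -> Piop gam F z = F z) /\
      (exists z, onG gam z /\ F z <> 0))
   <->
   (exists f g : C -> C, inA sigma gam f /\ inA' sigma gam g /\
      nonconst gam f /\ nonconst gam g /\
      (forall z, onG gam z -> f z = Cconj (g z))))
  /\
  (forall f g : C -> C, inA sigma gam f -> inA' sigma gam g ->
      nonconst gam f -> nonconst gam g ->
      (forall z, onG gam z -> f z = Cconj (g z)) ->
      (forall z, onG gam z -> Piop gam f z = f z) /\
      (forall z, onG gam z -> Piop gam g z = g z)).
Proof.
  intros Hsig Hj Hpos. pose proof (analytic_jordan_regular gam Hj) as Hreg.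
  (* Shared by the converse and the final claim. Conjugation swaps f and g on the loop, so Pi f = H
     f + conj (H g) = f and Pi g = H g + conj (H f) = conj f = g. *)
  assert (Fix : forall f g : C -> C, inA sigma gam f -> inA' sigma gam g ->
      (forall z, onG gam z -> f z = Cconj (g z)) ->
      (forall z, onG gam z -> Piop gam f z = f z) /\
      (forall z, onG gam z -> Piop gam g z = g z)).
  { intros f g Hf Hg Hfg.
    assert (Cf : Hop gam (Cop f) = Hop gam g).
    { apply Hop_ext. intros z Gz. unfold Cop. rewrite Hfg by auto. apply Cconj_conj. }
    assert (Cg : Hop gam (Cop g) = Hop gam f).
    { apply Hop_ext. intros z Gz. unfold Cop. now rewrite Hfg. }
    split; intros z Gz; unfold Piop; [rewrite Cf|rewrite Cg]; unfold Cop;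
      rewrite (Hop_inA' gam Hreg Hpos sigma Hsig g z Hg Gz), (Hop_inA gam Hreg Hpos sigma Hsig f z Hf Gz).
    - replace (Cconj 0) with (RtoC 0) by (unfold Cconj, RtoC; simpl; f_equal; ring). ring.
    - rewrite Hfg, Cconj_conj by auto. ring. }
  split; [split|].
  - intros (F & HF & HPi & z1 & Gz1 & Fz1).
    assert (HCF : Lambda sigma gam (Cop F)) by (apply holder_conj; exact HF).
    set (f1 := Hop gam (Cop F)). set (g1 := fun z => F z - Hop gam F z).
    assert (A1 : inA sigma gam f1) by now apply Hop_range.
    assert (A2 : inA' sigma gam g1) by now apply Hop_corange.
    (* The equation Pi F = F says precisely that F - H F is the conjugate of H (conj F). *)
    assert (Eg : forall z, onG gam z -> g1 z = Cconj (f1 z)).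
    { intros z Gz. unfold g1. rewrite <- (HPi z Gz) at 1. unfold Piop, Cop at 1. fold f1. ring. }
    assert (Efg : forall z, onG gam z -> f1 z = Cconj (g1 z)).
    { intros z Gz. rewrite Eg by auto. now rewrite Cconj_conj. }
    destruct (classic (nonconst gam f1)) as [N|N].
    + exists f1, g1. split; [auto|split; [auto|split; [auto|split; [|auto]]]].
      destruct N as (z & w & Gz & Gw & Nzw). exists z, w. split; [auto|split; [auto|]].
      intros X. apply Nzw. now rewrite !Efg, X.
    + assert (K : forall z, onG gam z -> g1 z = Cconj (f1 (gam 0%R))).
      { intros z Gz. now rewrite Eg, (not_nonconst gam f1 N z Gz). }
      pose proof (inA'_const gam Hreg Hpos sigma Hsig g1 _ A2 K) as K0. rewrite K0 in K.
      assert (f0 : forall z, onG gam z -> f1 z = 0).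
      { intros z Gz. rewrite Efg, K by auto. unfold Cconj, RtoC; simpl. f_equal; ring. }
      assert (FA : inA sigma gam F).
      { apply (inA_ext gam sigma (Hop gam F)); [|now apply Hop_range].
        intros z Gz. specialize (K z Gz). unfold g1 in K.
        replace (Hop gam F z) with (F z - (F z - Hop gam F z)) by ring. rewrite K. ring. }
      (* As H (conj F) vanishes on the loop, conj F coincides with its component in A'. *)
      assert (CA : inA' sigma gam (Cop F)).
      { apply (inA'_ext gam sigma (fun z => Cop F z - Hop gam (Cop F) z)); [|now apply Hop_corange].
        intros z Gz. fold f1. rewrite f0 by auto. ring. }
      (* Were F constant, conj F would be a constant in A', hence 0, against F z1 <> 0. *)
      assert (NF : nonconst gam F).
      { apply NNPP. intros X. apply Fz1.
        assert (KC : forall z, onG gam z -> Cop F z = Cconj (F (gam 0%R))).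
        { intros z Gz. unfold Cop. now rewrite (not_nonconst gam F X z Gz). }
        pose proof (inA'_const gam Hreg Hpos sigma Hsig (Cop F) _ CA KC) as Z.
        rewrite (not_nonconst gam F X z1 Gz1), <- (Cconj_conj (F (gam 0%R))), Z.
        unfold Cconj, RtoC; simpl. f_equal; ring. }
      exists F, (Cop F). split; [auto|split; [auto|split; [auto|split]]].
      * destruct NF as (z & w & Gz & Gw & Nzw). exists z, w. split; [auto|split; [auto|]].
        unfold Cop. intros X. apply Nzw. rewrite <- (Cconj_conj (F z)), X. apply Cconj_conj.
      * intros z Gz. unfold Cop. now rewrite Cconj_conj.
  - intros (f & g & Hf & Hg & Nf & Ng & Hfg). exists f.
    split; [now apply (inA_Lambda gam Hreg Hpos)|split; [now apply (Fix f g)|]].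
    (* Of two distinct values of f at least one is nonzero. *)
    destruct Nf as (z & w & Gz & Gw & Nzw). destruct (classic (f z = 0)) as [Z|Z].
    + exists w. split; auto. congruence.
    + now exists z.
  - intros f g Hf Hg _ _ Hfg. now apply Fix.
Qed.
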